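(* Assume $\operatorname{rank}\mathfrak g\ge 2$ and let $M\in\mathfrak A$ be torsion free as a $U(\mathfrak h)$-module. Then $\mathcal W(M)$ is an $(\mathfrak h^*\setminus\operatorname{Supp}\mathcal W_1(M))$-coherent family of degree equal to $\operatorname{rank}M$.
   Context: $\mathfrak g$ is a finite-dimensional simple complex Lie algebra with Cartan subalgebra $\mathfrak h$; $U(\cdot)$ is the universal enveloping algebra; $\mathcal A=U(\mathfrak g)_0$ is the commutant of $U(\mathfrak h)$ in $U(\mathfrak g)$. $\mathfrak A$ is the category of finitely generated $U(\mathfrak g)$-modules that are finitely generated as $U(\mathfrak h)$-modules. For $M\in\mathfrak A$, $\operatorname{rank}M=\dim_{K}(M\otimes_{U(\mathfrak h)}K)$ with $K=\operatorname{Frac}U(\mathfrak h)$. For $\lambda\in\mathfrak h^*$, $\mathfrak m_\lambda\subset U(\mathfrak h)$ is the kernel of the algebra homomorphism $U(\mathfrak h)\to\mathbb C$ extending $\lambda$. The weighting functor is $\mathcal W(M)=\bigoplus_{\lambda\in\mathfrak h^*}M/\mathfrak m_\lambda M$, where $x_\alpha\in\mathfrak g_\alpha$ acts by $x_\alpha\cdot(m+\mathfrak m_\lambda M)=x_\alpha m+\mathfrak m_{\lambda+\alpha}M$ and $\mathfrak h$ acts on $M/\mathfrak m_\lambda M$ by $\lambda$. $\mathcal W_1$ is its first left derived functor on $\mathfrak g$-modules; $\mathcal W_1(M)$ is the direct sum of its weight spaces $\mathcal W_1(M)_\lambda\simeq\operatorname{Tor}_1^{U(\mathfrak h)}(M,U(\mathfrak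 h)/\mathfrak m_\lambda)$, and $\operatorname{Supp}\mathcal W_1(M)=\{\lambda\mid\mathcal W_1(M)_\lambda\neq0\}$. A weight module is a $\mathfrak g$-module that is the direct sum of its $\mathfrak h$-weight spaces, all finite dimensional. For a subset $U\subseteq\mathfrak h^*$ with finite complement, a weight module $\mathcal M$ is a $U$-coherent family of degree $d$ if (i) $\dim\mathcal M_\lambda=d$ for all $\lambda\in U$, and (ii) for every $u\in\mathcal A$ the function $\lambda\mapsto\operatorname{tr}(u|_{\mathcal M_\lambda})$ is polynomial on $U$, i.e. coincides on $U$ with a polynomial function on $\mathfrak h^*$. *)

(* Defs.v *)
From HB Require Import structures.
From mathcomp Require Import all_boot all_order all_algebra.
From mathcomp Require Import boolp classical_sets cardinality reals.
From mathcomp Require Import complex finmap.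
From mathcomp.multinomials Require mpoly.
From mathcomp.multinomials Require Import monalg.

Set Implicit Arguments.
Unset Strict Implicit.
Unset Printing Implicit Defensive.

Import GRing.Theory.
Local Open Scope ring_scope.
Local Open Scope quotient_scope.

Definition restr (A B : pzRingType) (f : {rmorphism A -> B}) (M : lmodType B)
  : Type := M.

Section Restr.
Variables (A B : pzRingType) (f : {rmorphism A -> B}) (M : lmodType B).

HB.instance Definition _ := GRing.Zmodule.on (restr f M).

Definition restr_scale (a : A) (m : restr f M) : restr f M := f a *: (m : M).

Fact restr_scaleA a b v :
  restr_scale a (restr_scale b v) = restr_scale (a * b) v.
Proof. by rewrite /restr_scale rmorphM scalerA. Qed.
Fact restr_scale1 : left_id 1 restr_scale.
Proof. by move=> v; rewrite /restr_scale rmorph1 scale1r. Qed.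
Fact restr_scaleDr : right_distributive restr_scale +%R.
Proof. by move=> a u v; rewrite /restr_scale scalerDr. Qed.
Fact restr_scaleDl v : {morph restr_scale^~ v : a b / a + b}.
Proof. by move=> a b; rewrite /restr_scale rmorphD scalerDl. Qed.

HB.instance Definition _ := GRing.Zmodule_isLmodule.Build A (restr f M)
  restr_scaleA restr_scale1 restr_scaleDr restr_scaleDl.
End Restr.

Record submodule (A : pzRingType) (M : lmodType A) := Submodule {
  in_sub :> M -> Prop;
  sub0P : in_sub 0;
  subPP : forall a x y, in_sub x -> in_sub y -> in_sub (a *: x + y) }.

Section Quotient.
Variables (A : pzRingType) (M : lmodType A) (S : submodule M).

Definition mq_equiv (x y : M) : bool := `[< S (x - y) >].

Fact subD x y : S x -> S y -> S (x + y).
Proof. by move=> Sx Sy; rewrite -[x]scale1r; apply: subPP. Qed.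
Fact subZ a x : S x -> S (a *: x).
Proof. by move=> Sx; rewrite -[_ *: _]addr0; apply: subPP => //; apply: sub0P. Qed.
Fact subN x : S x -> S (- x).
Proof. by move=> Sx; rewrite -scaleN1r; apply: subZ. Qed.

Fact mq_equiv_is_equiv : equiv_class_of mq_equiv.
Proof.
split=> [x|x y|y x z]; rewrite /mq_equiv.
- by rewrite subrr; apply/asboolP/sub0P.
- by apply/asboolP/asboolP => /subN; rewrite opprB.
- move=> /asboolP xy /asboolP yz; apply/asboolP.
  by rewrite -[x](addrNK y) -addrA; apply: subD.
Qed.
Canonical mq_equiv_equiv := EquivRelPack mq_equiv_is_equiv.

Definition modquot : Type := {eq_quot mq_equiv}.
HB.instance Definition _ := Choice.on modquot.

Definition mqpi (x : M) : modquot := \pi_({eq_quot mq_equiv}) x.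
Definition mqrepr (q : modquot) : M := repr (q : {eq_quot mq_equiv}).

Lemma mqreprK q : mqpi (mqrepr q) = q.
Proof. exact: reprK. Qed.

Lemma mqpiP x y : mqpi x = mqpi y <-> S (x - y).
Proof.
split=> [/eqP|Sxy]; first by rewrite /mqpi eqmodE /= => /asboolP.
by apply/eqP; rewrite /mqpi eqmodE /=; apply/asboolP.
Qed.

Lemma mqreprP x : S (mqrepr (mqpi x) - x).
Proof. by apply/mqpiP; rewrite mqreprK. Qed.

Definition mq_zero := mqpi 0.
Definition mq_add p q := mqpi (mqrepr p + mqrepr q).
Definition mq_opp p := mqpi (- mqrepr p).
Definition mq_scale a p := mqpi (a *: mqrepr p).

Fact mq_addE x y : mq_add (mqpi x) (mqpi y) = mqpi (x + y).
Proof. by apply/mqpiP; rewrite opprD addrACA; apply: subD; apply: mqreprP. Qed.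
Fact mq_oppE x : mq_opp (mqpi x) = mqpi (- x).
Proof. by apply/mqpiP; rewrite -opprD; apply: subN; apply: mqreprP. Qed.
Fact mq_scaleE a x : mq_scale a (mqpi x) = mqpi (a *: x).
Proof. by apply/mqpiP; rewrite -scalerBr; apply: subZ; apply: mqreprP. Qed.

Fact mq_addA : associative mq_add.
Proof.
move=> x y z; rewrite -[x]mqreprK -[y]mqreprK -[z]mqreprK !mq_addE.
by rewrite addrA.
Qed.
Fact mq_addC : commutative mq_add.
Proof. by move=> x y; rewrite -[x]mqreprK -[y]mqreprK !mq_addE addrC. Qed.
Fact mq_add0 : left_id mq_zero mq_add.
Proof. by move=> x; rewrite -[x]mqreprK mq_addE add0r. Qed.
Fact mq_addN : left_inverse mq_zero mq_opp mq_add.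
Proof. by move=> x; rewrite -[x]mqreprK mq_oppE mq_addE addNr. Qed.
HB.instance Definition _ :=
  GRing.isZmodule.Build modquot mq_addA mq_addC mq_add0 mq_addN.

Fact mq_scaleA a b v : mq_scale a (mq_scale b v) = mq_scale (a * b) v.
Proof. by rewrite -[v]mqreprK !mq_scaleE scalerA. Qed.
Fact mq_scale1 : left_id 1 mq_scale.
Proof. by move=> v; rewrite -[v]mqreprK mq_scaleE scale1r. Qed.
Fact mq_scaleDr : right_distributive mq_scale +%R.
Proof.
move=> a u v; rewrite -[u]mqreprK -[v]mqreprK.
rewrite (mq_addE : forall x y, mqpi x + mqpi y = _) !mq_scaleE scalerDr.
by rewrite (mq_addE : forall x y, mqpi x + mqpi y = _).
Qed.
Fact mq_scaleDl v : {morph mq_scale^~ v : a b / a + b}.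
Proof.
move=> a b; rewrite /= -[v]mqreprK !mq_scaleE.
by rewrite (mq_addE : forall x y, mqpi x + mqpi y = _) scalerDl.
Qed.
HB.instance Definition _ := GRing.Zmodule_isLmodule.Build A modquot
  mq_scaleA mq_scale1 mq_scaleDr mq_scaleDl.

Fact mqpi_is_linear : linear mqpi.
Proof.
move=> a x y.
rewrite -(mq_addE : forall x y, mqpi x + mqpi y = _).
by rewrite -(mq_scaleE : forall a x, a *: mqpi x = _).
Qed.
HB.instance Definition _ := GRing.isLinear.Build A M modquot _ mqpi
  mqpi_is_linear.
End Quotient.

Section Span.
Variables (A : pzRingType) (M : lmodType A) (E : set M).

Definition in_span (x : M) : Prop :=
  exists n (a : 'I_n -> A) (e : 'I_n -> M),
    (forall i, E (e i)) /\ x = \sum_i a i *: e i.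

Fact in_span0 : in_span 0.
Proof. by exists 0%N, (fun=> 0), (fun=> 0); split=> [[]|]//; rewrite big_ord0. Qed.

Fact in_spanP a x y : in_span x -> in_span y -> in_span (a *: x + y).
Proof.
move=> [n [c [e [Ee ->]]]] [n' [c' [e' [Ee' ->]]]].
exists (n + n')%N.
exists (fun i => match split i with inl j => a * c j | inr j => c' j end).
exists (fun i => match split i with inl j => e j | inr j => e' j end).
split=> [i|]; first by case: (split i).
rewrite big_split_ord scaler_sumr; congr (_ + _); apply: eq_bigr => i _.
  by rewrite (unsplitK (inl i)) scalerA.
by rewrite (unsplitK (inr i)).
Qed.

Definition span_sub : submodule M := Submodule in_span0 in_spanP.
End Span.

Section Kernel.
Variables (A : pzRingType) (M N : lmodType A) (f : {linear M -> N}).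

Definition kerm : Type := {x : M | f x == 0}.
HB.instance Definition _ := Choice.on kerm.

Definition kerm_pred : {pred M} := fun x => f x == 0.
Fact kerm_submod : submod_closed kerm_pred.
Proof.
split=> [|a x y]; first by rewrite /kerm_pred unfold_in linear0.
by rewrite !unfold_in linearP => /eqP -> /eqP ->; rewrite scaler0 addr0.
Qed.
HB.instance Definition _ := GRing.isSubmodClosed.Build A M kerm_pred kerm_submod.
HB.instance Definition _ := SubChoice.copy kerm {x : M | kerm_pred x}.
HB.instance Definition _ := [SubChoice_isSubLmodule of kerm by <:].
End Kernel.

Section Homology.
Variables (A : pzRingType) (P2 P1 P0 : lmodType A).
Variables (d2 : {linear P2 -> P1}) (d1 : {linear P1 -> P0}).

Definition in_boundary (z : kerm d1) : Prop := exists y, d2 y = val z.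

Fact in_boundary0 : in_boundary 0.
Proof. by exists 0; rewrite linear0. Qed.
Fact in_boundaryP a x y :
  in_boundary x -> in_boundary y -> in_boundary (a *: x + y).
Proof. by move=> [u du] [v dv]; exists (a *: u + v); rewrite linearP du dv. Qed.
Definition boundary : submodule (kerm d1) := Submodule in_boundary0 in_boundaryP.

Definition homology := modquot boundary.
HB.instance Definition _ := GRing.Lmodule.on homology.
End Homology.

Section Fext.
Variables (A : nzRingType) (X : choiceType) (N : lmodType A) (f : X -> N).

Definition fext (p : {malg A[X]}) : N := \sum_(x <- msupp p) p@_x *: f x.

Fact fextE (s : seq X) p : uniq s -> {subset msupp p <= s} ->
  fext p = \sum_(x <- s) p@_x *: f x.
Proof.
move=> us ps; rewrite /fext [RHS](bigID (fun x => x \in msupp p)) /=.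
rewrite [X in _ = _ + X]big1 ?addr0; last first.
  by move=> x /mcoeff_outdom ->; rewrite scale0r.
rewrite -[RHS]big_filter; apply: perm_big; apply: uniq_perm.
- exact: fset_uniq.
- exact: filter_uniq.
- move=> x; rewrite mem_filter; case xp: (x \in msupp p) => //=.
  by apply/esym/ps.
Qed.

Fact fext_is_linear : linear fext.
Proof.
move=> a p q; pose s := undup (msupp p ++ msupp q ++ msupp (a *: p + q)).
have us : uniq s by exact: undup_uniq.
rewrite (@fextE s) // => [|x xs]; last by rewrite mem_undup !mem_cat xs !orbT.
rewrite (@fextE s p) // => [|x xs]; last by rewrite mem_undup !mem_cat xs.
rewrite (@fextE s q) // => [|x xs]; last by rewrite mem_undup !mem_cat xs !orbT.
rewrite scaler_sumr -big_split; apply: eq_bigr => x _ /=.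
by rewrite mcoeffD mcoeffZ scalerDl scalerA.
Qed.
HB.instance Definition _ := GRing.isLinear.Build A {malg A[X]} N _ fext
  fext_is_linear.
End Fext.

HB.mixin Record Lmodule_isLie (F : fieldType) L of GRing.Lmodule F L := {
  lie : L -> L -> L;
  lie_linearl : forall a x y z, lie (a *: x + y) z = a *: lie x z + lie y z;
  lie_linearr : forall a x y z, lie z (a *: x + y) = a *: lie z x + lie z y;
  liexx : forall x, lie x x = 0;
  lie_jacobi : forall x y z,
    lie x (lie y z) + lie y (lie z x) + lie z (lie x y) = 0 }.

#[short(type="lieAlgType")]
HB.structure Definition LieAlgebra (F : fieldType) :=
  {L of Lmodule_isLie F L & GRing.Lmodule F L}.

#[short(type="finLieAlgType")]
HB.structure Definition FinLieAlgebra (F : fieldType) :=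
  {L of LieAlgebra F L & Vector F L}.

Section LieTheory.
Variables (F : fieldType) (L : lieAlgType F).
Implicit Types x y z : L.

Fact lieDl x y z : lie (x + y) z = lie x z + lie y z.
Proof. by rewrite -[x in LHS]scale1r lie_linearl scale1r. Qed.
Fact lieDr x y z : lie z (x + y) = lie z x + lie z y.
Proof. by rewrite -[x in LHS]scale1r lie_linearr scale1r. Qed.
Fact lie0l z : lie 0 z = 0.
Proof. by apply: (@addrI _ (lie 0 z)); rewrite -lieDl !addr0. Qed.
Fact lie0r z : lie z 0 = 0.
Proof. by apply: (@addrI _ (lie z 0)); rewrite -lieDr !addr0. Qed.
Fact lieZl a x z : lie (a *: x) z = a *: lie x z.
Proof. by rewrite -[a *: x]addr0 lie_linearl lie0l addr0. Qed.
Fact lieZr a x z : lie z (a *: x) = a *: lie z x.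
Proof. by rewrite -[a *: x]addr0 lie_linearr lie0r addr0. Qed.
Fact lie_suml I (r : seq I) (P : pred I) (f : I -> L) z :
  lie (\sum_(i <- r | P i) f i) z = \sum_(i <- r | P i) lie (f i) z.
Proof. by apply: (big_morph (lie^~ z)) => [x y|]; rewrite ?lieDl ?lie0l. Qed.
Fact lie_sumr I (r : seq I) (P : pred I) (f : I -> L) z :
  lie z (\sum_(i <- r | P i) f i) = \sum_(i <- r | P i) lie z (f i).
Proof. by apply: (big_morph (lie z)) => [x y|]; rewrite ?lieDr ?lie0r. Qed.
Fact lieC x y : lie x y = - lie y x.
Proof.
apply/eqP; rewrite -addr_eq0; have := liexx (x + y).
by rewrite lieDl !lieDr !liexx add0r addr0 => ->.
Qed.
End LieTheory.

(** [uea L] is the unital associative [F]-algebra presented by the generators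
    [UVar x], for [x] in [L], and the relations [uvarP] and [uvar_lie]; the other
    clauses of [urel] are the congruence and algebra axioms. Its universal
    property is given by [ulift], [ulift_var] and [uea_ind]. *)
Section Enveloping.
Variables (F : fieldType) (L : lieAlgType F).

Inductive uterm :=
  | UVar of L | UScal of F | UAdd of uterm & uterm | UMul of uterm & uterm.

Inductive urel : uterm -> uterm -> Prop :=
  | urefl t : urel t t
  | usym s t : urel s t -> urel t s
  | utrans s t u : urel s t -> urel t u -> urel s u
  | uadd_congr s s' t t' : urel s s' -> urel t t' -> urel (UAdd s t) (UAdd s' t')
  | umul_congr s s' t t' : urel s s' -> urel t t' -> urel (UMul s t) (UMul s' t')
  | uaddA s t u : urel (UAdd s (UAdd t u)) (UAdd (UAdd s t) u)
  | uaddC s t : urel (UAdd s t) (UAdd t s)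
  | uadd0 t : urel (UAdd (UScal 0) t) t
  | uaddN t : urel (UAdd (UMul (UScal (-1)) t) t) (UScal 0)
  | umulA s t u : urel (UMul s (UMul t u)) (UMul (UMul s t) u)
  | umul1l t : urel (UMul (UScal 1) t) t
  | umul1r t : urel (UMul t (UScal 1)) t
  | umulDl s t u : urel (UMul (UAdd s t) u) (UAdd (UMul s u) (UMul t u))
  | umulDr s t u : urel (UMul u (UAdd s t)) (UAdd (UMul u s) (UMul u t))
  | uscalD a b : urel (UScal (a + b)) (UAdd (UScal a) (UScal b))
  | uscalM a b : urel (UScal (a * b)) (UMul (UScal a) (UScal b))
  | uscalC a t : urel (UMul (UScal a) t) (UMul t (UScal a))
  | uvarP a x y :
      urel (UVar (a *: x + y)) (UAdd (UMul (UScal a) (UVar x)) (UVar y))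
  | uvar_lie x y :
      urel (UVar (lie x y))
           (UAdd (UMul (UVar x) (UVar y))
                 (UMul (UScal (-1)) (UMul (UVar y) (UVar x)))).

HB.instance Definition _ := gen_eqMixin uterm.
HB.instance Definition _ := gen_choiceMixin uterm.

Definition ueq (s t : uterm) : bool := `[< urel s t >].
Fact ueq_is_equiv : equiv_class_of ueq.
Proof.
split=> [x|x y|y x z]; rewrite /ueq.
- exact/asboolP/urefl.
- by apply/asboolP/asboolP; apply: usym.
- by move=> /asboolP xy /asboolP yz; apply/asboolP/(utrans xy yz).
Qed.
Canonical ueq_equiv := EquivRelPack ueq_is_equiv.

Definition uea : Type := {eq_quot ueq}.
HB.instance Definition _ := Choice.on uea.

Definition upi (t : uterm) : uea := \pi_({eq_quot ueq}) t.
Definition urepr (u : uea) : uterm := repr (u : {eq_quot ueq}).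

Fact ureprK u : upi (urepr u) = u. Proof. exact: reprK. Qed.
Fact upiP s t : upi s = upi t <-> urel s t.
Proof.
split=> [/eqP|st]; first by rewrite /upi eqmodE /= => /asboolP.
by apply/eqP; rewrite /upi eqmodE /=; apply/asboolP.
Qed.
Fact ureprP t : urel (urepr (upi t)) t.
Proof. by apply/upiP; rewrite ureprK. Qed.

Definition u_scal c := upi (UScal c).
Definition u_add u v := upi (UAdd (urepr u) (urepr v)).
Definition u_mul u v := upi (UMul (urepr u) (urepr v)).
Definition u_opp u := u_mul (u_scal (-1)) u.
Definition u_scale c u := u_mul (u_scal c) u.

Fact u_addE s t : u_add (upi s) (upi t) = upi (UAdd s t).
Proof. by apply/upiP; apply: uadd_congr; apply: ureprP. Qed.
Fact u_mulE s t : u_mul (upi s) (upi t) = upi (UMul s t).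
Proof. by apply/upiP; apply: umul_congr; apply: ureprP. Qed.

Fact u_addA : associative u_add.
Proof.
move=> x y z; rewrite -[x]ureprK -[y]ureprK -[z]ureprK !u_addE.
exact/upiP/uaddA.
Qed.
Fact u_addC : commutative u_add.
Proof. move=> x y; rewrite -[x]ureprK -[y]ureprK !u_addE; exact/upiP/uaddC. Qed.
Fact u_add0 : left_id (u_scal 0) u_add.
Proof. move=> x; rewrite -[x]ureprK u_addE; exact/upiP/uadd0. Qed.
Fact u_addN : left_inverse (u_scal 0) u_opp u_add.
Proof.
move=> x; rewrite -[x]ureprK /u_opp u_mulE u_addE; exact/upiP/uaddN.
Qed.
HB.instance Definition _ :=
  GRing.isZmodule.Build uea u_addA u_addC u_add0 u_addN.

Fact u_mulA : associative u_mul.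
Proof.
move=> x y z; rewrite -[x]ureprK -[y]ureprK -[z]ureprK !u_mulE.
exact/upiP/umulA.
Qed.
Fact u_mul1 : left_id (u_scal 1) u_mul.
Proof. move=> x; rewrite -[x]ureprK u_mulE; exact/upiP/umul1l. Qed.
Fact u_mulr1 : right_id (u_scal 1) u_mul.
Proof. move=> x; rewrite -[x]ureprK u_mulE; exact/upiP/umul1r. Qed.
Fact u_mulDl : left_distributive u_mul u_add.
Proof.
move=> x y z; rewrite -[x]ureprK -[y]ureprK -[z]ureprK.
rewrite !(u_addE, u_mulE); exact/upiP/umulDl.
Qed.
Fact u_mulDr : right_distributive u_mul u_add.
Proof.
move=> x y z; rewrite -[x]ureprK -[y]ureprK -[z]ureprK.
rewrite !(u_addE, u_mulE); exact/upiP/umulDr.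
Qed.

Fixpoint uaug (t : uterm) : F := match t with
  | UVar _ => 0 | UScal c => c
  | UAdd s t => uaug s + uaug t | UMul s t => uaug s * uaug t end.
Fact uaugP s t : urel s t -> uaug s = uaug t.
Proof.
elim=> //=; do ?by move=> *; congruence.
- by move=> *; rewrite addrA.
- by move=> *; rewrite addrC.
- by move=> *; rewrite add0r.
- by move=> *; rewrite mulN1r addNr.
- by move=> *; rewrite mulrA.
- by move=> *; rewrite mul1r.
- by move=> *; rewrite mulr1.
- by move=> *; rewrite mulrDl.
- by move=> *; rewrite mulrDr.
- by move=> *; rewrite mulrC.
- by move=> *; rewrite mulr0 addr0.
- by move=> *; rewrite !mulr0 addr0.
Qed.
Fact u_1_neq0 : u_scal 1 != 0.
Proof. by apply/eqP => /upiP/uaugP/eqP; rewrite /= oner_eq0. Qed.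

HB.instance Definition _ := GRing.Zmodule_isNzRing.Build uea
  u_mulA u_mul1 u_mulr1 u_mulDl u_mulDr u_1_neq0.

Fact u_scaleA a b v : u_scale a (u_scale b v) = u_scale (a * b) v.
Proof.
rewrite /u_scale u_mulA u_mulE; congr u_mul; exact/esym/upiP/uscalM.
Qed.
Fact u_scaleDl v : {morph u_scale^~ v : a b / a + b}.
Proof.
move=> a b; rewrite -[RHS]/(u_add (u_mul _ _) (u_mul _ _)) -u_mulDl.
by congr u_mul; rewrite /u_scal u_addE; apply/upiP/uscalD.
Qed.
HB.instance Definition _ := GRing.Zmodule_isLmodule.Build F uea
  u_scaleA u_mul1 (fun a => u_mulDr (u_scal a)) u_scaleDl.

Fact u_scaleAl a (u v : uea) : a *: (u * v) = (a *: u) * v.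
Proof. exact: u_mulA. Qed.
HB.instance Definition _ := GRing.Lmodule_isLalgebra.Build F uea u_scaleAl.

Fact u_scaleAr a (u v : uea) : a *: (u * v) = u * (a *: v).
Proof.
have C : u_mul (u_scal a) u = u_mul u (u_scal a).
  rewrite -[u]ureprK !u_mulE; exact/upiP/uscalC.
rewrite -[LHS]/(u_mul _ (u_mul u v)) -[RHS]/(u_mul u (u_mul _ v)).
by rewrite !u_mulA C.
Qed.
HB.instance Definition _ := GRing.Lalgebra_isAlgebra.Build F uea u_scaleAr.

Definition uvar (x : L) : uea := upi (UVar x).

Fact upi_scal c : upi (UScal c) = c%:A.
Proof. exact/esym/u_mulr1. Qed.
Fact upi_add s t : upi (UAdd s t) = upi s + upi t.
Proof. exact/esym/u_addE. Qed.
Fact upi_mul s t : upi (UMul s t) = upi s * upi t.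
Proof. exact/esym/u_mulE. Qed.

Fact upi_scale c t : upi (UMul (UScal c) t) = c *: upi t.
Proof. exact/esym/u_mulE. Qed.

Fact uvar_is_linear : linear uvar.
Proof. move=> a x y; rewrite -upi_scale -upi_add; exact/upiP/uvarP. Qed.
HB.instance Definition _ := GRing.isLinear.Build F L uea _ uvar uvar_is_linear.

Lemma uvar_lieE x y : uvar (lie x y) = uvar x * uvar y - uvar y * uvar x.
Proof.
rewrite /uvar -!upi_mul -scaleN1r -upi_scale -upi_add; exact/upiP/uvar_lie.
Qed.

Lemma uea_ind (P : uea -> Prop) :
  (forall x, P (uvar x)) -> (forall c : F, P c%:A) ->
  (forall u v, P u -> P v -> P (u + v)) ->
  (forall u v, P u -> P v -> P (u * v)) -> forall u, P u.
Proof.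
move=> Pv Ps Pa Pm u; rewrite -[u]ureprK; elim: (urepr u) => //.
- by move=> c; rewrite upi_scal.
- by move=> s Ps' t Pt; rewrite upi_add; apply: Pa.
- by move=> s Ps' t Pt; rewrite upi_mul; apply: Pm.
Qed.
End Enveloping.

Record lie_hom (F : fieldType) (L : lieAlgType F) (A : algType F) := LieHom {
  lie_hom_fun :> L -> A;
  lie_hom_linear : linear lie_hom_fun;
  lie_hom_lie : forall x y, lie_hom_fun (lie x y) =
    lie_hom_fun x * lie_hom_fun y - lie_hom_fun y * lie_hom_fun x }.

Section Lift.
Variables (F : fieldType) (L : lieAlgType F) (A : algType F) (f : lie_hom L A).

Fixpoint uterm_lift (t : uterm L) : A := match t with
  | UVar x => f x | UScal c => c%:A
  | UAdd s t => uterm_lift s + uterm_lift t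
  | UMul s t => uterm_lift s * uterm_lift t end.

Fact uterm_liftP s t : urel s t -> uterm_lift s = uterm_lift t.
Proof.
elim=> //=; do ?by move=> *; congruence.
- by move=> *; rewrite addrA.
- by move=> *; rewrite addrC.
- by move=> *; rewrite scale0r add0r.
- by move=> *; rewrite scaleN1r mulN1r addNr scale0r.
- by move=> *; rewrite mulrA.
- by move=> *; rewrite scale1r mul1r.
- by move=> *; rewrite scale1r mulr1.
- by move=> *; rewrite mulrDl.
- by move=> *; rewrite mulrDr.
- by move=> *; rewrite scalerDl.
- by move=> *; rewrite -scalerAl mul1r scalerA.
- by move=> *; rewrite -scalerAl -scalerAr mul1r mulr1.
- by move=> a x y; rewrite lie_hom_linear -scalerAl mul1r.
- by move=> *; rewrite lie_hom_lie scaleN1r mulN1r.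
Qed.

Definition ulift (u : uea L) : A := uterm_lift (urepr u).

Fact ulift_pi t : ulift (upi t) = uterm_lift t.
Proof. exact/uterm_liftP/ureprP. Qed.

Fact ulift_zmod : zmod_morphism ulift.
Proof.
move=> x y; rewrite -[x]ureprK -[y]ureprK -scaleN1r.
rewrite -upi_scale -upi_add !ulift_pi /=.
by rewrite -scalerAl mul1r scaleN1r.
Qed.
Fact ulift_monoid : monoid_morphism ulift.
Proof.
split=> [|x y]; first by rewrite [LHS]ulift_pi /= scale1r.
by rewrite -[x]ureprK -[y]ureprK -upi_mul !ulift_pi.
Qed.
HB.instance Definition _ := GRing.isZmodMorphism.Build (uea L) A ulift ulift_zmod.
HB.instance Definition _ :=
  GRing.isMonoidMorphism.Build (uea L) A ulift ulift_monoid.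

Lemma ulift_var x : ulift (uvar x) = f x.
Proof. by rewrite ulift_pi. Qed.
Lemma ulift_scal c : ulift c%:A = c%:A.
Proof. by rewrite -upi_scal ulift_pi. Qed.
End Lift.

Record lie_rep (F : fieldType) (L : lieAlgType F) (V : lmodType F) := LieRep {
  lie_act :> L -> V -> V;
  lie_actDl : forall a x y v,
    lie_act (a *: x + y) v = a *: lie_act x v + lie_act y v;
  lie_actDr : forall x, linear (lie_act x);
  lie_act_lie : forall x y v,
    lie_act (lie x y) v = lie_act x (lie_act y v) - lie_act y (lie_act x v) }.

Definition repmod (F : fieldType) (L : lieAlgType F) (V : lmodType F)
  (rho : lie_rep L V) : Type := V.

Section RepMod.
Variables (F : fieldType) (L : lieAlgType F) (V : lmodType F).
Variable rho : lie_rep L V.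
HB.instance Definition _ := GRing.Zmodule.on (repmod rho).

Fixpoint uterm_act (t : uterm L) : V -> V := match t with
  | UVar x => rho x | UScal c => *:%R c
  | UAdd s t => fun v => uterm_act s v + uterm_act t v
  | UMul s t => fun v => uterm_act s (uterm_act t v) end.

Fact uterm_actDr t : linear (uterm_act t).
Proof.
elim: t => /= [x|c|s IHs t IHt|s IHs t IHt] a u v.
- exact: lie_actDr.
- by rewrite scalerDr !scalerA mulrC.
- by rewrite IHs IHt scalerDr addrACA.
- by rewrite IHt IHs.
Qed.

Fact uterm_actP s t : urel s t -> uterm_act s =1 uterm_act t.
Proof.
elim=> {s t} //=.
- by move=> ? ? _ IH v; rewrite IH.
- by move=> ? ? ? _ IH _ IH' v; rewrite IH IH'.
- by move=> ? ? ? ? _ IH _ IH' v; rewrite IH IH'.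
- by move=> ? ? ? ? _ IH _ IH' v; rewrite IH IH'.
- by move=> s t u v; rewrite addrA.
- by move=> ? ? ?; rewrite addrC.
- by move=> t v; rewrite scale0r add0r.
- by move=> t v; rewrite scaleN1r addNr scale0r.
- by move=> t v; rewrite scale1r.
- by move=> t v; rewrite scale1r.
- move=> s t u v; rewrite -[X in uterm_act u (X + _)]scale1r uterm_actDr.
  by rewrite scale1r.
- by move=> a b v; rewrite scalerDl.
- by move=> a b v; rewrite scalerA.
- move=> a t v; rewrite -[a *: v]addr0 uterm_actDr.
  suff -> : uterm_act t 0 = 0 by rewrite addr0.
  have := uterm_actDr t 1 0 0; rewrite !scale1r addr0 => H.
  by apply: (@addrI _ (uterm_act t 0)); rewrite -H addr0.
- by move=> a x y v; rewrite lie_actDl.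
- by move=> x y v; rewrite lie_act_lie scaleN1r.
Qed.

Definition rep_scale (u : uea L) (v : repmod rho) : repmod rho :=
  uterm_act (urepr u) v.

Fact rep_scaleE t v : rep_scale (upi t) v = uterm_act t v.
Proof. exact/uterm_actP/ureprP. Qed.
Fact rep_scaleA a b v : rep_scale a (rep_scale b v) = rep_scale (a * b) v.
Proof. by rewrite -[a]ureprK -[b]ureprK -upi_mul !rep_scaleE. Qed.
Fact rep_scale1 : left_id 1 rep_scale.
Proof. by move=> v; rewrite [LHS]rep_scaleE /= scale1r. Qed.
Fact rep_scaleDr : right_distributive rep_scale +%R.
Proof.
move=> a u v; rewrite /rep_scale -[u in LHS](@scale1r F V) uterm_actDr.
by rewrite scale1r.
Qed.
Fact rep_scaleDl v : {morph rep_scale^~ v : a b / a + b}.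
Proof.
by move=> a b; rewrite /= -[a]ureprK -[b]ureprK -upi_add !rep_scaleE.
Qed.
HB.instance Definition _ := GRing.Zmodule_isLmodule.Build (uea L) (repmod rho)
  rep_scaleA rep_scale1 rep_scaleDr rep_scaleDl.

Lemma rep_varE x (v : repmod rho) : uvar x *: v = rho x v :> V.
Proof. exact: rep_scaleE. Qed.
Lemma rep_scalE c (v : repmod rho) : (c%:A : uea L) *: v = (c *: (v : V)) :> V.
Proof. by rewrite -upi_scal [LHS]rep_scaleE. Qed.
End RepMod.

Record lieSubalgebra (F : fieldType) (g : finLieAlgType F) := LieSubalgebra {
  lsub :> {vspace g};
  lsub_lie : forall x y, x \in lsub -> y \in lsub -> lie x y \in lsub }.

Section SubLie.
Variables (F : fieldType) (g : finLieAlgType F) (h : lieSubalgebra g).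

Definition lie_of : Type := subvs_of h.
HB.instance Definition _ := Vector.on lie_of.

Definition lsval (x : lie_of) : g := vsval (x : subvs_of h).
Fact lsval_linear : linear lsval.
Proof. by move=> a x y; rewrite /lsval -linearP. Qed.
HB.instance Definition _ := GRing.isLinear.Build F lie_of g _ lsval lsval_linear.
Fact lsval_inj : injective lsval.
Proof. by move=> x y; apply: subvs_inj. Qed.
Fact lsvalP x : lsval x \in (h : {vspace g}).
Proof. exact: subvsP. Qed.

Definition sub_lie (x y : lie_of) : lie_of := vsproj h (lie (lsval x) (lsval y)).
Fact sub_lieE x y : lsval (sub_lie x y) = lie (lsval x) (lsval y).
Proof. by rewrite /lsval vsprojK // lsub_lie ?lsvalP. Qed.
Fact sub_liel a x y z :
  sub_lie (a *: x + y) z = a *: sub_lie x z + sub_lie y z.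
Proof. by apply: lsval_inj; rewrite linearP /= !sub_lieE linearP /= lie_linearl. Qed.
Fact sub_lier a x y z :
  sub_lie z (a *: x + y) = a *: sub_lie z x + sub_lie z y.
Proof. by apply: lsval_inj; rewrite linearP /= !sub_lieE linearP /= lie_linearr. Qed.
Fact sub_liexx x : sub_lie x x = 0.
Proof. by apply: lsval_inj; rewrite linear0 sub_lieE liexx. Qed.
Fact sub_lie_jacobi x y z :
  sub_lie x (sub_lie y z) + sub_lie y (sub_lie z x) + sub_lie z (sub_lie x y) = 0.
Proof. by apply: lsval_inj; rewrite !linearD linear0 /= !sub_lieE lie_jacobi. Qed.
HB.instance Definition _ := Lmodule_isLie.Build F lie_of
  sub_liel sub_lier sub_liexx sub_lie_jacobi.

Lemma lie_ofE (x y : lie_of) : lsval (lie x y) = lie (lsval x) (lsval y).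
Proof. exact: sub_lieE. Qed.
End SubLie.

Section LieNotions.
Variables (F : fieldType) (g : finLieAlgType F).

Definition lie_ideal (I : {vspace g}) : Prop :=
  forall x y, y \in I -> lie x y \in I.

Definition simple_lie : Prop :=
  (exists x y : g, lie x y <> 0) /\
  (forall I : {vspace g}, lie_ideal I -> I = 0%VS \/ I = fullv).

Definition ad_semisimple (x : g) : Prop :=
  exists2 b : seq g, basis_of fullv b &
    forall v, v \in b -> exists c : F, lie x v = c *: v.

Definition toral (h : {vspace g}) : Prop :=
  (forall x y, x \in h -> y \in h -> lie x y = 0) /\
  (forall x, x \in h -> ad_semisimple x).

Definition self_centralizing (h : {vspace g}) : Prop :=
  forall x, (forall y, y \in h -> lie y x = 0) -> x \in h.

(** The definition used for complex semisimple Lie algebras: a toral subalgebra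
    equal to its own centralizer. *)
Record cartan := Cartan {
  cartan_sub :> lieSubalgebra g;
  cartan_toral : toral cartan_sub;
  cartan_centralizer : self_centralizing cartan_sub }.
End LieNotions.

Section Uh.
Variables (F : fieldType) (g : finLieAlgType F) (h : cartan g).

Definition uh : Type := uea (lie_of h).
HB.instance Definition _ := GRing.Algebra.on uh.

Fact lie_of0 (x y : lie_of h) : lie x y = 0.
Proof.
apply: lsval_inj; rewrite lie_ofE linear0.
by have [+ _] := cartan_toral h; apply; apply: lsvalP.
Qed.

Fact uh_mulC : commutative (@GRing.mul uh).
Proof.
have Cv (x : lie_of h) (v : uh) : uvar x * v = v * uvar x.
  elim/uea_ind: v => [y|c|u v IHu IHv|u v IHu IHv].
  - by apply/eqP; rewrite -subr_eq0 -uvar_lieE lie_of0 linear0.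
  - by rewrite -scalerAl -scalerAr mul1r mulr1.
  - by rewrite mulrDl mulrDr IHu IHv.
  - by rewrite mulrA IHu -mulrA IHv mulrA.
move=> u v; elim/uea_ind: u => [x|c|u w IHu IHw|u w IHu IHw].
- exact: Cv.
- by rewrite -scalerAl -scalerAr mul1r mulr1.
- by rewrite mulrDl mulrDr IHu IHw.
- by rewrite -mulrA IHw !mulrA IHu.
Qed.
HB.instance Definition _ := GRing.PzRing_hasCommutativeMul.Build uh uh_mulC.

Section Domain.
Import mpoly.
Local Notation n := (\dim {: lie_of h}).
Local Notation P := {mpoly F[n]}.
Local Notation b := (vbasis {: lie_of h}).

Definition uh_poly_fun (x : lie_of h) : P :=
  \sum_(i < n) (coord b i x) *: 'X_i.
Fact uh_poly_linear : linear uh_poly_fun.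
Proof.
move=> a x y; rewrite /uh_poly_fun scaler_sumr -big_split /=.
by apply: eq_bigr => i _; rewrite linearP /= scalerDl scalerA.
Qed.
Fact uh_poly_lie x y : uh_poly_fun (lie x y) =
  uh_poly_fun x * uh_poly_fun y - uh_poly_fun y * uh_poly_fun x.
Proof.
rewrite lie_of0 [X in _ - X]mulrC subrr /uh_poly_fun.
by rewrite big1 // => i _; rewrite linear0 scale0r.
Qed.
Definition uh_poly : lie_hom (lie_of h) P := LieHom uh_poly_linear uh_poly_lie.

Definition uh_eval (p : P) : uh := mmap (in_alg uh) (fun i => uvar b`_i) p.

Fact uh_polyK : cancel (ulift uh_poly) uh_eval.
Proof.
have E0 : uh_eval = mmap (in_alg uh) (fun i => uvar b`_i) :> (P -> uh) by [].
elim/uea_ind => [x|c|u v IHu IHv|u v IHu IHv].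
- rewrite ulift_var /= /uh_poly_fun E0 raddf_sum /=.
  rewrite [in RHS](coord_vbasis (memvf x)) linear_sum /=.
  by apply: eq_bigr => i _; rewrite mmapZ mmapX mmap1U /= linearZ /= mulr_algl.
- by rewrite ulift_scal E0 -mul_mpolyC mulr1 mmapC.
- by rewrite rmorphD /= E0 raddfD /= -E0 IHu IHv.
- by rewrite rmorphM /= E0 rmorphM /= -E0 IHu IHv.
Qed.

Fact uh_integral (u v : uh) : u * v = 0 -> (u == 0) || (v == 0).
Proof.
move=> /(congr1 (ulift uh_poly)); rewrite rmorphM rmorph0 => /eqP.
rewrite mulf_eq0 => /orP[] /eqP /(congr1 uh_eval).
all: by rewrite uh_polyK [RHS](_ : _ = 0) => [->|]; rewrite ?eqxx ?orbT //;
        rewrite /uh_eval raddf0.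
Qed.
End Domain.

Definition uh_unit (u : uh) : bool := `[< exists v, v * u = 1 >].
Definition uh_inv (u : uh) : uh :=
  match pselect (exists v, v * u = 1) with
  | left e => sval (cid e) | right _ => u end.
Fact uh_mulVr : {in uh_unit, left_inverse 1 uh_inv *%R}.
Proof.
move=> u /asboolP e; rewrite /uh_inv; case: pselect => // e'.
by case: cid.
Qed.
Fact uh_unitP (u v : uh) : v * u = 1 -> uh_unit u.
Proof. by move=> e; apply/asboolP; exists v. Qed.
Fact uh_inv_out : {in [predC uh_unit], uh_inv =1 id}.
Proof.
move=> u; rewrite inE => /asboolPn nu; rewrite /uh_inv.
by case: pselect.
Qed.
HB.instance Definition _ := GRing.ComNzRing_hasMulInverse.Build uh
  uh_mulVr uh_unitP uh_inv_out.
HB.instance Definition _ := GRing.ComUnitRing_isIntegral.Build uh uh_integral.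

Definition dual : Type := 'Hom(lie_of h, F^o).
HB.instance Definition _ := Vector.on dual.
Definition dual_app (l : dual) (x : lie_of h) : F := (l : 'Hom(_, _)) x.

Section Character.
Variable l : dual.
Fact char_linear : linear (fun x => dual_app l x : F^o).
Proof. by move=> a x y; rewrite /dual_app linearP. Qed.
Fact char_lie x y : (dual_app l (lie x y) : F^o) =
  (dual_app l x : F^o) * dual_app l y - (dual_app l y : F^o) * dual_app l x.
Proof. by rewrite lie_of0 mulrC subrr /dual_app linear0. Qed.
Definition char_hom : lie_hom (lie_of h) F^o := LieHom char_linear char_lie.
Definition character (a : uh) : F := ulift char_hom a.
End Character.

Fact uincl_linear : linear (fun x : lie_of h => uvar (lsval x) : uea g).
Proof. by move=> a x y; rewrite !linearP. Qed.
Fact uincl_lie (x y : lie_of h) : uvar (lsval (lie x y)) =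
  uvar (lsval x) * uvar (lsval y) - uvar (lsval y) * uvar (lsval x).
Proof. by rewrite lie_ofE uvar_lieE. Qed.
Definition uincl_hom := LieHom uincl_linear uincl_lie.

Definition uincl : uh -> uea g := ulift uincl_hom.
HB.instance Definition _ := GRing.RMorphism.on uincl.
End Uh.

Definition root_space (F : fieldType) (g : finLieAlgType F) (h : cartan g)
    (alpha : dual h) (z : g) : Prop :=
  forall y : lie_of h, lie (lsval y) z = dual_app alpha y *: z.

Section RootBasis.
Import VectorInternalTheory.
Variables (F : fieldType) (g : finLieAlgType F) (h : cartan g).
Local Notation N := (dim g).

Definition ad_row (x : g) (u : 'rV[F]_N) : 'rV[F]_N := v2r (lie x (r2v u)).
Fact ad_row_linear x : linear (ad_row x).
Proof. by move=> a u v; rewrite /ad_row linearP lie_linearr linearP. Qed.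
HB.instance Definition _ x :=
  GRing.isLinear.Build F 'rV[F]_N 'rV[F]_N _ (ad_row x) (ad_row_linear x).
Definition ad_mx (x : g) : 'M[F]_N := lin1_mx (ad_row x).

Fact ad_mxE x (v : g) : v2r v *m ad_mx x = v2r (lie x v).
Proof. by rewrite mul_rV_lin1 /= /ad_row v2rK. Qed.

Fact basis_unitmx (b : N.-tuple g) : free b ->
  (\matrix_(i < N) v2r b`_i) \in unitmx.
Proof.
move=> /freeP fb; rewrite -row_free_unit; apply: inj_row_free => u.
move=> /(congr1 (@r2v _ g)); rewrite linear0 mulmx_sum_row linear_sum /=.
under eq_bigr => i _ do rewrite linearZ /= rowK v2rK.
by move/fb => u0; apply/rowP => i; rewrite u0 mxE.
Qed.

Fact ad_semisimple_mx x : ad_semisimple x -> diagonalizable (ad_mx x).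
Proof.
move=> [b bB bE].
have sb : size b == N by have := size_basis (X := in_tuple b) bB; rewrite dimvf => <-.
pose T : N.-tuple g := Tuple sb.
exists (\matrix_(i < N) v2r T`_i); first exact/basis_unitmx/(basis_free bB).
have E (i : 'I_N) : exists c : F, lie x T`_i = c *: T`_i.
  by apply: bE; apply: mem_nth; rewrite (eqP sb).
pose d := \row_i sval (cid (E i)).
apply/diagonalizable_forPex; exists d.
apply/simmxP; first exact/basis_unitmx/(basis_free bB).
apply/row_matrixP => i; rewrite !row_mul rowK ad_mxE row_diag_mx.
rewrite -scalemxAl -rowE rowK /d mxE; case: cid => c /= ->.
by rewrite linearZ.
Qed.

Fact ex_root_basis : exists b : N.-tuple g, basis_of fullv b /\
  forall i : 'I_N, forall y, y \in (h : {vspace g}) ->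
    exists c : F, lie y b`_i = c *: b`_i.
Proof.
have [hC hS] := cartan_toral h.
pose As := [seq ad_mx x | x <- vbasis (h : {vspace g})].
have: codiagonalizable As.
  apply/codiagonalizableP; split=> [A B|A].
    move=> /mapP[x /vbasis_mem xh ->] /mapP[y /vbasis_mem yh ->].
    rewrite /comm_mx; apply/row_matrixP => i.
    rewrite !rowE -[delta_mx 0 i]r2vK; move: (r2v _) => v.
    rewrite !mulmxA !ad_mxE; congr v2r.
    have := lie_jacobi x y v; rewrite (hC x y) // lie0r addr0.
    rewrite (lieC v x) -scaleN1r lieZr scaleN1r => /eqP.
    by rewrite subr_eq0 => /eqP.
  by move=> /mapP[x /vbasis_mem xh ->]; apply/ad_semisimple_mx/hS.
move=> [P Pu /allP PA].
pose b := [tuple r2v (row i P) | i < N].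
have bE (i : 'I_N) : b`_i = r2v (row i P).
  by rewrite -tnth_nth tnth_mktuple.
exists b; split.
  rewrite basisEfree dimvf size_tuple leqnn subvf !andbT.
  apply/freeP => k.
  under eq_bigr => i _ do rewrite bE -linearZ.
  rewrite -linear_sum /= => /(congr1 v2r); rewrite r2vK linear0.
  have -> : \sum_i k i *: row i P = (\row_i k i) *m P.
    by rewrite mulmx_sum_row; apply: eq_bigr => i _; rewrite mxE.
  move/(congr1 (mulmx^~ (invmx P))); rewrite mulmxK // mul0mx => k0 i.
  by have := congr1 (fun u : 'rV_N => u 0 i) k0; rewrite !mxE.
move=> i y yh.
have E x : x \in vbasis (h : {vspace g}) -> exists c : F, lie x b`_i = c *: b`_i.
  move=> xh; have /PA /= : ad_mx x \in As by apply: map_f.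
  move=> /diagonalizable_forPex[d /(simmxP Pu)] /(congr1 (row i)).
  rewrite !row_mul row_diag_mx -scalemxAl -rowE => H.
  exists (d 0 i); apply: (can_inj v2rK).
  by rewrite -ad_mxE bE r2vK H linearZ /= r2vK.
rewrite (coord_vbasis yh).
have {}E (j : 'I_(\dim h)) : {c : F | lie (vbasis h)`_j b`_i = c *: b`_i}.
  by apply/cid/E/mem_nth; rewrite size_tuple.
exists (\sum_j coord (vbasis h) j y * sval (E j)).
rewrite lie_suml scaler_suml; apply: eq_bigr => j _.
by rewrite lieZl -scalerA; case: (E j) => /= c ->.
Qed.

(** [root_basis`_i] is an eigenvector of all [ad y], [y] in [h], with eigenvalue
    [root_weight i] in [h^*]; this weight is [0] when [root_basis`_i] is in [h]. *)
Definition root_basis : N.-tuple g := sval (cid ex_root_basis).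
Local Notation b := root_basis.
Fact root_basis_basis : basis_of fullv b.
Proof. by rewrite /root_basis; case: cid => b []. Qed.

Fact root_linear (i : 'I_N) :
  linear (fun y : lie_of h => coord b i (lie (lsval y) b`_i) : F^o).
Proof. by move=> a x y; rewrite linearP lie_linearl linearP. Qed.
Definition root_fun (i : 'I_N) (y : lie_of h) : F^o :=
  coord b i (lie (lsval y) b`_i).
HB.instance Definition _ i :=
  GRing.isLinear.Build F (lie_of h) F^o _ (root_fun i) (root_linear i).
Definition root_weight (i : 'I_N) : dual h := linfun (root_fun i).

Lemma root_basisP (i : 'I_N) : root_space (root_weight i) b`_i.
Proof.
move=> y; rewrite /dual_app /root_weight lfunE /= /root_fun.
have [c ->] : exists c : F, lie (lsval y) b`_i = c *: b`_i.
  rewrite /root_basis; case: cid => b' /= [_ H]; apply: H; exact: lsvalP.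
rewrite linearZ /= coord_free ?eqxx ?(basis_free root_basis_basis) //.
by rewrite mulr1.
Qed.

Lemma root_basisE x : x = \sum_(i < N) coord b i x *: b`_i.
Proof. exact: (coord_basis root_basis_basis (memvf x)). Qed.

Fact root_spaceB alpha beta (x y : g) : root_space (h := h) alpha x ->
  root_space beta y -> root_space (alpha + beta) (lie x y).
Proof.
move=> rx ry t; have := lie_jacobi (lsval t) x y.
rewrite (lieC y (lsval t)) -scaleN1r lieZr ry rx.
rewrite lieZr scaleN1r [lie y (_ *: x)]lieZr (lieC y x) => /eqP.
rewrite -addrA addr_eq0 => /eqP ->; rewrite opprD opprK scalerN opprK.
by rewrite /dual_app add_lfunE scalerDl addrC.
Qed.

Fact root_coord gamma (z : g) (i : 'I_N) : root_space (h := h) gamma z ->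
  root_weight i != gamma -> coord b i z = 0.
Proof.
move=> rz; apply: contra_neq_eq => zi.
apply/lfunP => y; have := congr1 (coord b i) (rz y).
rewrite linearZ /= {1}[z]root_basisE lie_sumr linear_sum /=.
have fb := basis_free root_basis_basis.
rewrite (bigD1 i) //= big1 ?addr0 => [|j ji].
  rewrite lieZr root_basisP scalerA linearZ /= coord_free // eqxx mulr1.
  by rewrite mulrC => /(mulIf zi).
by rewrite lieZr root_basisP scalerA linearZ /= coord_free // (negPf ji) mulr0.
Qed.
End RootBasis.

Definition fin_generated (A : pzRingType) (M : lmodType A) : Prop :=
  exists n (e : 'I_n -> M), forall m, exists a : 'I_n -> A,
    m = \sum_i a i *: e i.

Definition torsion_free (A : pzRingType) (M : lmodType A) : Prop :=
  forall (a : A) (m : M), a *: m = 0 -> a = 0 \/ m = 0.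

Definition is_basis (F : fieldType) (V : lmodType F) (S : set V) (d : nat)
    (e : 'I_d -> V) : Prop :=
  (forall i, S (e i)) /\
  (forall v, S v -> exists! c : 'rV[F]_d, v = \sum_i c 0 i *: e i).

Definition has_dim (F : fieldType) (V : lmodType F) (S : set V) (d : nat) :=
  exists e : 'I_d -> V, is_basis S e.

(** [S] has a finite basis, on which [f] acts by a matrix of trace [t]. *)
Definition is_trace (F : fieldType) (V : lmodType F) (S : set V) (f : V -> V)
    (t : F) : Prop :=
  exists d (e : 'I_d -> V) (a : 'M[F]_d), is_basis S e /\
    (forall j, f (e j) = \sum_i a i j *: e i) /\ t = \tr a.

(** The extension of scalars [M \otimes_A B] as a [B]-module: the generator
    [<< m >>] stands for [m \otimes 1]. *)
Section BaseChange.
Variables (A B : comNzRingType) (f : {rmorphism A -> B}) (M : lmodType A).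

Inductive tensor_rel : set {malg B[M]} :=
  | TensorD (m m' : M) : tensor_rel (<< m + m' >> - << m >> - << m' >>)
  | TensorZ (a : A) (m : M) : tensor_rel (<< a *: m >> - f a *: << m >>).

Definition base_change := modquot (span_sub tensor_rel).
HB.instance Definition _ := GRing.Lmodule.on base_change.
End BaseChange.

Section Modules.
Variables (F : fieldType) (g : finLieAlgType F) (h : cartan g).
Variable M : lmodType (uea g).

Definition res_uh : Type := restr (@uincl F g h) M.
HB.instance Definition _ := GRing.Lmodule.on res_uh.

Definition res_F : Type := restr (in_alg (uea g)) M.
HB.instance Definition _ := GRing.Lmodule.on res_F.

Definition in_frakA : Prop := fin_generated M /\ fin_generated res_uh.

(** [dim_K (M \otimes_{U(h)} K) = d], where [K] is the fraction field of [U(h)]. *)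
Definition is_rank (d : nat) : Prop :=
  has_dim [set: base_change (@tofrac (uh h)) res_uh] d.

Definition weight_space (l : dual h) : set res_F :=
  [set v : M | forall y : lie_of h,
    uvar (lsval y) *: v = (dual_app l y)%:A *: v].

Definition weight_module : Prop :=
  [/\ forall v : res_F, exists (s : seq (dual h)) (w : dual h -> res_F),
        (forall l, weight_space l (w l)) /\ v = \sum_(l <- s) w l,
      forall (s : seq (dual h)) (w : dual h -> res_F), uniq s ->
        (forall l, weight_space l (w l)) -> \sum_(l <- s) w l = 0 ->
        forall l, l \in s -> w l = 0
    & forall l, exists d, has_dim (weight_space l) d].

Definition supp : set (dual h) := [set l | exists2 v, weight_space l v & v <> 0].

Definition commutant : set (uea g) :=
  [set u | forall a : uh h, u * uincl a = uincl a * u].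

Definition polynomial_function (p : dual h -> F) : Prop :=
  exists q : mpoly.mpoly (\dim {: lie_of h}) F, forall l,
    p l = mpoly.meval (fun i => dual_app l (vbasis {: lie_of h})`_i) q.

Definition coherent_family (U : set (dual h)) (d : nat) : Prop :=
  [/\ finite_set (~` U)%classic, weight_module,
      forall l, U l -> has_dim (weight_space l) d
    & forall u, commutant u -> exists2 p, polynomial_function p &
        forall l, U l -> is_trace (weight_space l) ( *:%R u) (p l)].
End Modules.
Arguments weight_space {F g} h M l.
Arguments weight_module {F g} h M.
Arguments supp {F g} h M.
Arguments commutant {F g} h.
Arguments coherent_family {F g h} M U d.

Section Weighting.
Variables (F : fieldType) (g : finLieAlgType F) (h : cartan g).
Variable M : lmodType (uea g).
Local Notation MU := (res_uh h M).
Local Notation N := (dim g).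
Local Notation b := (root_basis h).
Local Notation wt := (@root_weight F g h).

Definition max_gen (l : dual h) : set MU :=
  [set x | exists (a : uh h) (m : MU), character l a = 0 /\ x = a *: m].
Definition max_sub (l : dual h) : submodule MU := span_sub (max_gen l).

Definition fib (l : dual h) : Type := modquot (max_sub l).
HB.instance Definition _ l := GRing.Lmodule.on (fib l).
Definition fpi (l : dual h) (m : M) : fib l := mqpi (max_sub l) m.
Definition frepr (l : dual h) (q : fib l) : M := mqrepr q.

(** The direct sum of the [M / m_l M], as finitely supported families. *)
Record wsum := Wsum {
  wfun :> forall l, fib l;
  wfun_fin : exists s : seq (dual h), forall l, l \notin s -> wfun l = 0 }.

HB.instance Definition _ := gen_eqMixin wsum.
HB.instance Definition _ := gen_choiceMixin wsum.

Fact wsumP (f f' : wsum) : (forall l, f l = f' l) -> f = f'.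
Proof.
case: f f' => [f pf] [f' pf'] /= E.
have {}E : f = f' by apply: functional_extensionality_dep.
by subst f'; congr Wsum; apply: Prop_irrelevance.
Qed.

Fact fpi_linear_uh l a (x y : MU) : fpi l (a *: x + y) = a *: fpi l x + fpi l y.
Proof. exact: (linearP (mqpi (max_sub l))). Qed.
Fact fpiD l x y : fpi l (x + y) = fpi l x + fpi l y.
Proof. exact: (raddfD (mqpi (max_sub l))). Qed.
Fact fpi0 l : fpi l 0 = 0.
Proof. exact: (raddf0 (mqpi (max_sub l))). Qed.
Fact fpiN l x : fpi l (- x) = - fpi l x.
Proof. exact: (raddfN (mqpi (max_sub l))). Qed.
Fact fpi_sum l I (r : seq I) (P : pred I) (f : I -> M) :
  fpi l (\sum_(i <- r | P i) f i) = \sum_(i <- r | P i) fpi l (f i).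
Proof. exact: (raddf_sum (mqpi (max_sub l))). Qed.
Fact freprK l (q : fib l) : fpi l (frepr q) = q.
Proof. exact: mqreprK. Qed.
Fact fpiP l x y : fpi l x = fpi l y <-> max_sub l (x - y : M).
Proof. exact: mqpiP. Qed.

Fact uincl_scal (c : F) : uincl (c%:A : uh h) = c%:A.
Proof. exact: ulift_scal. Qed.
Fact fpiZ l (c : F) x : fpi l ((c%:A : uea g) *: x) = (c%:A : uh h) *: fpi l x.
Proof.
rewrite -uincl_scal -[RHS]addr0 -(fpi0 l) -fpi_linear_uh addr0.
by congr fpi.
Qed.

Definition wzero : wsum.
Proof. by exists (fun l => 0 : fib l); exists [::]. Defined.
Definition wadd (f f' : wsum) : wsum.
Proof.
exists (fun l => f l + f' l).
have [s fs] := wfun_fin f; have [s' fs'] := wfun_fin f'.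
by exists (s ++ s') => l; rewrite mem_cat negb_or => /andP[/fs-> /fs'->]; rewrite addr0.
Defined.
Definition wopp (f : wsum) : wsum.
Proof.
exists (fun l => - f l); have [s fs] := wfun_fin f.
by exists s => l /fs ->; rewrite oppr0.
Defined.
Definition wscale (c : F) (f : wsum) : wsum.
Proof.
exists (fun l => (c%:A : uh h) *: f l); have [s fs] := wfun_fin f.
by exists s => l /fs ->; rewrite scaler0.
Defined.

Fact waddA : associative wadd.
Proof. by move=> f f' f''; apply: wsumP => l /=; rewrite addrA. Qed.
Fact waddC : commutative wadd.
Proof. by move=> f f'; apply: wsumP => l /=; rewrite addrC. Qed.
Fact wadd0 : left_id wzero wadd.
Proof. by move=> f; apply: wsumP => l /=; rewrite add0r. Qed.
Fact waddN : left_inverse wzero wopp wadd.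
Proof. by move=> f; apply: wsumP => l /=; rewrite addNr. Qed.
HB.instance Definition _ := GRing.isZmodule.Build wsum waddA waddC wadd0 waddN.

Fact wscaleA a c f : wscale a (wscale c f) = wscale (a * c) f.
Proof.
by apply: wsumP => l /=; rewrite scalerA -scalerAl mul1r scalerA.
Qed.
Fact wscale1 : left_id 1 wscale.
Proof. by move=> f; apply: wsumP => l /=; rewrite !scale1r. Qed.
Fact wscaleDr : right_distributive wscale +%R.
Proof. by move=> a f f'; apply: wsumP => l /=; rewrite scalerDr. Qed.
Fact wscaleDl f : {morph wscale^~ f : a c / a + c}.
Proof. by move=> a c; apply: wsumP => l /=; rewrite !scalerDl. Qed.
HB.instance Definition _ := GRing.Zmodule_isLmodule.Build F wsum
  wscaleA wscale1 wscaleDr wscaleDl.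

(** A root vector of weight [alpha] maps the class of [m] in [M / m_l M] to the
    class of [x_alpha m] in [M / m_(l + alpha) M]; this is extended linearly to
    [g] along [root_basis]. See [weighting_root] and [weighting_cartan] for the
    resulting formulas, which do not depend on the chosen representatives. *)
Definition wact_at (x : g) (f : wsum) (l : dual h) : fib l :=
  \sum_(i < N) ((coord b i x)%:A : uh h) *:
    fpi l (uvar b`_i *: frepr (f (l - wt i))).

Section Shift.
Variables (alpha : dual h) (z : g) (rz : root_space alpha z).

Definition shift_fun (y : lie_of h) : uh h := uvar y - (dual_app alpha y)%:A.
Fact shift_linear : linear shift_fun.
Proof.
move=> a x y; rewrite /shift_fun /dual_app !linearP /= scalerDl opprD.
by rewrite scalerBr addrACA scalerA.
Qed.
Fact shift_lie x y : shift_fun (lie x y) =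
  shift_fun x * shift_fun y - shift_fun y * shift_fun x.
Proof.
by rewrite lie_of0 [X in _ - X]mulrC subrr /shift_fun /dual_app !linear0
           scale0r subr0.
Qed.
Definition shift_hom := LieHom shift_linear shift_lie.
Definition shift (a : uh h) : uh h := ulift shift_hom a.

Fact shiftE a : uvar z * uincl a = uincl (shift a) * uvar z.
Proof.
rewrite /shift; elim/uea_ind: a => [y|c|u v IHu IHv|u v IHu IHv].
- rewrite ulift_var /= /shift_fun rmorphB /= uincl_scal /uincl !ulift_var /=.
  apply/eqP; rewrite mulrBl -scalerAl mul1r -linearZ /= -rz uvar_lieE.
  by rewrite opprB addrC subrK.
- by rewrite ulift_scal !uincl_scal -scalerAl -scalerAr mul1r mulr1.
- by rewrite !rmorphD /= mulrDl mulrDr IHu IHv.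
- by rewrite !rmorphM /= mulrA IHu -mulrA IHv mulrA.
Qed.

Fact character_shift l a : character (l + alpha) (shift a) = character l a.
Proof.
rewrite /shift /character; elim/uea_ind: a => [y|c|u v IHu IHv|u v IHu IHv].
- rewrite !ulift_var /= rmorphB /= ulift_scal ulift_var /=.
  rewrite /dual_app add_lfunE -[_%:A]/(_ * 1) mulr1.
  by rewrite addrK.
- by rewrite !ulift_scal.
- by rewrite !rmorphD /= IHu IHv.
- by rewrite !rmorphM /= IHu IHv.
Qed.

Fact root_scale (a : uh h) (m : M) :
  uvar z *: ((a *: (m : MU)) : M) = (shift a *: ((uvar z *: m : M) : MU) : MU).
Proof.
change (uvar z *: (uincl a *: m) = uincl (shift a) *: (uvar z *: m)).
by rewrite !scalerA shiftE.
Qed.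

Fact root_max_sub l (m : M) :
  max_sub l m -> max_sub (l + alpha) (uvar z *: m : M).
Proof.
move=> [n [a [e [Ee ->]]]].
exists n, (fun i => shift (a i)), (fun i => uvar z *: (e i : M) : M).
split=> [i|].
  have [c [m' [c0 ->]]] := Ee i.
  exists (shift c), (uvar z *: (m' : M) : M); rewrite character_shift; split=> //.
  exact: root_scale.
rewrite [LHS]scaler_sumr; apply: eq_bigr => i _; exact: root_scale.
Qed.

Fact root_fpi l (m m' : M) : fpi l m = fpi l m' ->
  fpi (l + alpha) (uvar z *: m) = fpi (l + alpha) (uvar z *: m').
Proof. by move=> /fpiP/root_max_sub H; apply/fpiP; rewrite -scalerBr. Qed.

Lemma wact_root f l : wact_at z f l = fpi l (uvar z *: frepr (f (l - alpha))).
Proof.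
rewrite [in RHS](root_basisE h z) linear_sum scaler_suml fpi_sum.
apply: eq_bigr => i _; rewrite linearZ /= -[_ *: uvar _]mulr_algl -[in RHS]scalerA fpiZ.
have [->//|ni] := eqVneq (wt i) alpha.
by rewrite (root_coord rz ni) !scale0r.
Qed.
End Shift.

Fact wact_fin x f :
  exists s : seq (dual h), forall l, l \notin s -> wact_at x f l = 0.
Proof.
have [s fs] := wfun_fin f.
exists [seq a + wt i | a <- s, i <- enum 'I_N] => l nl.
rewrite /wact_at big1 // => i _.
have -> : f (l - wt i) = 0.
  apply: fs; apply: contra nl => li; rewrite -(subrK (wt i) l).
  by apply: allpairs_f => //; rewrite mem_enum.
suff -> : fpi l (uvar b`_i *: frepr (0 : fib (l - wt i))) = fpi l 0.
  by rewrite fpi0 scaler0.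
have := @root_fpi _ _ (@root_basisP F g h i) (l - wt i) (frepr (0 : fib (l - wt i))) 0.
by rewrite subrK scaler0; apply; rewrite freprK fpi0.
Qed.
Definition wact x f : wsum := Wsum (wact_fin x f).

Fact wact_linl a x y f : wact (a *: x + y) f = a *: wact x f + wact y f.
Proof.
apply: wsumP => l /=; rewrite /wact_at scaler_sumr -big_split.
apply: eq_bigr => i _ /=; rewrite linearP /= scalerDl scalerDl.
by rewrite scalerA -[_%:A * _%:A]scalerAl mul1r scalerA.
Qed.

Fact wact_linr x : linear (wact x).
Proof.
move=> a f f'; apply: wsumP => l /=; rewrite /wact_at scaler_sumr -big_split.
apply: eq_bigr => i _ /=.
rewrite [a%:A *: (_ *: _)]scalerA [a%:A * _]mulrC -[(_ * a%:A) *: _]scalerA.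
rewrite -scalerDr; congr (_ *: _).
rewrite -fpiZ -fpiD [a%:A *: (_ *: _)]scalerA mulr_algl -[a *: uvar _]mulr_algr.
rewrite -[(_ * a%:A) *: _]scalerA -scalerDr.
have := @root_fpi _ _ (@root_basisP F g h i) (l - wt i).
rewrite subrK; apply.
by rewrite fpiD fpiZ !freprK.
Qed.

Fact wact0 f l : wact_at 0 f l = 0.
Proof. by rewrite /wact_at big1 // => i _; rewrite linear0 !scale0r. Qed.

Fact wact_rootE alpha z f l : root_space (h := h) alpha z ->
  wact z f l = fpi l (uvar z *: frepr (f (l - alpha))).
Proof. by move=> rz; apply: (wact_root rz). Qed.

Fact wact_roots (i j : 'I_N) f :
  wact (lie b`_i b`_j) f = wact b`_i (wact b`_j f) - wact b`_j (wact b`_i f).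
Proof.
apply: wsumP => l.
have E (i' j' : 'I_N) : wact b`_i' (wact b`_j' f) l =
    fpi l (uvar b`_i' *: (uvar b`_j' *: frepr (f (l - (wt i' + wt j'))))).
  rewrite (wact_rootE _ _ (@root_basisP F g h i')).
  have := @root_fpi _ _ (@root_basisP F g h i') (l - wt i').
  rewrite subrK; apply; rewrite freprK (wact_rootE _ _ (@root_basisP F g h j')).
  by rewrite opprD addrA.
rewrite -[RHS]/(wact b`_i (wact b`_j f) l - wact b`_j (wact b`_i f) l) !E.
rewrite (wact_rootE _ _ (root_spaceB (@root_basisP F g h i) (@root_basisP F g h j))).
by rewrite [wt j + _]addrC uvar_lieE scalerBl !scalerA fpiD fpiN.
Qed.

Fact wact_suml (c : 'I_N -> F) f :
  wact (\sum_i c i *: b`_i) f = \sum_i c i *: wact b`_i f.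
Proof.
have W0 : wact 0 f = 0 by apply: wsumP => l; apply: wact0.
elim/big_rec2: _ => [//|i x y _ <-].
by rewrite wact_linl.
Qed.

Fact wact_lin0 x : wact x 0 = 0.
Proof.
have := wact_linr x 1 0 0; rewrite scale1r scale1r addr0 => H.
by apply: (@addrI _ (wact x 0)); rewrite -H addr0.
Qed.

Fact wact_sumr x (c : 'I_N -> F) (f : 'I_N -> wsum) :
  wact x (\sum_i c i *: f i) = \sum_i c i *: wact x (f i).
Proof.
elim/big_rec2: _ => [|i u v _ <-]; first exact: wact_lin0.
by rewrite wact_linr.
Qed.

Fact wact_lie x y f : wact (lie x y) f = wact x (wact y f) - wact y (wact x f).
Proof.
suff {x y} H (c d : 'I_N -> F) :
    wact (lie (\sum_i c i *: b`_i) (\sum_i d i *: b`_i)) f =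
    wact (\sum_i c i *: b`_i) (wact (\sum_i d i *: b`_i) f) -
    wact (\sum_i d i *: b`_i) (wact (\sum_i c i *: b`_i) f).
  by rewrite (root_basisE h x) (root_basisE h y); apply: H.
rewrite [wact (\sum_i d i *: _) f]wact_suml [wact (\sum_i c i *: _) f]wact_suml.
rewrite !wact_suml.
under [X in X - _]eq_bigr => i _ do rewrite wact_sumr scaler_sumr.
under [X in _ - X]eq_bigr => i _ do rewrite wact_sumr scaler_sumr.
rewrite [X in _ - X]exchange_big /= -sumrB lie_suml.
have WS (u : 'I_N -> g) : wact (\sum_i u i) f = \sum_i wact (u i) f.
  have W0 : wact 0 f = 0 by apply: wsumP => l; apply: wact0.
  elim/big_rec2: _ => [//|i s t _ <-].
  by rewrite -[u i in LHS]scale1r wact_linl scale1r.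
rewrite WS; apply: eq_bigr => i _; rewrite lie_sumr WS -sumrB.
apply: eq_bigr => j _; rewrite lieZr lieZl -[_ *: (_ *: _)]addr0 wact_linl.
rewrite -[_ *: lie _ _]addr0 wact_linl.
have -> : wact 0 f = 0 by apply: wsumP => l; apply: wact0.
by rewrite !addr0 wact_roots !scalerBr !scalerA [d j * c i]mulrC.
Qed.

Definition wrep : lie_rep g wsum := LieRep wact_linl wact_linr wact_lie.

Definition weighting : Type := repmod wrep.
HB.instance Definition _ := GRing.Lmodule.on weighting.
End Weighting.

Section WeightingTheory.
Variables (F : fieldType) (g : finLieAlgType F) (h : cartan g).
Variable M : lmodType (uea g).
Implicit Types (f : weighting h M) (m : M).

Lemma weighting_root alpha z f l m : root_space (h := h) alpha z ->
  wfun f l = fpi l m ->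
  wfun (uvar z *: f : weighting h M) (l + alpha) = fpi (l + alpha) (uvar z *: m).
Proof.
move=> rz fm; rewrite [uvar z *: f](@rep_varE _ _ _ (wrep h M)).
rewrite [LHS](wact_root rz) addrK; apply: (root_fpi rz).
by rewrite freprK fm.
Qed.

Lemma weighting_cartan (y : lie_of h) f l :
  wfun (uvar (lsval y) *: f : weighting h M) l = (dual_app l y)%:A *: wfun f l.
Proof.
have r0 : root_space (0 : dual h) (lsval y).
  by move=> t; rewrite -lie_ofE lie_of0 linear0 /dual_app zero_lfunE scale0r.
rewrite [uvar _ *: f](@rep_varE _ _ _ (wrep h M)) [LHS](wact_root r0) subr0.
rewrite -[in RHS](freprK (wfun f l)) -fpiZ; apply/fpiP; rewrite -scalerBl.
exists 1%N, (fun=> 1), (fun=> (uvar (lsval y) - (dual_app l y)%:A) *: frepr (wfun f l)).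
split=> [_|]; last by rewrite big_ord1 scale1r.
exists (uvar y - (dual_app l y)%:A), (frepr (wfun f l)); split.
  rewrite /character rmorphB /= ulift_scal ulift_var /=.
  by rewrite -[_%:A]/(_ * 1) mulr1 subrr.
change ((uvar (lsval y) - (dual_app l y)%:A) *: frepr (wfun f l) =
  uincl (uvar y - (dual_app l y)%:A : uh h) *: frepr (wfun f l)).
by rewrite rmorphB /= uincl_scal /uincl ulift_var.
Qed.
End WeightingTheory.

Section WeightingMap.
Variables (F : fieldType) (g : finLieAlgType F) (h : cartan g).
Variables (M M' : lmodType (uea g)) (phi : {linear M -> M'}).

Fact lin_max_sub (l : dual h) m : max_sub M l m -> max_sub M' l (phi m).
Proof.
move=> [n [a [e [Ee ->]]]]; exists n, a, (fun i => phi (e i)); split=> [i|].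
  have [c [m' [c0 ->]]] := Ee i.
  by exists c, (phi m'); split=> //; apply: (linearZ_LR phi).
rewrite [LHS](raddf_sum phi); apply: eq_bigr => i _; exact: (linearZ_LR phi).
Qed.

Fact lin_fpi (l : dual h) (m m' : M) : fpi l m = fpi l m' ->
  fpi l (phi m) = fpi l (phi m').
Proof.
by move=> /fpiP/lin_max_sub H; apply/fpiP; rewrite -(raddfB phi).
Qed.

Fact wmap_fin (f : weighting h M) : exists s : seq (dual h),
  forall l, l \notin s -> fpi l (phi (frepr (wfun f l))) = 0.
Proof.
have [s fs] := wfun_fin f; exists s => l /fs ->.
have -> : fpi l (phi (frepr (0 : fib M l))) = fpi l (phi 0).
  by apply: lin_fpi; rewrite freprK fpi0.
by rewrite (raddf0 phi) fpi0.
Qed.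

Definition wmap (f : weighting h M) : weighting h M' := Wsum (wmap_fin f).

Fact wmapE (f : weighting h M) l m : wfun f l = fpi l m ->
  wfun (wmap f) l = fpi l (phi m).
Proof. by move=> E; apply: lin_fpi; rewrite freprK. Qed.

Fact wmap_linear : linear wmap.
Proof.
have D (f f' : weighting h M) : wmap (f + f') = wmap f + wmap f'.
  apply: wsumP => l.
  transitivity (fpi l (phi (frepr (wfun f l) + frepr (wfun f' l)))).
    by apply: wmapE; rewrite fpiD !freprK.
  by rewrite (raddfD phi) fpiD.
suff Z u (f : weighting h M) : wmap (u *: f) = u *: wmap f.
  by move=> a f f'; rewrite D Z.
elim/uea_ind: u f => [x|c|u v IHu IHv|u v IHu IHv] f; last first.
- by rewrite -!scalerA IHu IHv.
- by rewrite !scalerDl D IHu IHv.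
- apply: wsumP => l.
  transitivity (fpi l (phi ((c%:A : uea g) *: frepr (wfun f l)))).
    by apply: wmapE; rewrite [_ *: f](@rep_scalE _ _ _ (wrep h M)) fpiZ freprK.
  by rewrite (linearZ_LR phi) fpiZ [_ *: wmap f](@rep_scalE _ _ _ (wrep h M')).
apply: wsumP => l; rewrite [_ *: wmap f](@rep_varE _ _ _ (wrep h M')).
rewrite (@wmapE _ l (\sum_i ((coord (root_basis h) i x)%:A : uea g) *:
   (uvar (root_basis h)`_i *: frepr (wfun f (l - root_weight h i))))); last first.
  rewrite [_ *: f](@rep_varE _ _ _ (wrep h M)) fpi_sum; apply: eq_bigr => i _; by rewrite fpiZ.
rewrite (raddf_sum phi) fpi_sum; apply: eq_bigr => i _.
have pZ u m : phi (u *: m) = u *: phi m by exact: (linearZ_LR phi).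
rewrite /= pZ fpiZ pZ; congr (_ *: _).
have := @root_fpi _ _ _ M' _ _ (@root_basisP F g h i) (l - root_weight h i).
rewrite subrK; apply; rewrite freprK; exact/esym/wmapE/esym/freprK.
Qed.
HB.instance Definition _ := GRing.isLinear.Build (uea g)
  (weighting h M) (weighting h M') _ wmap wmap_linear.
End WeightingMap.
Arguments wmap {F g} h {M M'} phi f.

(** The first left derived functor of the weighting functor, computed with the
    free resolution of [M] whose term of degree [0] is free on the set [M], and
    whose next terms are free on the kernel of the previous differential. *)
Section LeftDerived.
Variables (F : fieldType) (g : finLieAlgType F) (h : cartan g).
Variable M : lmodType (uea g).

Definition res0 : lmodType (uea g) := {malg (uea g)[M]}.
Definition aug : {linear res0 -> M} := fext id.
Definition res1 : lmodType (uea g) := {malg (uea g)[kerm aug]}.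
Definition diff1 : {linear res1 -> res0} := fext val.
Definition res2 : lmodType (uea g) := {malg (uea g)[kerm diff1]}.
Definition diff2 : {linear res2 -> res1} := fext val.

Definition weighting1 : Type := homology (wmap h diff2) (wmap h diff1).
HB.instance Definition _ := GRing.Lmodule.on weighting1.
End LeftDerived.

(* Main.v *)
(** Write [S = U(h)], a polynomial ring, and call [(e, f)] a frame when [e] is a
    finite [S]-independent family of [M], of size [rank M], and [f] in [S] maps [M]
    into its span. Let [V] be the common zero set of the [f]'s.

    [V] is the support of [W_1(M)]. Localizing at a frame with [f(l) <> 0] kills
    [Tor_1] at [l]. Conversely, lift a basis of [M / m_l M] to [M]; Nakayama's lemma
    gives an [f] with [f(l) = 1] mapping [M] into the span of the lifts. If [W_1(M)]
    vanishes at [l], then these are independent, because [U(g)] is free over [S] (PBW)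
    and an element of [S] that vanishes at [l] to infinite order is [0].

    PBW is proved in characteristic [0] for a Lie algebra without center: on
    polynomial functions on matrices, [g] acts by linear vector fields which are
    independent at the identity matrix, and the symbol at this point of an ordered
    monomial in [g] is the corresponding partial derivative.

    [V] is finite. Let [l + T] be an affine subspace contained in [V], with [T] of
    maximal dimension. For a root [a] outside [T], the root vectors of weight [a] and
    [-a] act nilpotently on the weight space of [W_1(M)] at a generic point of
    [l + T], so computing in [sl_2] (or in the Heisenberg algebra) shows that the
    points of [l + T] take half-integral multiples of [a(t)] as values at
    [t = [x_a, x_-a]]; hence [T] kills all such [t]. As [g] is simple and [V] is not
    all of [h^*], such brackets span [h], so [T = 0]. Then the same integrality shows
    that [V] is countable, and a countable closed set is finite since the field is
    uncountable.

    The trace of [u] in [A] is computed in frames, and lies in [S] because its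
    denominators have only finitely many common zeros while [dim h >= 2]. *)
Require Import Defs.
From HB Require Import structures.
From mathcomp Require Import all_boot all_order all_algebra.
From mathcomp Require Import boolp classical_sets cardinality reals.
From mathcomp Require Import complex finmap ring lra.
From mathcomp.multinomials Require mpoly.
From mathcomp.multinomials Require Import monalg.

Set Implicit Arguments.
Unset Strict Implicit.
Unset Printing Implicit Defensive.

Import GRing.Theory.
Local Open Scope ring_scope.

(** * The Poincare-Birkhoff-Witt theorem *)

Section PolynomialOrder.
Import mpoly.
Variables (F : fieldType) (n : nat).
Implicit Types (f g : mpoly n F) (d e : nat).

(** Membership in the [d]-th power of the maximal ideal at the origin. *)
Definition order_ge d f := forall m : multinom n, (mdeg m < d)%N -> f@_m = 0.

Lemma order_geD d f g : order_ge d f -> order_ge d g -> order_ge d (f + g).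
Proof. by move=> hf hg m md; rewrite mcoeffD hf // hg // addr0. Qed.

Lemma order_ge0 d : order_ge d 0.
Proof. by move=> m _; rewrite mcoeff0. Qed.

Lemma order_ge_sum d I (r : seq I) (f : I -> mpoly n F) :
  (forall i, order_ge d (f i)) -> order_ge d (\sum_(i <- r) f i).
Proof.
move=> hf; elim/big_rec: _ => [|i g _ hg]; first exact: order_ge0.
exact: order_geD.
Qed.

Lemma order_geM d e f g : order_ge d f -> order_ge e g -> order_ge (d + e) (f * g).
Proof.
move=> hf hg m md; rewrite mcoeffM big1 // => -[k1 k2] /= /eqP mk.
have [k1d|k1d] := ltnP (mdeg k1) d; first by rewrite hf // mul0r.
have md' : (mdeg k1 + mdeg k2 < d + e)%N by rewrite -mdegD -mk.
by rewrite (hg k2) ?mulr0 // -(ltn_add2l d) (leq_ltn_trans _ md') // leq_add2r.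
Qed.

Lemma order_geZ d c f : order_ge d f -> order_ge d (c *: f).
Proof. by move=> hf m md; rewrite mcoeffZ hf // mulr0. Qed.

Lemma order_geW d e f : (e <= d)%N -> order_ge d f -> order_ge e f.
Proof. by move=> ed hf m me; apply/hf/(leq_trans me). Qed.

Lemma order_ge_deriv d i f : order_ge d f -> order_ge d.-1 (f^`M(i)).
Proof.
move=> hf m md; rewrite mcoeff_deriv hf ?mul0rn // mdegD mdeg1 addn1.
by case: d md {hf}.
Qed.

Lemma order_ge_sub_const f : order_ge 1 (f - (f@_0%MM)%:MP).
Proof.
move=> m; rewrite ltnS leqn0 mdeg_eq0 => /eqP ->.
by rewrite mcoeffB mcoeffC eqxx mulr1 subrr.
Qed.

Lemma order_ge_prod I (r : seq I) (f : I -> mpoly n F) (k : I -> nat) :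
  (forall i, order_ge 1 (f i)) ->
  order_ge (\sum_(i <- r) k i) (\prod_(i <- r) f i ^+ k i).
Proof.
move=> hf; elim: r => [|i r IH]; first by rewrite !big_nil.
rewrite !big_cons; apply: order_geM => //.
elim: (k i) => [|j IHj] //; rewrite exprS -add1n.
exact: order_geM.
Qed.

Lemma mpoly_alg_ind (P : mpoly n F -> Prop) :
  (forall c, P c%:MP) -> (forall i, P 'X_i) ->
  (forall f g, P f -> P g -> P (f + g)) ->
  (forall f g, P f -> P g -> P (f * g)) -> forall f, P f.
Proof.
move=> Pc Px Pa Pm; elim/mpolyind => [|c m p _ _ Pp].
  by rewrite -mpolyC0; apply: (Pc).
apply: (Pa) => //; rewrite -mul_mpolyC; apply: (Pm) => //.
rewrite mpolyXE_id; elim/big_rec: _ => [|i q _ Pq].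
  by rewrite -mpolyC1; apply: (Pc).
apply: (Pm) => //; elim: (m i) => [|k IH]; first by rewrite expr0 -mpolyC1; apply: (Pc).
by rewrite exprS; apply: (Pm).
Qed.

Definition vector_field (L : 'I_n -> mpoly n F) f := \sum_v L v * f^`M(v).

Lemma vector_field_linear L : linear (vector_field L).
Proof.
move=> a f g; rewrite /vector_field scaler_sumr -big_split; apply: eq_bigr => v _ /=.
by rewrite linearP mulrDr scalerAr.
Qed.

HB.instance Definition _ L := GRing.isLinear.Build F (mpoly n F) (mpoly n F) _
  (vector_field L) (vector_field_linear L).

Lemma vector_fieldM L f g :
  vector_field L (f * g) = vector_field L f * g + f * vector_field L g.
Proof.
rewrite /vector_field mulr_suml mulr_sumr -big_split; apply: eq_bigr => v _ /=.
rewrite mderivM mulrDr !mulrA; congr (_ + _); by rewrite [L v * f]mulrC.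
Qed.

Lemma vector_fieldX L i : vector_field L 'X_i = L i.
Proof.
rewrite /vector_field (bigD1 i) //= big1 ?addr0 => [|j ji].
  rewrite mderivX mnm1E eqxx scale1r (_ : (_ - _)%MM = 0%MM) ?mpolyX0 ?mulr1 //.
  by apply/mnmP => k; rewrite mnmBE subnn mnm0E.
by rewrite mderivX mnm1E eq_sym (negPf ji) scale0r mulr0.
Qed.

Lemma vector_fieldC L c : vector_field L c%:MP = 0.
Proof. by rewrite /vector_field big1 // => v _; rewrite mderivC mulr0. Qed.

Lemma order_ge_vector_field L d f : order_ge d f -> order_ge d.-1 (vector_field L f).
Proof.
move=> hf; apply: order_ge_sum => v; rewrite -[d.-1]add0n; apply: order_geM => //.
exact: order_ge_deriv.
Qed.

(** The second-order terms of the two compositions agree by symmetry of mixed partial derivatives,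
    so only a derivation is left. *)
Lemma vector_field_lie L L' f :
  vector_field L (vector_field L' f) - vector_field L' (vector_field L f) =
  vector_field (fun v => vector_field L (L' v) - vector_field L' (L v)) f.
Proof.
have E L1 L2 : vector_field L1 (vector_field L2 f) =
    \sum_v vector_field L1 (L2 v) * f^`M(v) +
    \sum_v \sum_u L2 v * (L1 u * f^`M(v)^`M(u)).
  rewrite [in LHS]/vector_field -big_split /=.
  under [LHS]eq_bigr => u _ do rewrite raddf_sum mulr_sumr.
  rewrite exchange_big; apply: eq_bigr => v _ /=.
  under [LHS]eq_bigr => u _ do rewrite mderivM mulrDr.
  rewrite big_split /=; congr (_ + _).
    by rewrite /vector_field mulr_suml; apply: eq_bigr => u _; rewrite mulrA.
  by apply: eq_bigr => u _; rewrite mulrCA.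
rewrite !E [X in _ - (_ + X)]exchange_big /= opprD addrACA -[RHS]addr0; congr (_ + _).
  by rewrite -sumrB; apply: eq_bigr => v _; rewrite mulrBl.
apply/eqP; rewrite subr_eq0; apply/eqP; apply: eq_bigr => v _; apply: eq_bigr => u _.
by rewrite mderiv_comm mulrCA.
Qed.

End PolynomialOrder.

(** * Linear vector fields and independence of ordered monomials *)

Section LinearVectorFields.
Import mpoly.
Variables (F : fieldType) (g : lieAlgType F) (n : nat) (rho : g -> 'M[F]_n).
Hypothesis rho_linear : linear rho.
Hypothesis rho_lie : forall x y, rho (lie x y) = rho x *m rho y - rho y *m rho x.
Variable p : 'rV[F]_n.

(** The linear field [w |-> w *m rho x] on row vectors, in the coordinates [X = w - p]. Orders at
    the origin are thus orders at [p], and the constant terms form the tangent vector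
    [p *m rho x]. *)
Definition orbit_field (x : g) (v : 'I_n) : mpoly n F :=
  \sum_u (rho x u v) *: ('X_u + (p 0 u)%:MP).

Lemma orbit_field_coef0 x v : (orbit_field x v)@_0%MM = (p *m rho x) 0 v.
Proof.
rewrite /orbit_field raddf_sum mxE; apply: eq_bigr => u _ /=.
rewrite mcoeffZ mcoeffD mcoeffX mcoeffC eqxx mulr1 mnm1_eq0 add0r.
exact: mulrC.
Qed.

Fact orbit_actDl a x y f : vector_field (orbit_field (a *: x + y)) f =
  a *: vector_field (orbit_field x) f + vector_field (orbit_field y) f.
Proof.
rewrite /vector_field scaler_sumr -big_split; apply: eq_bigr => v _ /=.
rewrite scalerAl -mulrDl; congr (_ * _); rewrite /orbit_field scaler_sumr -big_split.
by apply: eq_bigr => u _; rewrite /= rho_linear !mxE scalerDl scalerA.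
Qed.

Fact orbit_act_lie x y f : vector_field (orbit_field (lie x y)) f =
  vector_field (orbit_field x) (vector_field (orbit_field y) f) -
  vector_field (orbit_field y) (vector_field (orbit_field x) f).
Proof.
rewrite vector_field_lie; apply: eq_bigr => v _; congr (_ * _).
have E x' y' : vector_field (orbit_field x') (orbit_field y' v) =
    \sum_u ((rho x' *m rho y') u v) *: ('X_u + (p 0 u)%:MP).
  rewrite [in LHS]/orbit_field raddf_sum /=.
  have E1 u : vector_field (orbit_field x') (rho y' u v *: ('X_u + (p 0 u)%:MP)) =
      rho y' u v *: orbit_field x' u.
    by rewrite linearZ raddfD /= vector_fieldC addr0 vector_fieldX.
  under eq_bigr => u _ do rewrite E1 /orbit_field scaler_sumr.
  rewrite exchange_big; apply: eq_bigr => w _ /=.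
  rewrite mxE scaler_suml; apply: eq_bigr => u _.
  by rewrite scalerA mulrC.
rewrite !E /orbit_field -sumrB; apply: eq_bigr => u _.
by rewrite rho_lie mxE [X in _ + X]mxE scalerBl.
Qed.

Definition orbit_rep : lie_rep g (mpoly n F) :=
  LieRep orbit_actDl (fun x => vector_field_linear (orbit_field x)) orbit_act_lie.

Variables (N : nat) (b : 'I_N -> g) (C : 'M[F]_(n, N)).
Hypothesis bC : forall j i, (p *m rho (b j) *m C) 0 i = (i == j)%:R.

(** By [bC], these linear forms are dual to the tangent vectors at [p] of the fields of the
    [b j]. *)
Definition dual_form (i : 'I_N) : mpoly n F := \sum_v (C v i) *: 'X_v.
Definition subst_forms (Q : mpoly N F) : mpoly n F := mmap (@mpolyC n F) dual_form Q.

Lemma order_ge_dual_form i : order_ge 1 (dual_form i).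
Proof.
apply: order_ge_sum => v; apply: order_geZ => m; rewrite ltnS leqn0 mdeg_eq0 => /eqP ->.
by rewrite mcoeffX mnm1_eq0.
Qed.

Lemma order_ge_subst d Q : order_ge d Q -> order_ge d (subst_forms Q).
Proof.
move=> hQ; rewrite /subst_forms /mmap; apply: order_ge_sum => m.
have [md|md] := ltnP (mdeg m) d; first by rewrite hQ // mpolyC0 mul0r; apply: order_ge0.
rewrite mul_mpolyC; apply: order_geZ; apply: order_geW md _.
rewrite /mmap1 mdegE; exact/order_ge_prod/order_ge_dual_form.
Qed.

(** With its coefficients frozen at [p], the field of [b j] is constant, and by duality it
    differentiates polynomials in the dual forms along the [j]-th one. The Leibniz rule reduces this
    to constants and variables. *)
Lemma subst_forms_deriv j Q :
  vector_field (fun v => ((orbit_field (b j) v)@_0%MM)%:MP) (subst_forms Q) =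
  subst_forms (Q^`M(j)).
Proof.
elim/mpoly_alg_ind: Q => [c|i|f h IHf IHh|f h IHf IHh].
- by rewrite mderivC /subst_forms mmapC vector_fieldC raddf0.
- rewrite /subst_forms mmapX mmap1U /dual_form.
  have -> : 'X_i^`M(j) = ((i == j)%:R)%:MP :> mpoly N F.
    rewrite mderivX mnm1E; have [->|ij] := eqVneq i j.
      rewrite scale1r (_ : (_ - _)%MM = 0%MM) ?mpolyX0 //.
      by apply/mnmP => k; rewrite mnmBE subnn mnm0E.
    by rewrite scale0r mpolyC0.
  rewrite mmapC -bC mxE !raddf_sum /=; apply: eq_bigr => v _.
  by rewrite linearZ /= vector_fieldX orbit_field_coef0 -mul_mpolyC -mpolyCM mulrC.
- by rewrite raddfD /subst_forms !raddfD /= -/(subst_forms _) IHf IHh.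
- rewrite mderivM /subst_forms raddfD /= !rmorphM /= vector_fieldM.
  by rewrite -/(subst_forms _) IHf IHh.
Qed.

Definition has_symbol k (u : uea g) (A : mpoly N F -> mpoly N F) :=
  [/\ forall d f, order_ge d f ->
        order_ge (d - k) (u *: (f : repmod orbit_rep) : mpoly n F),
      forall d Q, order_ge d Q -> order_ge (d - k) (A Q)
    & forall d Q, (k <= d)%N -> order_ge d Q ->
        order_ge (d - k).+1
          ((u *: (subst_forms Q : repmod orbit_rep) : mpoly n F) - subst_forms (A Q))].

Lemma has_symbol1 : has_symbol 0 1 id.
Proof.
split=> [d f|d Q|d Q _ _]; rewrite ?subn0 ?scale1r //.
by rewrite subrr; apply: order_ge0.
Qed.

Lemma has_symbolM k l u v A B :
  has_symbol k u A -> has_symbol l v B -> has_symbol (k + l) (u * v) (A \o B).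
Proof.
move=> [u1 u2 u3] [v1 v2 v3]; split=> [d f hf|d Q hQ|d Q kld hQ].
- by rewrite -scalerA addnC subnDA; apply/u1/v1.
- by rewrite addnC subnDA; apply/u2/v2.
- have ld : (l <= d)%N by apply: leq_trans kld; apply: leq_addl.
  have kd : (k <= d - l)%N by rewrite leq_subRL // addnC.
  rewrite -scalerA addnC subnDA.
  have H1 := u3 _ _ kd (v2 _ _ hQ).
  have := u1 _ _ (v3 _ _ ld hQ); rewrite subSn // => H2.
  have := order_geD H2 H1.
  by rewrite [u *: (_ - _)](scalerBr u) addrA subrK.
Qed.

(** The field of [b j] minus its frozen part has coefficients vanishing at [p]; these make up for
    the order lost by differentiation. *)
Lemma has_symbol_var j : has_symbol 1 (uvar (b j)) (mderiv j).
Proof.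
split=> [d f hf|d Q hQ|d Q d1 hQ].
- by rewrite rep_varE /= subn1; apply: order_ge_vector_field.
- by rewrite subn1; apply: order_ge_deriv.
- rewrite rep_varE /= -subst_forms_deriv subn1 prednK //.
  rewrite /vector_field -sumrB; apply: order_ge_sum => v; rewrite -mulrBl.
  rewrite -(prednK d1) -add1n; apply: order_geM; first exact: order_ge_sub_const.
  exact/order_ge_deriv/order_ge_subst.
Qed.

Lemma has_symbol_mnm (m : multinom N) :
  has_symbol (mdeg m) (mmap1 (fun i => uvar (b i)) m) (mderivm m).
Proof.
have E : index_enum 'I_N = enum 'I_N by rewrite enumT; unlock index_enum.
rewrite /mmap1 mdegE /mderivm E.
elim: (enum _) => [|i s IH] /=; first by rewrite !big_nil; exact: has_symbol1.
rewrite !big_cons; apply: has_symbolM => //.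
elim: (m i) => [|k IHk]; first exact: has_symbol1.
by rewrite exprS -add1n; apply: has_symbolM => //; apply: has_symbol_var.
Qed.

Hypothesis char0 : [pchar F] =i pred0.

(** Let [a] be a monomial of maximal degree in [P]. Apply the vanishing element to [subst_forms
    'X_[a]] and take the constant term: a monomial [m] contributes the constant term of the [m]-th
    derivative of ['X_[a]]. This is zero unless [m = a], where it is a product of factorials,
    nonzero in characteristic zero. *)
Lemma ordered_monomials_free (P : mpoly N F) :
  mmap (in_alg (uea g)) (fun i => uvar (b i)) P = 0 -> P = 0.
Proof.
move=> P0; apply: contraTeq isT => nzP; apply/negP => _.
have : exists2 a, a \in msupp P & forall m, m \in msupp P -> (mdeg m <= mdeg a)%N.
  case: (msupp P) (msupp_eq0 P) => [|m0 s _]; first by rewrite eqxx (negPf nzP).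
  elim: s m0 => [|m1 s IH] m0; first by exists m0 => [|m]; rewrite inE // => /eqP ->.
  have [a ain ha] := IH m1.
  have [le|lt] := leqP (mdeg m0) (mdeg a).
    exists a => [|m]; rewrite inE; first by rewrite ain orbT.
    by case/orP => [/eqP ->//|/ha].
  exists m0 => [|m]; rewrite inE ?eqxx //.
  by case/orP => [/eqP -> //|/ha/leq_trans]; apply; apply: ltnW.
move=> [a aP amax].
pose f : repmod orbit_rep := subst_forms 'X_[a].
have of_a : order_ge (mdeg a) ('X_[a] : mpoly N F).
  by move=> m ma; rewrite mcoeffX; case: eqP ma => // ->; rewrite ltnn.
(* Since [mdeg m <= mdeg a], the symbol describes the action up to an error of positive order, which
   has no constant term. *)
have E m : m \in msupp P ->
    ((mmap1 (fun i => uvar (b i)) m *: f : mpoly n F)@_0%MM =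
    ('X_[a] : mpoly N F)^`M[m]@_0%MM).
  move=> mP; have [h1 h2 h3] := has_symbol_mnm m.
  have H := h3 _ _ (amax _ mP) of_a.
  have := H 0%MM; rewrite mdeg0 mcoeffB => /(_ isT)/eqP; rewrite subr_eq0 => /eqP ->.
  have := @order_ge_subst 1 _ (order_ge_sub_const ('X_[a]^`M[m])) 0%MM.
  rewrite mdeg0 {1}/subst_forms raddfB /= mmapC mcoeffB mcoeffC eqxx mulr1 => /(_ isT).
  by move=> /eqP; rewrite subr_eq0 => /eqP.
have := congr1 (fun u : uea g => (u *: f : mpoly n F)@_0%MM) P0.
rewrite scale0r mcoeff0 /mmap scaler_suml raddf_sum /=.
rewrite (eq_big_seq (fun m => P@_m * ('X_[a] : mpoly N F)^`M[m]@_0%MM)); last first.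
  move=> m mP /=; rewrite -scalerA [_ *: (_ *: f)](@rep_scalE F g _ orbit_rep) mcoeffZ.
  by rewrite E.
rewrite (bigD1_seq a) ?msupp_uniq //= big1 ?addr0.
  rewrite mcoeff_mderivm addm0 mcoeffX eqxx => /eqP; rewrite mulf_eq0.
  rewrite (negPf _ : P@_a == 0 = false); last by rewrite -mcoeff_msupp.
  rewrite /= ((pcharf0P F).1 char0) => /eqP.
  have : (0 < \prod_(i < N) a i ^_ (a i))%N.
    by apply: prodn_gt0 => i; rewrite ffactnn fact_gt0.
  by case: (\prod_(_ < _) _)%N.
move=> m ma; rewrite mcoeff_mderivm addm0 mcoeffX eq_sym (negPf ma) mul0rn mulr0.
by [].
Qed.

End LinearVectorFields.

(** * Ordered monomials span the enveloping algebra *)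

Section OrderedMonomials.
Import mpoly.
Variables (F : fieldType) (g : lieAlgType F) (N : nat) (b : 'I_N -> g).
Hypothesis b_span : forall x, exists c : 'I_N -> F, x = \sum_i c i *: b i.
Local Notation h := (fun i => uvar (b i)).
Local Notation Theta := (mmap (in_alg (uea g)) h).

(** As [msize] is the degree plus one, the bound means degree less than [k]. The products in [Theta]
    follow the order of the indices, which matters in the noncommutative [uea g]. *)
Definition ordered_span k (u : uea g) :=
  exists2 P : mpoly N F, u = Theta P & (msize P <= k)%N.

Lemma ordered_spanW k l u : (k <= l)%N -> ordered_span k u -> ordered_span l u.
Proof. by move=> kl [P -> Pk]; exists P => //; apply: leq_trans kl. Qed.

Lemma ordered_span_lin k a u v :
  ordered_span k u -> ordered_span k v -> ordered_span k (a *: u + v).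
Proof.
move=> [P -> Pk] [Q -> Qk]; exists (a *: P + Q).
  by rewrite raddfD /= mmapZ mulr_algl.
apply: leq_trans (msizeD_le _ _) _; rewrite geq_max Qk andbT.
exact: leq_trans (msizeZ_le _ _) Pk.
Qed.

Lemma ordered_span0 k : ordered_span k 0.
Proof. by exists 0; rewrite ?raddf0 // msize0. Qed.

Lemma ordered_spanD k u v : ordered_span k u -> ordered_span k v -> ordered_span k (u + v).
Proof. by rewrite -[u in _ -> _ -> ordered_span k (u + _)]scale1r; apply: ordered_span_lin. Qed.

Lemma ordered_span_sum k I (r : seq I) (c : I -> F) (f : I -> uea g) :
  (forall i, ordered_span k (f i)) -> ordered_span k (\sum_(i <- r) c i *: f i).
Proof.
move=> hf; elim/big_rec: _ => [|i u _ hu]; first exact: ordered_span0.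
exact: ordered_span_lin.
Qed.

Lemma ordered_span_mnm m : ordered_span (mdeg m).+1 (mmap1 h m).
Proof. by exists 'X_[m]; rewrite ?mmapX // msizeX. Qed.

Lemma mulr_min_mnm (j : 'I_N) (m : multinom N) : (forall i : 'I_N, (i < j)%N -> m i = 0%N) ->
  h j * mmap1 h m = mmap1 h (U_(j) + m)%MM.
Proof.
move=> m0; rewrite /mmap1.
have E : index_enum 'I_N = enum 'I_N by rewrite enumT; unlock index_enum.
rewrite E; have : forall i, i \in enum 'I_N -> index i (enum 'I_N) = i.
  by move=> i _; rewrite index_enum_ord.
have : uniq (enum 'I_N) by apply: enum_uniq.
have : j \in enum 'I_N by rewrite mem_enum.
case/splitPr => r1 r2; rewrite cat_uniq /= => /and3P[_ nr1 /andP[jr2 _]] idx.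
rewrite !big_cat !big_cons /=.
have lt i : i \in r1 -> (i < j)%N.
  move=> ir1; rewrite -[X in (X < _)%N]idx ?mem_cat ?ir1 //.
  rewrite -[X in (_ < X)%N]idx ?mem_cat ?inE ?eqxx ?orbT //.
  rewrite !index_cat ir1 (_ : j \in r1 = false).
    by rewrite /= eqxx addn0 index_mem.
  by move: nr1; rewrite negb_or => /andP[/negPf].
have one m' : (forall i, i \in r1 -> m' i = 0%N) -> \prod_(i <- r1) h i ^+ m' i = 1.
  by move=> m'0; rewrite big1_seq // => i /= ir1; rewrite m'0 ?expr0.
rewrite !one ?mul1r => [|i ir1|i ir1]; last 2 first.
- rewrite mnmDE mnm1E m0 ?lt // addn0.
  by have := lt _ ir1; case: eqP => [->|]; rewrite ?ltnn.
- by rewrite m0 ?lt.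
rewrite mnmDE mnm1E eqxx add1n exprS mulrA; congr (_ * _).
apply: eq_big_seq => i ir2; rewrite mnmDE mnm1E.
by case: eqP ir2 jr2 => [<- -> //|_ _ _]; rewrite add0n.
Qed.

(** Straightening. If the first variable [i] of [m] precedes [j], then [h j * h i] is [h i * h j]
    plus a bracket, and both the bracket and the further reordering of [h j] only concern smaller
    degrees. *)
Lemma ordered_span_mul_mnm k (j : 'I_N) (m : multinom N) : mdeg m = k ->
  ordered_span k.+1 (h j * mmap1 h m - mmap1 h (U_(j) + m)%MM).
Proof.
elim/ltn_ind: k j m => k IH j m mk.
(* In the degrees already treated, multiplication by a generator raises the filtration by at most
   one. *)
have IHl l j' u : (l <= k)%N -> ordered_span l u -> ordered_span l.+1 (h j' * u).
  move=> lk [P -> Pl]; rewrite /mmap mulr_sumr big_seq.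
  elim/big_rec: _ => [|m' u' m'P hu']; first exact: ordered_span0.
  rewrite mulr_algl -scalerAr; apply: ordered_span_lin => //.
  have m'l : (mdeg m' < l)%N by apply: leq_trans Pl; apply: msize_mdeg_lt.
  rewrite -[h j' * _](subrK (mmap1 h (U_(j') + m')%MM)); apply: ordered_spanD.
    by apply: ordered_spanW (IH _ (leq_trans m'l lk) j' m' erefl); rewrite ltnS ltnW.
  apply: ordered_spanW (ordered_span_mnm _).
  by rewrite mdegD mdeg1 add1n ltnS.
case: (pickP (fun i => m i != 0%N)) => [i0 mi0|m0]; last first.
  rewrite mulr_min_mnm ?subrr; first exact: ordered_span0.
  by move=> i _; apply/eqP; rewrite -[_ == _]negbK m0.
have [i mi imin] := @arg_minnP _ i0 (fun i => m i != 0%N) val mi0.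
have [ji|ij] := leqP j i.
  rewrite mulr_min_mnm ?subrr; first exact: ordered_span0.
  move=> i' i'j; apply/eqP; apply: contraTT (leq_trans i'j ji) => /imin.
  by rewrite -leqNgt.
have ltm (i' : 'I_N) : (i' < i)%N -> m i' = 0%N.
  by move=> i'i; apply/eqP; apply: contraTT i'i => /imin; rewrite -leqNgt.
pose m' := (m - U_(i))%MM.
have Em : m = (U_(i) + m')%MM.
  rewrite addmC submK //; apply/mnm_lepP => l; rewrite mnm1E.
  by case: eqP => // <-; rewrite lt0n.
have km' : k = (mdeg m').+1 by rewrite -mk Em mdegD mdeg1.
have ltm' (l : 'I_N) : (l < i)%N -> m' l = 0%N by move=> li; rewrite mnmBE ltm.
rewrite Em -mulr_min_mnm // mulrA.
have -> : h j * h i = h i * h j + uvar (lie (b j) (b i)).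
  by rewrite uvar_lieE addrC subrK.
have -> : mmap1 h (U_(j) + (U_(i) + m'))%MM = h i * mmap1 h (U_(j) + m')%MM.
  rewrite mulr_min_mnm => [|l li]; first by rewrite !addmA [(U_(i) + _)%MM]addmC.
  rewrite mnmDE mnm1E ltm' // addn0; case: eqP => // jl.
  by move: ij; rewrite jl ltnNge ltnW.
rewrite mulrDl addrAC -mulrA -mulrBr; apply: ordered_spanD.
  by apply: IHl => //; rewrite km'; apply: IH => //; rewrite km'.
have [c ->] := b_span (lie (b j) (b i)).
rewrite raddf_sum mulr_suml.
under eq_bigr => l _ do rewrite /= linearZ -scalerAl.
apply: ordered_span_sum => l; apply: IHl => //.
by rewrite km'; apply: ordered_span_mnm.
Qed.

Lemma ordered_monomials_span (u : uea g) : exists P : mpoly N F, u = Theta P.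
Proof.
have Tvar j P : exists P', h j * Theta P = Theta P' :> uea g.
  rewrite {1}/mmap mulr_sumr; elim/big_rec: _ => [|m u' _ [P1 ->]].
    by exists 0; rewrite raddf0.
  rewrite mulr_algl -scalerAr.
  have [P2 E2 _] := @ordered_span_mul_mnm _ j m erefl.
  exists (P@_m *: (P2 + 'X_[U_(j) + m]) + P1).
  by rewrite raddfD /= mmapZ raddfD /= mmapX -E2 subrK mulr_algl.
suff H v : (exists P, v = Theta P) -> exists P, u * v = Theta P.
  by rewrite -[u]mulr1; apply: H; exists 1; rewrite -mpolyC1 mmapC /= scale1r.
elim/uea_ind: u v => [x|c|u w IHu IHw|u w IHu IHw] v.
- move=> [P ->]; have [c ->] := b_span x.
  rewrite raddf_sum mulr_suml /=; elim/big_rec: _ => [|i w _ [P' ->]].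
    by exists 0; rewrite raddf0.
  rewrite linearZ -scalerAl; have [P'' ->] := Tvar i P.
  by exists (c i *: P'' + P'); rewrite raddfD /= mmapZ mulr_algl.
- by move=> [P ->]; exists (c *: P); rewrite mmapZ.
- move=> /[dup] /IHu [P E] /IHw [P' E']; exists (P + P').
  by rewrite mulrDl E E' raddfD.
- by move=> /IHw/IHu; rewrite mulrA.
Qed.

End OrderedMonomials.

(** * Independence of ordered monomials when the center is zero *)

Section AdjointOrbit.
Import VectorInternalTheory.
Import mpoly.
Variables (F : fieldType) (g : finLieAlgType F).
Local Notation N := (dim g).

Lemma ad_mx_linear : linear (@ad_mx F g).
Proof.
move=> a x y; apply/row_matrixP => i; rewrite linearP /= !rowE -[delta_mx 0 i]r2vK.
by rewrite !ad_mxE -linearP /= -lie_linearl.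
Qed.

Lemma ad_mx_lie (x y : g) : ad_mx (lie x y) = ad_mx y *m ad_mx x - ad_mx x *m ad_mx y.
Proof.
apply/row_matrixP => i; rewrite linearB /= !rowE -[delta_mx 0 i]r2vK.
rewrite !mulmxA !ad_mxE -linearB; congr v2r; move: (r2v _) => v.
have := lie_jacobi x y v; rewrite (lieC v x) (lieC v (lie x y)).
have -> : lie y (- lie x v) = - lie y (lie x v) by rewrite -scaleN1r lieZr scaleN1r.
by move=> /eqP; rewrite subr_eq0 => /eqP ->.
Qed.

(** [ad_mx] reverses brackets because its matrices act on row vectors; the sign turns right
    multiplication by it into a representation. *)
Definition right_ad (x : g) : 'M[F]_(N * N) := lin_mulmxr (- ad_mx x).

Lemma right_ad_linear : linear right_ad.
Proof.
move=> a x y; rewrite /right_ad -[RHS]linearP; congr (lin_mulmxr _).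
by rewrite ad_mx_linear opprD scalerN.
Qed.

Lemma right_ad_lie x y : right_ad (lie x y) =
  right_ad x *m right_ad y - right_ad y *m right_ad x.
Proof.
have E (A B : 'M[F]_N) : lin_mulmxr A *m lin_mulmxr B = lin_mulmxr (A *m B) :> 'M_(N * N).
  apply/row_matrixP => i; rewrite !rowE mulmxA -[delta_mx 0 i]vec_mxK.
  by rewrite !mul_vec_lin /= mulmxA.
rewrite /right_ad !E -[RHS]linearB; congr (lin_mulmxr _).
by rewrite ad_mx_lie !mulNmx !mulmxN !opprK opprB.
Qed.

Hypothesis center0 : forall x : g, (forall y, lie x y = 0) -> x = 0.
Hypothesis char0 : [pchar F] =i pred0.

(** The base point is the identity matrix, where the field of [x] has the value [- ad_mx x]. As the
    center is zero, independent elements have independent tangent vectors there, and a right inverse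
    of their matrix [B] gives the dual forms. *)
Lemma pbw_free k (b : 'I_k -> g) :
  (forall c : 'I_k -> F, \sum_i c i *: b i = 0 -> forall i, c i = 0) ->
  forall P : mpoly k F, mmap (in_alg (uea g)) (fun i => uvar (b i)) P = 0 -> P = 0.
Proof.
move=> bfree P; pose p : 'rV[F]_(N * N) := mxvec 1%:M.
have pE x : p *m right_ad x = mxvec (- ad_mx x).
  by rewrite mul_vec_lin /= mul1mx.
pose B := \matrix_(j < k) (p *m right_ad (b j)).
have Bfree : row_free B.
  apply: inj_row_free => c; rewrite mulmx_sum_row => cB; apply/rowP => i.
  rewrite mxE; apply: (bfree (fun i => c 0 i)); apply: center0 => y.
  have E : ad_mx (\sum_i c 0 i *: b i) = \sum_i c 0 i *: ad_mx (b i).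
    have ad0 : ad_mx (0 : g) = 0.
      by rewrite -[X in ad_mx X](scaler0 _ 0) -[X in ad_mx X]addr0 ad_mx_linear scale0r add0r
         -(subrr (0 : g)) -scaleN1r addrC ad_mx_linear scaleN1r addNr.
    elim/big_rec2: _ => [//|j A x _ <-]; exact: ad_mx_linear.
  apply: (can_inj v2rK); rewrite -ad_mxE E linear0; apply: (can_inj mxvecK).
  have -> : \sum_i0 c 0 i0 *: ad_mx (b i0) = 0; last by rewrite mulmx0.
  apply: (can_inj mxvecK); apply: oppr_inj; rewrite linear0 oppr0 -{}cB.
  rewrite linear_sum -sumrN; apply: eq_bigr => j _.
  by rewrite rowK pE linearZ linearN scalerN.
apply: (@ordered_monomials_free F g _ right_ad right_ad_linear right_ad_lie p k b
  (pinvmx B)) => // j i.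
transitivity ((B *m pinvmx B) j i); last by rewrite mulmxVp // mxE eq_sym.
by rewrite mxE [RHS]mxE; apply: eq_bigr => l _; rewrite [B _ _]mxE.
Qed.

End AdjointOrbit.

(** * The enveloping algebra as a free module over U(h) *)

Section RelativeLift.
Import mpoly.
Variables (F : fieldType) (g : finLieAlgType F) (h : cartan g).
Hypothesis center0 : forall x : g, (forall y, lie x y = 0) -> x = 0.
Hypothesis char0 : [pchar F] =i pred0.
Local Notation S := (uh h).
Local Notation n := (\dim {: lie_of h}).
Local Notation q := (\dim (lsub h)^C).
Local Notation vb := (vbasis {: lie_of h}).

(** With [h] listed first, every ordered monomial is an element of [S] times an ordered monomial in
    the complement. *)
Definition adapted_basis (i : 'I_(n + q)) : g :=
  match split i with
  | inl j => lsval (vb`_j : lie_of h) | inr j => (vbasis (lsub h)^C)`_j end.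
Local Notation b := adapted_basis.

Lemma adapted_basisl i : b (lshift q i) = lsval (vb`_i : lie_of h).
Proof. by rewrite /b (unsplitK (inl i)). Qed.

Lemma adapted_basisr i : b (rshift n i) = (vbasis (lsub h)^C)`_i.
Proof. by rewrite /b (unsplitK (inr i)). Qed.

Lemma adapted_basis_free (c : 'I_(n + q) -> F) :
  \sum_i c i *: b i = 0 -> forall i, c i = 0.
Proof.
rewrite big_split_ord /=.
under eq_bigr => i _ do rewrite adapted_basisl -linearZ.
under [X in _ + X]eq_bigr => i _ do rewrite adapted_basisr.
rewrite -linear_sum /=; set y := \sum_(i < n) _; set w := \sum_(i < q) _ => yw.
have wC : w \in (lsub h)^C%VS.
  by apply: memv_suml => i _; apply/memvZ/vbasis_mem/mem_nth; rewrite size_tuple.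
have w0 : w = 0.
  apply/eqP; rewrite -memv0 -(capv_compl (lsub h)) memv_cap wC andbT.
  have -> : w = - lsval y by apply/eqP; rewrite -addr_eq0 addrC yw.
  by rewrite memvN; apply: lsvalP.
have y0 : y = 0 by apply: lsval_inj; rewrite linear0 -yw w0 addr0.
have fr := basis_free (vbasisP {: lie_of h}).
have fw := basis_free (vbasisP (lsub h)^C).
move=> i; rewrite -(splitK i); case: (split i) => j.
  by move/freeP: fr => /(_ (fun j => c (lshift q j)) y0 j).
by move/freeP: fw => /(_ (fun j => c (rshift n j)) w0 j).
Qed.

Lemma adapted_basis_span x : exists c : 'I_(n + q) -> F, x = \sum_i c i *: b i.
Proof.
have : x \in (lsub h + (lsub h)^C)%VS by rewrite addv_complf memvf.
case/memv_addP => y yh [w wC ->].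
pose y' : lie_of h := vsproj (lsub h) y.
exists (fun i => match split i with
  | inl j => coord vb j y' | inr j => coord (vbasis (lsub h)^C) j w end).
rewrite big_split_ord /=; congr (_ + _).
  rewrite -(vsprojK yh) -[LHS]/(lsval y') {1}[y'](coord_vbasis (memvf _)) linear_sum /=.
  by apply: eq_bigr => i _; rewrite (unsplitK (inl i)) adapted_basisl.
rewrite {1}(coord_vbasis wC); apply: eq_bigr => i _.
by rewrite (unsplitK (inr i)) adapted_basisr.
Qed.

Local Notation Theta := (mmap (in_alg (uea g)) (fun i => uvar (b i))).

Variables (P Q : lmodType S) (pi : {linear P -> Q}) (phi : uea g -> Q) (p0 : P).
Hypothesis phiP : forall a u v, phi (uincl a * u + v) = a *: phi u + phi v.
Hypothesis pi_onto : forall u, exists p, pi p = phi u.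
Hypothesis pi_p0 : pi p0 = phi 1.

Let yl (m : multinom (n + q)) : S := \prod_(i < n) (uvar (vb`_i : lie_of h) : S) ^+ m (lshift q i).
Let zr (m : multinom (n + q)) : uea g := \prod_(j < q) uvar (b (rshift n j)) ^+ m (rshift n j).
(** The lift depends only on the exponents in the complement, which gives [S]-linearity of [Psi];
    the monomial 1 gets the prescribed lift [p0]. *)
Let pr (m : multinom (n + q)) : P :=
  if [forall j : 'I_q, m (rshift n j) == 0%N] then p0 else sval (cid (pi_onto (zr m))).
Let term (f : mpoly (n + q) F) m : P := f@_m *: yl m *: pr m.
Let Psi f : P := \sum_(m <- msupp f) term f m.

Let mnmE m : mmap1 (fun i => uvar (b i)) m = uincl (yl m) * zr m.
Proof.
rewrite /mmap1 big_split_ord /= /yl rmorph_prod; congr (_ * _).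
by apply: eq_bigr => i _; rewrite adapted_basisl rmorphXn /= /uincl ulift_var.
Qed.

Let pi_pr m : pi (pr m) = phi (zr m).
Proof.
rewrite /pr; case: ifP => [/forallP m0|_]; last by case: cid.
rewrite pi_p0 /zr big1 // => j _.
by rewrite (eqP (m0 j)) expr0.
Qed.

Let PsiE (s : seq (multinom (n + q))) f : uniq s -> {subset msupp f <= s} ->
  Psi f = \sum_(m <- s) term f m.
Proof.
move=> us fs; rewrite /Psi [RHS](bigID (fun m => m \in msupp f)) /=.
rewrite [X in _ = _ + X]big1 ?addr0; last first.
  by move=> m /memN_msupp_eq0; rewrite /term => ->; rewrite !scale0r.
rewrite -[RHS]big_filter; apply: perm_big; apply: uniq_perm.
- exact: msupp_uniq.
- exact: filter_uniq.
- move=> m; rewrite mem_filter; case mf: (m \in msupp f) => //=.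
  by apply/esym/fs.
Qed.

Let PsiD a f f' : Psi (a *: f + f') = (a%:A : S) *: Psi f + Psi f'.
Proof.
pose s := undup (msupp f ++ msupp f' ++ msupp (a *: f + f')).
have us : uniq s by exact: undup_uniq.
rewrite (@PsiE s) // => [|m ms]; last by rewrite mem_undup !mem_cat ms !orbT.
rewrite (@PsiE s f) // => [|m ms]; last by rewrite mem_undup !mem_cat ms.
rewrite (@PsiE s f') // => [|m ms]; last by rewrite mem_undup !mem_cat ms !orbT.
rewrite scaler_sumr -big_split; apply: eq_bigr => m _ /=; rewrite /term.
rewrite mcoeffD mcoeffZ scalerDl scalerDl; congr (_ + _).
by rewrite scalerA mulr_algl scalerA.
Qed.

Let ylU i m : yl (U_(lshift q i) + m) = (uvar (vb`_i : lie_of h) : S) * yl m.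
Proof.
rewrite /yl (bigD1 i) //= [in RHS](bigD1 i) //= mulrA; congr (_ * _).
  by rewrite mnmDE mnm1E eqxx add1n exprS.
by apply: eq_bigr => j ji; rewrite mnmDE mnm1E eq_lshift eq_sym (negPf ji).
Qed.

Let rU i m j : (U_(lshift q i) + m)%MM (rshift n j) = m (rshift n j).
Proof. by rewrite mnmDE mnm1E eq_lrshift add0n. Qed.

Let zrU i m : zr (U_(lshift q i) + m) = zr m.
Proof. by apply: eq_bigr => j _; rewrite rU. Qed.

Let prU i m : pr (U_(lshift q i) + m) = pr m.
Proof.
rewrite /pr; under eq_forallb => j do rewrite rU.
by case: ifP => // _; rewrite zrU.
Qed.

Let PsiXl i f : Psi ('X_(lshift q i) * f) = (uvar (vb`_i : lie_of h) : S) *: Psi f.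
Proof.
elim/mpolyind: f => [|c m f _ _ IH].
  have P0 : Psi 0 = 0 by rewrite /Psi msupp0 big_nil.
  by rewrite mulr0 P0 scaler0.
rewrite mulrDr -scalerAr !PsiD IH scalerDr !scalerA; congr (_ + _).
rewrite [_ * c%:A]mulrC -[RHS]scalerA; congr (_ *: _).
rewrite -mpolyXD /Psi !msuppX !big_seq1 /term !mcoeffX !eqxx !scale1r scalerA.
by rewrite prU ylU.
Qed.

Let ThetaXl i f :
  Theta ('X_(lshift q i) * f) = uincl (uvar (vb`_i : lie_of h) : S) * Theta f.
Proof.
elim/mpolyind: f => [|c m f _ _ IH]; first by rewrite mulr0 raddf0 mulr0.
rewrite mulrDr raddfD /= IH [in RHS]raddfD /= mulrDr; congr (_ + _).
rewrite -scalerAr -mpolyXD !mmapZ /= !mulr_algl !mmapX !mnmE ylU zrU.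
by rewrite rmorphM -scalerAr mulrA.
Qed.

Let pi_Psi f : pi (Psi f) = phi (Theta f).
Proof.
have phi0 : phi 0 = 0.
  by have /eqP := phiP 1 0 0; rewrite scale1r rmorph1 mul1r addr0 -subr_eq0 opprD addNKr oppr_eq0 => /eqP.
rewrite /Psi raddf_sum /mmap /=.
elim/big_rec2: _ => [|m u v _ ->]; first by rewrite phi0.
rewrite /term linearZ_LR pi_pr -phiP mnmE [in RHS]mulrA; congr (phi (_ * _ + _)).
by rewrite -[_ *: yl m]mulr_algl rmorphM /= (uincl_scal h).
Qed.

(** The ordered monomials in the complement form a basis of [uea g] over [S], so [phi] is lifted by
    choosing lifts on this basis. Since 1 belongs to it, its lift may be prescribed. *)
Lemma uea_lift : exists psi : uea g -> P,
  [/\ forall a u v, psi (uincl a * u + v) = a *: psi u + psi v,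
      forall u, pi (psi u) = phi u & psi 1 = p0].
Proof.
pose pre u := sval (cid (ordered_monomials_span adapted_basis_span u)).
have preK u : Theta (pre u) = u by rewrite /pre; case: cid.
have inj f f' : Theta f = Theta f' -> f = f'.
  move=> ff'; apply/eqP; rewrite -subr_eq0; apply/eqP.
  by apply: (pbw_free center0 char0 adapted_basis_free); rewrite raddfB /= ff' subrr.
have preP f u : Theta f = u -> pre u = f by move=> fu; apply: inj; rewrite preK.
have PsiDF a u v : Psi (pre (a *: u + v)) = (a%:A : S) *: Psi (pre u) + Psi (pre v).
  rewrite (@preP (a *: pre u + pre v)) ?PsiD //.
  by rewrite raddfD /= mmapZ !preK mulr_algl.
have PsiA u v : Psi (pre (u + v)) = Psi (pre u) + Psi (pre v).
  by rewrite -[u in LHS]scale1r PsiDF !scale1r.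
have PsiZ a u : Psi (pre (uincl a * u)) = a *: Psi (pre u).
  elim/uea_ind: a u => [y|c|a a' IHa IHa'|a a' IHa IHa'] u.
  - have P00 : Psi (pre 0) = 0.
      by apply: (@addrI _ (Psi (pre 0))); rewrite -PsiA !addr0.
    have -> : uvar y = \sum_i coord vb i y *: (uvar vb`_i : S) :> S.
      rewrite {1}(coord_vbasis (memvf y)) linear_sum; apply: eq_bigr => i _.
      exact: linearZ_LR.
    rewrite raddf_sum /= mulr_suml scaler_suml.
    elim/big_rec2: _ => [//|i r s _ <-].
    rewrite -mulr_algl rmorphM /= (uincl_scal h) mulr_algl -scalerAl mul1r -scalerAl PsiDF; congr (_ + _).
    rewrite -[in RHS]mulr_algl -[RHS]scalerA; congr (_ *: _); rewrite -PsiXl.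
    by congr Psi; apply: preP; rewrite ThetaXl preK.
  - by rewrite (uincl_scal h) mulr_algl -[_ *: u]addr0 PsiDF (_ : Psi (pre 0) = 0) ?addr0 //;
      apply: (@addrI _ (Psi (pre 0))); rewrite -PsiA !addr0.
  - by rewrite rmorphD mulrDl PsiA IHa IHa' scalerDl.
  - by rewrite rmorphM -mulrA IHa IHa' scalerA.
exists (fun u => Psi (pre u)); split=> [a u v|u|].
- by rewrite PsiA PsiZ.
- by rewrite pi_Psi preK.
- rewrite (@preP 1); last by rewrite -mpolyC1 mmapC /= scale1r.
  rewrite -mpolyX0 /Psi msuppX big_seq1 /term mcoeffX eqxx scale1r /yl big1 ?scale1r.
    by rewrite /pr; case: ifP => // /negbT/forallPn[j]; rewrite mnm0E.
  by move=> i _; rewrite mnm0E expr0.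
Qed.

End RelativeLift.

(** * Points of the spectrum of U(h) *)

Section Points.
Import mpoly.
Variables (F : fieldType) (g : finLieAlgType F) (h : cartan g).
Local Notation S := (uh h).
Local Notation n := (\dim {: lie_of h}).
Local Notation vb := (vbasis {: lie_of h}).

Definition uh_var (i : 'I_n) : S := uvar (vb`_i : lie_of h).
Local Notation x := uh_var.

Lemma uvar_coord (y : lie_of h) : uvar y = \sum_i coord vb i y *: x i :> S.
Proof.
rewrite {1}(coord_vbasis (memvf y)) linear_sum; apply: eq_bigr => i _.
exact: linearZ_LR.
Qed.

Lemma uh_var_ind (P : S -> Prop) : (forall c : F, P c%:A) -> (forall i, P (x i)) ->
  (forall a b, P a -> P b -> P (a + b)) -> (forall a b, P a -> P b -> P (a * b)) ->
  forall a, P a.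
Proof.
move=> Pc Px Pa Pm; elim/uea_ind => // y; rewrite uvar_coord.
elim/big_rec: _ => [|i a _ IH]; first by rewrite -(scale0r 1).
apply: (Pa) => //; rewrite -mulr_algl; exact: (Pm).
Qed.

Lemma character_scal (l : dual h) c : character l (c%:A : S) = c.
Proof. by rewrite /character ulift_scal -[_%:A]/(_ * 1) mulr1. Qed.

Lemma character_var (l : dual h) y : character l (uvar y : S) = dual_app l y.
Proof. by rewrite /character ulift_var. Qed.

Lemma character0 (l : dual h) : character l 0 = 0. Proof. exact: (raddf0 (ulift (char_hom l))). Qed.
Lemma character1 (l : dual h) : character l 1 = 1. Proof. exact: (rmorph1 (ulift (char_hom l))). Qed.
Lemma characterD (l : dual h) a b : character l (a + b) = character l a + character l b.
Proof. exact: (raddfD (ulift (char_hom l))). Qed.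
Lemma characterB (l : dual h) a b : character l (a - b) = character l a - character l b.
Proof. exact: (raddfB (ulift (char_hom l))). Qed.
Lemma characterM (l : dual h) a b : character l (a * b) = character l a * character l b.
Proof. exact: (rmorphM (ulift (char_hom l))). Qed.
Lemma character_sum (l : dual h) I (r : seq I) (f : I -> S) :
  character l (\sum_(i <- r) f i) = \sum_(i <- r) character l (f i).
Proof. exact: (raddf_sum (ulift (char_hom l))). Qed.

Definition coord_point (c : 'I_n -> F) : dual h :=
  \sum_i c i *: (linfun (coord vb i : lie_of h -> F^o) : dual h).

Lemma dual_appD (l m : dual h) y : dual_app (l + m) y = dual_app l y + dual_app m y.
Proof. by rewrite /dual_app add_lfunE. Qed.
Lemma dual_appZ (a : F) (l : dual h) y : dual_app (a *: l) y = a * dual_app l y.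
Proof. by rewrite /dual_app scale_lfunE. Qed.
Lemma dual_app0 (y : lie_of h) : dual_app (0 : dual h) y = 0.
Proof. by rewrite /dual_app zero_lfunE. Qed.

Lemma coord_pointE c (i : 'I_n) : dual_app (coord_point c) (vb`_i : lie_of h) = c i.
Proof.
have E (r : seq 'I_n) y : dual_app (\sum_(j <- r) c j *: (linfun (coord vb j : lie_of h -> F^o) : dual h)) y =
    \sum_(j <- r) c j * coord vb j y.
  elim: r => [|j r IH]; first by rewrite !big_nil dual_app0.
  by rewrite !big_cons dual_appD dual_appZ IH /dual_app lfunE.
rewrite E (bigD1 i) //= big1 ?addr0 => [|j ji].
  by rewrite coord_free ?eqxx ?mulr1 // (basis_free (vbasisP _)).
by rewrite coord_free ?(basis_free (vbasisP _)) // eq_sym (negPf ji) mulr0.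
Qed.

Lemma dual_ext (l m : dual h) :
  (forall i : 'I_n, dual_app l (vb`_i : lie_of h) = dual_app m (vb`_i : lie_of h)) -> l = m.
Proof.
move=> lm; apply/lfunP => y; rewrite (coord_vbasis (memvf y)) !linear_sum.
by apply: eq_bigr => i _; rewrite !linearZ; congr (_ *: _); apply: lm.
Qed.

Section Line.
Variables l m : dual h.
Definition line_fun (y : lie_of h) : {poly F} := (dual_app l y)%:P + dual_app m y *: 'X.
Fact line_linear : linear line_fun.
Proof.
move=> a u v; rewrite /line_fun /dual_app !linearP /= scalerDr addrACA.
by rewrite -mul_polyC -polyCM -polyCD !scalerA scalerDl.
Qed.
Fact line_lie u v : line_fun (lie u v) = line_fun u * line_fun v - line_fun v * line_fun u.
Proof.
by rewrite lie_of0 [X in _ - X]mulrC subrr /line_fun /dual_app !linear0 scale0r addr0.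
Qed.
Definition line_hom := LieHom line_linear line_lie.
Definition on_line (a : S) : {poly F} := ulift line_hom a.

Lemma on_lineE a c : (on_line a).[c] = character (l + c *: m) a.
Proof.
elim/uea_ind: a => [y|a|a b IHa IHb|a b IHa IHb].
- rewrite /on_line ulift_var character_var dual_appD dual_appZ /= /line_fun.
  by rewrite hornerD hornerC hornerZ hornerX mulrC.
- by rewrite /on_line ulift_scal character_scal hornerZ hornerC mulr1.
- by rewrite /on_line raddfD hornerD characterD -IHa -IHb.
- by rewrite /on_line rmorphM hornerM characterM -IHa -IHb.
Qed.

Lemma on_lineM a b : on_line (a * b) = on_line a * on_line b.
Proof. exact: rmorphM. Qed.

Lemma on_line_sum I (r : seq I) (a : I -> S) :
  on_line (\sum_(i <- r) a i) = \sum_(i <- r) on_line (a i).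
Proof. exact: raddf_sum. Qed.
End Line.

Lemma character_poly (l : dual h) (a : S) (q : {poly F}) :
  character l (horner_alg a q) = q.[character l a].
Proof.
elim/poly_ind: q => [|q c IH]; first by rewrite raddf0 character0 horner0.
rewrite rmorphD rmorphM /= horner_algX horner_algC characterD characterM IH.
by rewrite character_scal hornerMXaddC.
Qed.

Definition ideal_pred (I : S -> Prop) :=
  I 0 /\ forall a u v, I u -> I v -> I (a * u + v).

Lemma idealD I u v : ideal_pred I -> I u -> I v -> I (u + v).
Proof. by move=> [_ H] Iu Iv; rewrite -[u]mul1r; apply: H. Qed.
Lemma idealM I a u : ideal_pred I -> I u -> I (a * u).
Proof. by move=> [I0 H] Iu; rewrite -[_ * _]addr0; apply: H. Qed.
Lemma ideal_sum I J (r : seq J) (f : J -> S) : ideal_pred I ->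
  (forall j, I (f j)) -> I (\sum_(j <- r) f j).
Proof.
move=> iI If; elim/big_rec: _ => [|j u _ Iu]; first by case: iI.
exact: idealD.
Qed.

Lemma uh_filtration d (cs : seq F) (r : F -> S) : uniq cs ->
  (#|{: bmultinom n d}| < size cs)%N ->
  (forall c, c \in cs -> (msize (ulift (uh_poly h) (r c)) <= d)%N) ->
  exists al : F -> F, (exists2 c, c \in cs & al c != 0) /\ \sum_(c <- cs) al c *: r c = 0.
Proof.
move=> ucs big rd; pose k := size cs; pose D := #|{: bmultinom n d}|.
pose A : 'M[F]_(k, D) :=
  \matrix_(i, j) (ulift (uh_poly h) (r cs`_i))@_(bmnm (enum_val j)).
have : kermx A != 0.
  by rewrite kermx_eq0 -row_leq_rank -ltnNge (leq_ltn_trans (rank_leq_col A)).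
case/rowV0Pn => v; rewrite sub_kermx => /eqP vA v0.
have cov c : c \in cs -> (index c cs < k)%N by rewrite index_mem.
exists (fun c => if insub (index c cs) is Some i then v 0 i else 0); split.
  case/rV0Pn: v0 => i vi; exists cs`_i; first by apply: mem_nth.
  by rewrite index_uniq // valK.
rewrite (big_nth 0) big_mkord.
under eq_bigr => i _ do rewrite index_uniq // valK.
apply: (can_inj (@uh_polyK _ _ h)); rewrite raddf0 raddf_sum /=; apply/mpolyP => m.
rewrite mcoeff0 raddf_sum /=.
have Z i : ulift (uh_poly h) (v 0 i *: r cs`_i) = v 0 i *: ulift (uh_poly h) (r cs`_i).
  by rewrite -mulr_algl rmorphM /= ulift_scal mulr_algl.
have [md|md] := ltnP (mdeg m) d.
  have := congr1 (fun B : 'rV_D => B 0 (enum_rank (BMultinom md))) vA.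
  rewrite !mxE => E; rewrite -[RHS]E; apply: eq_bigr => i _.
  by rewrite Z mcoeffZ mxE enum_rankK.
apply: big1 => i _; rewrite Z mcoeffZ memN_msupp_eq0 ?mulr0 //.
by apply: msize_mdeg_ge; apply: leq_trans md; apply/rd/mem_nth.
Qed.

(* Countability of [dim S] forces a linear relation among the [r c], and clearing
   denominators in it gives [q]. *)
Lemma uncountable_divisors (I : S -> Prop) (a y : S) (C : set F) :
  ideal_pred I -> ~ countable C ->
  (forall c, C c -> exists r, I ((y - c%:A) * r - a)) ->
  exists2 q : {poly F}, q != 0 & I (horner_alg y q * a).
Proof.
move=> iI nC Cr.
have {}Cr c : exists r, C c -> I ((y - c%:A) * r - a).
  have [/Cr[r]|] := pselect (C c); first by exists r.
  by exists 0.
pose r c := sval (cid (Cr c)).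
have rP c : C c -> I ((y - c%:A) * r c - a) by rewrite /r; case: cid.
pose Cd d := [set c | C c /\ (msize (ulift (uh_poly h) (r c)) <= d)%N]%classic.
(* [C] is the countable union of the degree pieces [Cd d]; were all of them finite, it would be
   countable. *)
have [d dinf] : exists d, infinite_set (Cd d).
  apply: contrapT => /forallNP nd; apply: nC.
  have -> : C = (\bigcup_d Cd d)%classic.
    rewrite predeqE => c; split=> [Cc|[d _ []//]].
    by exists (msize (ulift (uh_poly h) (r c))).
  by apply: bigcup_countable => // d _; apply: finite_set_countable; apply: contrapT.
have [B BC Bcard] := infinite_set_fset #|{: bmultinom n d}|.+1 dinf.
pose cs : seq F := enum_fset B.
have ucs : uniq cs by apply: fset_uniq.
have csC c : c \in cs -> Cd d c by move=> cB; apply: BC.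
have [|c /csC[]//|al [[c0 c0s al0] als]] := @uh_filtration d cs r ucs.
  exact: Bcard.
pose q := \sum_(c <- cs) al c *: \prod_(c' <- cs | c' != c) ('X - c'%:P).
have hp c z : (\prod_(c' <- cs | c' != c) ('X - c'%:P)).[z] =
    \prod_(c' <- cs | c' != c) (z - c').
  rewrite -big_filter horner_prod big_filter.
  by apply: eq_bigr => c' _; rewrite hornerXsubC.
exists q.
  (* At [c0] every product except the one omitting [c0] vanishes. *)
  apply/eqP => /(congr1 (fun p => p.[c0])); rewrite horner0 /q horner_sum.
  rewrite (bigD1_seq c0) //= [X in _ + X]big1_seq ?addr0.
    rewrite hornerZ hp => /eqP; rewrite mulf_eq0 (negPf al0) /=.
    rewrite prodf_seq_eq0 => /hasP[c _ /andP[cc0]].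
    by rewrite subr_eq0 eq_sym (negPf cc0).
  move=> c /andP[cc0 _]; rewrite hornerZ hp (big_rem c0) //= eq_sym cc0.
  by rewrite subrr mul0r mulr0.
pose P c := \prod_(c' <- cs | c' != c) (y - c'%:A).
(* The product of all factors [y - c] times the relation [als] is zero and is subtracted; each
   remaining term is, up to sign, a multiple of an element of [I]. *)
have -> : horner_alg y q * a = \sum_(c <- cs) al c *: (P c * (a - (y - c%:A) * r c)).
  have -> : horner_alg y q = \sum_(c <- cs) al c *: P c.
    rewrite /q raddf_sum; apply: eq_bigr => c _ /=.
    rewrite -mul_polyC rmorphM /= horner_algC mulr_algl rmorph_prod; congr (_ *: _); apply: eq_bigr => c' _ /=.
    by rewrite rmorphB /= horner_algX horner_algC.
  have Z : (\prod_(c <- cs) (y - c%:A)) * (\sum_(c <- cs) al c *: r c) = 0.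
    by rewrite als mulr0.
  rewrite mulr_suml -[LHS]subr0 -[X in _ - X]Z mulr_sumr -sumrB big_seq [RHS]big_seq; apply: eq_bigr => c cs_c.
  rewrite -scalerAl -scalerAr -scalerBr; congr (_ *: _); rewrite mulrBr; congr (_ - _).
  by rewrite (bigD1_seq c) //= mulrA [P c * _]mulrC.
rewrite big_seq; elim/big_rec: _ => [|c u cs_c Iu]; first by case: iI.
apply: idealD => //; rewrite -[_ *: (_ * _)]mulr_algl -[a - _]opprB !mulrN -mulNr mulrA.
by apply: idealM => //; apply: rP; case: (csC _ cs_c).
Qed.

End Points.

(** * The Nullstellensatz over an uncountable algebraically closed field *)

Section Nullstellensatz.
Variables (F : closedFieldType) (g : finLieAlgType F) (h : cartan g).
Hypothesis uncountableF : ~ countable [set: F]%classic.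
Local Notation S := (uh h).
Local Notation n := (\dim {: lie_of h}).
Local Notation vb := (vbasis {: lie_of h}).
Local Notation x := (@uh_var F g h).

(** Otherwise every [y - c] is invertible modulo [I]. By [uncountable_divisors] some nonzero
    polynomial in [y] lies in [I]; it splits into linear factors, all invertible modulo [I], so 1 is
    in [I]. *)
Lemma proper_add (I : S -> Prop) (y : S) : ideal_pred I -> ~ I 1 ->
  exists c, ~ exists p s, I p /\ 1 = p + s * (y - c%:A).
Proof.
move=> iI I1; apply: contrapT => /forallNP H; apply: I1.
have inv c : exists s, I ((y - c%:A) * s - 1).
  have /contrapT[p [s [Ip ps]]] := H c; exists s.
  suff -> : (y - c%:A) * s - 1 = -1 * p by apply: idealM.
  have -> : p = 1 - s * (y - c%:A) by rewrite {1}ps addrK.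
  by rewrite mulN1r opprB mulrC.
have [q q0 Iq] := @uncountable_divisors _ _ _ I 1 y _ iI uncountableF (fun c _ => inv c).
have [r qE] := closed_field_poly_normal q.
have [s Is] : exists s, I (\prod_(z <- r) (y - z%:A) * s - 1).
  elim: (r) => [|z r' [s Is]].
    by exists 1; rewrite big_nil mulr1 subrr; case: iI.
  have [s' Is'] := inv z; exists (s * s'); rewrite big_cons.
  have -> : (y - z%:A) * \prod_(j <- r') (y - j%:A) * (s * s') - 1 =
    ((y - z%:A) * s') * (\prod_(j <- r') (y - j%:A) * s - 1) + ((y - z%:A) * s' - 1).
    move: (y - z%:A) (\prod_(j <- r') _) => A B; ring.
  by apply: idealD => //; apply: idealM.
set P := \prod_(z <- r) _ in Is.
have IP : I P.
  have : I (horner_alg y q * 1) := Iq.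
  rewrite mulr1 qE -mul_polyC rmorphM /= horner_algC rmorph_prod.
  rewrite (eq_bigr (fun z => y - z%:A)) => [|z _]; last first.
    by rewrite rmorphB /= horner_algX horner_algC.
  rewrite -/P => /(idealM (lead_coef q)^-1%:A iI).
  by rewrite !mulr_algl scalerA mulVf ?scale1r ?lead_coef_eq0.
suff -> : 1 = s * P + -1 * (P * s - 1).
  by apply: idealD => //; apply: idealM.
by rewrite mulN1r opprB addrCA mulrC subrr addr0.
Qed.

(** Adjoin elements [x i - c i] one variable at a time, keeping the ideal proper. Modulo the
    resulting [J], each element equals its value at the point [c], so a nonzero value on [I] would
    put a nonzero constant in [J]. *)
Lemma nullstellensatz (I : S -> Prop) : ideal_pred I -> ~ I 1 ->
  exists l : dual h, forall a, I a -> character l a = 0.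
Proof.
move=> iI I1.
have [J [iJ J1 IJ Jx]] : exists J : S -> Prop, [/\ ideal_pred J, ~ J 1,
    forall a, I a -> J a & forall i, i \in enum 'I_n -> exists c : F, J (x i - c%:A)].
  elim: (enum _) => [|i s [J [iJ J1 IJ Jx]]]; first by exists I; split.
  have [c Hc] := proper_add (x i) iJ J1.
  exists (fun a => exists p s, J p /\ a = p + s * (x i - c%:A)); split.
  - split=> [|a u v [p [r [Jp ->]]] [p' [r' [Jp' ->]]]].
      by exists 0, 0; split; [case: iJ|rewrite mul0r addr0].
    exists (a * p + p'), (a * r + r'); split; first by case: iJ => _; apply.
    by rewrite mulrDr mulrDl addrACA mulrA.
  - exact: Hc.
  - by move=> a /IJ Ja; exists a, 0; rewrite mul0r addr0.
  - move=> j; rewrite inE => /orP[/eqP ->|/Jx [c' Jc']].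
      by exists c, 0, 1; split; [case: iJ|rewrite mul1r add0r].
    by exists c', (x j - c'%:A), 0; rewrite mul0r addr0.
have {}Jx i : exists c : F, J (x i - c%:A) by apply: Jx; rewrite mem_enum.
pose c i := sval (cid (Jx i)).
have Jc i : J (x i - (c i)%:A) by rewrite /c; case: cid.
have Jl a : J (a - (character (coord_point c) a)%:A).
  elim/uh_var_ind: a => [a|i|a b IHa IHb|a b IHa IHb].
  - by rewrite character_scal subrr; case: iJ.
  - by rewrite character_var coord_pointE.
  - by rewrite characterD scalerDl opprD addrACA; apply: idealD.
  - rewrite characterM -scalerA -[_ *: (_ *: _)]mulr_algl.
    have -> : a * b - (character (coord_point c) a)%:A * (character (coord_point c) b)%:A =
      b * (a - (character (coord_point c) a)%:A) + (character (coord_point c) a)%:A * (b - (character (coord_point c) b)%:A).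
      by rewrite !mulrBr addrA [b * a]mulrC [b * _]mulrC subrK.
    by apply: idealD => //; apply: idealM.
exists (coord_point c) => a /IJ Ja; apply: contrapT => /eqP la; apply: J1.
have Jla : J (character (coord_point c) a)%:A.
  suff -> : (character (coord_point c) a)%:A = a + -1 * (a - (character (coord_point c) a)%:A).
    by apply: idealD => //; apply: idealM.
  by rewrite mulN1r opprB addrC subrK.
have := idealM (character (coord_point c) a)^-1%:A iJ Jla.
by rewrite mulr_algl scalerA mulVf // scale1r.
Qed.

Lemma infiniteF k : exists s : seq F, uniq s /\ (k <= size s)%N.
Proof.
have inf : infinite_set [set: F]%classic.
  by move=> /finite_set_countable.
have [B _ Bk] := infinite_set_fset k inf.
by exists (enum_fset B); split=> //; apply: fset_uniq.
Qed.

Lemma poly_nonroot (q : {poly F}) : q != 0 -> exists c, q.[c] != 0.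
Proof.
move=> q0; apply: contrapT => /forallNP H.
have [s [us sk]] := infiniteF (size q).
have := max_poly_roots q0 _ us; rewrite ltnNge sk => /(_ _)/negP; case=> //; apply/allP => c _.
by rewrite /root; apply/negPn/negP/H.
Qed.

Lemma uh_var_transcendental i (q : {poly F}) : horner_alg (x i) q = 0 -> q = 0.
Proof.
move=> qx; apply/eqP; apply: contrapT => /negP/poly_nonroot[c qc].
case/negP: qc; have := character_poly (coord_point (fun=> c)) (x i) q.
by rewrite qx character0 character_var coord_pointE => <-.
Qed.

Section Substitution.
Variables (i : 'I_n) (c : F).
Definition subst_fun (y : lie_of h) : S := uvar y + coord vb i y *: (c%:A - x i).
Fact subst_linear : linear subst_fun.
Proof.
move=> a u v; rewrite /subst_fun.
have -> : uvar (a *: u + v) = a *: (uvar u : S) + uvar v :> S by exact: linearP.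
have -> : coord vb i (a *: u + v) = a * coord vb i u + coord vb i v by rewrite linearP.
by rewrite scalerDl -[in LHS]scalerA addrACA -scalerDr.
Qed.
Fact subst_lie u v : subst_fun (lie u v) = subst_fun u * subst_fun v - subst_fun v * subst_fun u.
Proof.
by rewrite lie_of0 [X in _ - X]mulrC subrr /subst_fun !linear0 scale0r addr0.
Qed.
Definition subst_var (a : S) : S := ulift (LieHom subst_linear subst_lie) a.

Lemma subst_varX j : subst_var (x j) = if j == i then c%:A else x j.
Proof.
rewrite /subst_var ulift_var /= /subst_fun coord_free ?(basis_free (vbasisP _)) //.
rewrite eq_sym; case: eqP => [->|_]; first by rewrite scale1r addrC subrK.
by rewrite scale0r addr0.
Qed.

Lemma subst_var_scal (a : F) : subst_var a%:A = a%:A.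
Proof. exact: ulift_scal. Qed.

Lemma subst_varD a b : subst_var (a + b) = subst_var a + subst_var b.
Proof. exact: raddfD. Qed.
Lemma subst_varM a b : subst_var (a * b) = subst_var a * subst_var b.
Proof. exact: rmorphM. Qed.

Lemma subst_varP a : exists r, a - subst_var a = (x i - c%:A) * r.
Proof.
elim/uh_var_ind: a => [a|j|a b [r Er] [s Es]|a b [r Er] [s Es]].
- by exists 0; rewrite subst_var_scal subrr mulr0.
- rewrite subst_varX; case: eqP => [->|_]; first by exists 1; rewrite mulr1.
  by exists 0; rewrite subrr mulr0.
- by exists (r + s); rewrite mulrDr -Er -Es subst_varD opprD addrACA.
- exists (r * b + subst_var a * s).
  rewrite mulrDr mulrA -Er mulrCA -Es mulrBl mulrBr addrA subrK.
  by rewrite subst_varM.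
Qed.
End Substitution.

(** Substitute constants for the variables one by one without reaching zero. If all constants failed
    at some stage, the current element would be divisible by every [x i - c]; then
    [uncountable_divisors] for the zero ideal would make [x i] algebraic. *)
Lemma character_nonzero (a : S) : a != 0 -> exists l : dual h, character l a != 0.
Proof.
move=> a0.
have [phi [[phiD phiM] phiC phia phix]] : exists phi : S -> S,
    [/\ (forall u v, phi (u + v) = phi u + phi v) /\ (forall u v, phi (u * v) = phi u * phi v),
     forall c : F, phi c%:A = c%:A, phi a != 0 &
     forall i, (exists c : F, phi (x i) = c%:A) \/ i \notin enum 'I_n /\ phi (x i) = x i].
  elim: (enum _) => [|i s [phi [[phiD phiM] phiC phia phix]]]; first by exists id; split=> // i; right.
  have [c ca] : exists c, subst_var i c (phi a) != 0.
    apply: contrapT => /forallNP H.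
    have D c : setT c -> exists r, (x i - c%:A) * r - phi a = 0.
      move=> _; have [r Er] := subst_varP i c (phi a); exists r.
      by have /negP := H c; rewrite -Er negbK => /eqP ->; rewrite subr0 subrr.
    have I0 : ideal_pred (fun u : S => u = 0).
      by split=> // u v w -> ->; rewrite mulr0 addr0.
    have [q q0 /eqP] := uncountable_divisors I0 uncountableF D.
    rewrite mulf_eq0 (negPf phia) orbF => /eqP/uh_var_transcendental/eqP.
    by rewrite (negPf q0).
  exists (fun u => subst_var i c (phi u)); split=> //.
  - split=> u v; first by rewrite phiD subst_varD.
    by rewrite phiM subst_varM.
  - by move=> c'; rewrite phiC subst_var_scal.
  - move=> j; have [[c' ->]|[js ->]] := phix j.
      by left; exists c'; rewrite subst_var_scal.
    rewrite subst_varX inE negb_or; case: eqP => [_|_]; first by left; exists c.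
    by right.
have {}phix i : exists c : F, phi (x i) = c%:A by have [|[]] := phix i; rewrite // mem_enum.
pose c i := sval (cid (phix i)).
have phiE u : phi u = (character (coord_point c) u)%:A.
  elim/uh_var_ind: u => [u|i|u v IHu IHv|u v IHu IHv].
  - by rewrite character_scal phiC.
  - by rewrite character_var coord_pointE /c; case: cid.
  - by rewrite characterD scalerDl phiD IHu IHv.
  - by rewrite characterM phiM IHu IHv mulr_algl scalerA.
exists (coord_point c); apply: contra_neq phia => la.
by rewrite phiE la scale0r.
Qed.

End Nullstellensatz.

(** * Ideals with countably many zeros *)

Section CountableZeros.
Variables (F : closedFieldType) (g : finLieAlgType F) (h : cartan g).
Hypothesis uncountableF : ~ countable [set: F]%classic.
Local Notation S := (uh h).
Local Notation n := (\dim {: lie_of h}).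
Local Notation vb := (vbasis {: lie_of h}).
Local Notation x := (@uh_var F g h).
Local Open Scope classical_set_scope.

Definition zeros (I : S -> Prop) : set (dual h) :=
  [set l | forall a, I a -> character l a = 0].

(** If [x i - c] is not invertible modulo [I], the Nullstellensatz gives a zero of [I] with [i]-th
    coordinate [c]. So only countably many [c] are excluded, and [uncountable_divisors] applies with
    [a = 1]. *)
Lemma countable_zeros_univariate (I : S -> Prop) : ideal_pred I -> countable (zeros I) ->
  forall i, exists2 q : {poly F}, q != 0 & I (horner_alg (x i) q).
Proof.
move=> iI cZ i; pose C := [set c | exists r, I ((x i - c%:A) * r - 1)].
have nC : ~ countable C.
  move=> cC; apply: uncountableF.
  suff -> : [set: F] = C `|` (fun l : dual h => dual_app l (vb`_i : lie_of h)) @` zeros I.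
    by rewrite -bigcup2E; apply: bigcup_countable => // [[|[|k]]] _ //=; do ?[by apply: sub_countable (card_image_le _ _) _].
  rewrite predeqE => c; split=> // _; have [Cc|nCc] := pselect (C c); [by left|right].
  pose J a := exists p s, I p /\ a = p + s * (x i - c%:A).
  have iJ : ideal_pred J.
    split=> [|a u v [p [r [Jp ->]]] [p' [r' [Jp' ->]]]].
      by exists 0, 0; split; [case: iI|rewrite mul0r addr0].
    exists (a * p + p'), (a * r + r'); split; first by case: iI => _; apply.
    by rewrite mulrDr mulrDl addrACA mulrA.
  have [|l lJ] := nullstellensatz uncountableF iJ.
    move=> [p [s [Ip ps]]]; apply: nCc; exists s.
    suff -> : (x i - c%:A) * s - 1 = -1 * p by apply: idealM.
    have -> : p = 1 - s * (x i - c%:A) by rewrite {1}ps addrK.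
    by rewrite mulN1r opprB mulrC.
  exists l.
    by move=> a Ia; apply: lJ; exists a, 0; rewrite mul0r addr0.
  have : J (x i - c%:A).
    by exists 0, 1; split; [case: iI|rewrite mul1r add0r].
  move=> /lJ; rewrite characterB character_var character_scal => /eqP.
  by rewrite subr_eq0 => /eqP.
have [q q0] := uncountable_divisors iI nC (fun c Cc => Cc).
by rewrite mulr1 => Iq; exists q.
Qed.

(** Each coordinate of a zero is a root of a fixed polynomial in one variable, so the zeros lie in a
    finite grid. *)
Lemma countable_zeros_finite (I : S -> Prop) : ideal_pred I -> countable (zeros I) ->
  finite_set (zeros I).
Proof.
move=> iI cZ; have Q := countable_zeros_univariate iI cZ.
have {}Q (i : 'I_n) : exists r : seq F, forall l, zeros I l -> dual_app l (vb`_i : lie_of h) \in r.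
  have [q q0 Iq] := Q i; have [r qE] := closed_field_poly_normal q.
  exists r => l /(_ _ Iq); rewrite character_poly character_var qE hornerZ => /eqP.
  by rewrite mulf_eq0 lead_coef_eq0 (negPf q0) /= -[_ == 0]/(root _ _) root_prod_XsubC.
pose r i := sval (cid (Q i)).
have rP (i : 'I_n) l : zeros I l -> dual_app l (vb`_i : lie_of h) \in r i.
  by rewrite /r; case: cid => s /= H; apply: H.
pose m := (\max_i size (r i))%N.
pose pt (f : {ffun 'I_n -> 'I_m.+1}) := coord_point (h := h) (fun i : 'I_n => (r i)`_(f i)).
apply: (@sub_finite_set _ _ (range pt)); last first.
  by apply: finite_image; apply: finite_finset.
move=> l Zl; exists [ffun i : 'I_n => inord (index (dual_app l (vb`_i : lie_of h)) (r i))] => //.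
apply: dual_ext => i; rewrite /pt coord_pointE ffunE inordK.
  by rewrite nth_index // rP.
rewrite ltnS; apply: (leq_trans (index_size _ _)).
exact: (@leq_bigmax _ (fun i => size (r i))).
Qed.

(** Setting [x i = z] leaves [u] unchanged and kills the left side, so [p] vanishes there and is
    divisible by [x i - z]; the factors are removed one at a time. *)
Lemma linear_factors_dvd i (u : S) (r : seq F) (w p : S) : u != 0 ->
  (forall z, subst_var i z u = u) ->
  (\prod_(z <- r) (x i - z%:A)) * w = u * p ->
  exists p', p = (\prod_(z <- r) (x i - z%:A)) * p'.
Proof.
move=> u0 us; elim: r w p => [|z r IH] w p; first by exists p; rewrite big_nil mul1r.
rewrite big_cons -mulrA => E.
have xz0 : x i - z%:A != 0.
  (* At the point with all coordinates [z + 1] the factor takes the value 1. *)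
  apply/eqP => /(congr1 (character (coord_point (fun=> z + 1)))).
  rewrite characterB character_var coord_pointE character_scal character0.
  by rewrite addrC addKr => /eqP; rewrite oner_eq0.
have sp0 : subst_var i z p = 0.
  have := congr1 (subst_var i z) E; rewrite !subst_varM us.
  have -> : subst_var i z (x i - z%:A) = 0.
    by rewrite /subst_var raddfB /= -!/(subst_var _ _ _) subst_varX eqxx subst_var_scal subrr.
  rewrite mul0r => /eqP; rewrite eq_sym mulf_eq0 (negPf u0).
  by move=> /eqP.
have [p1] := subst_varP i z p; rewrite sp0 subr0 => Ep.
have [|p' Ep'] := IH w p1; last by exists p'; rewrite Ep Ep' mulrA.
by apply: (mulfI xz0); rewrite E Ep mulrCA.
Qed.

Lemma subst_var_horner (i j : 'I_n) z (q : {poly F}) : i != j ->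
  subst_var i z (horner_alg (x j) q) = horner_alg (x j) q.
Proof.
move=> ij; elim/poly_ind: q => [|q c IH]; first by rewrite rmorph0 /subst_var raddf0.
rewrite rmorphD rmorphM /= horner_algX horner_algC subst_varD subst_varM.
rewrite IH subst_varX subst_var_scal.
by rewrite eq_sym (negPf ij).
Qed.

(* Denominators in two different variables are coprime. *)
Lemma hartogs (i j : 'I_n) (q q' : {poly F}) (f t p p' : S) : i != j ->
  q != 0 -> q' != 0 -> f != 0 ->
  horner_alg (x i) q * t = f * p -> horner_alg (x j) q' * t = f * p' ->
  exists t', t = f * t'.
Proof.
move=> ij q0 q'0 f0 E E'.
have nz k (r : {poly F}) : r != 0 -> horner_alg (x k) r != 0.
  by apply: contra_neq => /(uh_var_transcendental uncountableF).
have [r qE] := closed_field_poly_normal q.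
pose c := (lead_coef q)%:A : S.
have hq : horner_alg (x i) q = (\prod_(z <- r) (x i - z%:A)) * c.
  rewrite qE -mul_polyC rmorphM /= horner_algC rmorph_prod mulrC; congr (_ * _).
  by apply: eq_bigr => z _; rewrite rmorphB /= horner_algX horner_algC.
have H : (\prod_(z <- r) (x i - z%:A)) * (c * p') = horner_alg (x j) q' * p.
  rewrite mulrA -hq; apply: (mulfI f0).
  by rewrite mulrCA -E' mulrCA E mulrCA.
have [w Ew] := linear_factors_dvd (nz j _ q'0) (fun z => subst_var_horner z q' ij) H.
exists ((lead_coef q)^-1%:A * w); apply: (mulfI (nz i _ q0)).
rewrite E Ew hq [in RHS]mulrCA; congr (_ * _); rewrite -mulrA; congr (_ * _).
by rewrite /c !mulr_algl scalerA mulfV ?scale1r ?lead_coef_eq0.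
Qed.

End CountableZeros.

(** * Frames and rank *)

Section Bases.
Variables (F : fieldType) (V : lmodType F).

(** Writing each basis in the other gives matrices with [A *m B = 1], which bounds one size by the
    other. *)
Lemma has_dim_unique (T : set V) d d' : has_dim T d -> has_dim T d' -> d = d'.
Proof.
suff le d1 d2 : has_dim T d1 -> has_dim T d2 -> (d1 <= d2)%N.
  by move=> H H'; apply/eqP; rewrite eqn_leq !le.
move=> [e [eT eB]] [e' [e'T e'B]].
pose A : 'M[F]_(d1, d2) := \matrix_(i, j) (sval (cid (e'B _ (eT i)))) 0 j.
pose B : 'M[F]_(d2, d1) := \matrix_(j, k) (sval (cid (eB _ (e'T j)))) 0 k.
have AE i : e i = \sum_j A i j *: e' j.
  by under eq_bigr do rewrite mxE; case: cid => c [].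
have BE j : e' j = \sum_k B j k *: e k.
  by under eq_bigr do rewrite mxE; case: cid => c [].
apply: (@mulmx1_min _ _ _ A B); apply/row_matrixP => i.
have [c [_ c_uniq]] := eB _ (eT i).
transitivity c; [apply/esym|]; apply: c_uniq.
  rewrite {1}AE.
  under eq_bigr => j _ do rewrite BE scaler_sumr.
  rewrite exchange_big; apply: eq_bigr => k _; rewrite !mxE scaler_suml.
  by apply: eq_bigr => j _; rewrite scalerA.
rewrite (bigD1 i) //= !mxE eqxx scale1r big1 ?addr0 // => k ki.
by rewrite !mxE eq_sym (negPf ki) scale0r.
Qed.
End Bases.

Section Frames.
Variables (S : idomainType) (M : lmodType S).

Definition independent k (e : 'I_k -> M) :=
  forall c : 'I_k -> S, \sum_i c i *: e i = 0 -> forall i, c i = 0.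

Definition frame k (e : 'I_k -> M) (f : S) :=
  forall m, exists c : 'I_k -> S, f *: m = \sum_i c i *: e i.

Lemma independent_inj k (e : 'I_k -> M) c c' : independent e ->
  \sum_i c i *: e i = \sum_i c' i *: e i -> c =1 c'.
Proof.
move=> ie E i; apply/eqP; rewrite -subr_eq0; apply/eqP.
apply: (ie (fun i => c i - c' i)).
by under eq_bigr do rewrite scalerBl; rewrite sumrB E subrr.
Qed.

Lemma frame_of_generators n (x : 'I_n -> M) k (e : 'I_k -> M) f :
  (forall m, exists a : 'I_n -> S, m = \sum_i a i *: x i) ->
  (forall j, exists c : 'I_k -> S, f *: x j = \sum_i c i *: e i) -> frame e f.
Proof.
move=> xM fx m; have [a ->] := xM m.
pose c j := sval (cid (fx j)).
have cE j : f *: x j = \sum_i c j i *: e i by rewrite /c; case: cid.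
exists (fun i => \sum_j a j * c j i); rewrite scaler_sumr.
under eq_bigr => j _ do rewrite scalerA mulrC -scalerA cE scaler_sumr.
rewrite exchange_big; apply: eq_bigr => i _; rewrite scaler_suml.
by apply: eq_bigr => j _; rewrite scalerA.
Qed.

(** Induction on the number of generators: a new one either has a nonzero multiple in the span of
    [e], and the multiplier is absorbed in [f], or it joins the family. The claim is stated for
    arbitrary finite families because a subfamily need not generate [M]. *)
Lemma frame_exists : fin_generated M ->
  exists k (e : 'I_k -> M) f, [/\ independent e, f != 0 & frame e f].
Proof.
move=> [n [x xM]].
suff [k [e [f [ie f0 fx]]]] : exists k (e : 'I_k -> M) f, [/\ independent e, f != 0 &
    forall j, exists c : 'I_k -> S, f *: x j = \sum_i c i *: e i].
  by exists k, e, f; split=> //; apply: frame_of_generators xM fx.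
elim: n x {xM} => [|n IH] x.
  exists 0%N, (fun=> 0), 1; split; [by move=> c _ [] |exact: oner_neq0|by case].
have [k [e [f [ie f0 fx]]]] := IH (fun j => x (lift ord0 j)).
have [[a a0 [c cE]]|nc] := pselect (exists2 a, a != 0 &
    exists c : 'I_k -> S, a *: x ord0 = \sum_i c i *: e i).
  exists k, e, (a * f); split=> //; first by rewrite mulf_neq0.
  move=> j; case: (unliftP ord0 j) => [i ->|->].
    have [b bE] := fx i; exists (fun l => a * b l); rewrite -scalerA bE scaler_sumr.
    by apply: eq_bigr => l _; rewrite scalerA.
  exists (fun l => f * c l); rewrite mulrC -scalerA cE scaler_sumr.
  by apply: eq_bigr => l _; rewrite scalerA.
pose e' (i : 'I_(k + 1)) := match split i with inl i => e i | inr _ => x ord0 end.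
have e'E (c : 'I_(k + 1) -> S) :
    \sum_i c i *: e' i = \sum_i c (lshift 1 i) *: e i + c (rshift k ord0) *: x ord0.
  rewrite big_split_ord big_ord1 /=; congr (_ + c _ *: _).
    by apply: eq_bigr => i _; rewrite /e' (unsplitK (inl i)).
  by rewrite /e' (unsplitK (inr ord0)).
exists (k + 1)%N, e', f; split=> //.
  move=> c; rewrite e'E => E.
  have c0 : c (rshift k ord0) = 0.
    apply/eqP; apply: contrapT => /negP cn0; apply: nc; exists (c (rshift k ord0)) => //.
    exists (fun i => - c (lshift 1 i)); apply/eqP.
    by under eq_bigr do rewrite scaleNr; rewrite sumrN -addr_eq0 addrC E.
  move: E; rewrite c0 scale0r addr0 => /ie H i.
  by rewrite -(splitK i); case: (split i) => j //=; rewrite (ord1 j).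
move=> j; case: (unliftP ord0 j) => [i ->|->].
  have [b bE] := fx i; exists (fun l => match split l with inl i => b i | inr _ => 0 end).
  rewrite e'E bE (unsplitK (inr ord0)) scale0r addr0; apply: eq_bigr => l _.
  by rewrite (unsplitK (inl l)).
exists (fun l => match split l with inl i => 0 | inr _ => f end).
rewrite e'E (unsplitK (inr ord0)) big1 ?add0r // => l _.
by rewrite (unsplitK (inl l)) scale0r.
Qed.

Lemma frame_mx k (e : 'I_k -> M) f l (x : 'I_l -> M) : frame e f ->
  exists A : 'M[S]_(k, l), forall j, f *: x j = \sum_i A i j *: e i.
Proof.
move=> fe; pose c j := sval (cid (fe (x j))).
exists (\matrix_(i, j) c j i) => j; under eq_bigr do rewrite mxE.
by rewrite /c; case: cid.
Qed.

(* In the two frames the matrix of [u] is [A / f], resp. [A' / f'], and these are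
   conjugate over the fraction field. *)
Lemma frame_trace k (e e' : 'I_k -> M) f f' (u : M -> M) (A A' : 'M[S]_k) :
  linear u -> independent e -> independent e' -> f != 0 -> f' != 0 ->
  frame e f -> frame e' f' ->
  (forall j, f *: u (e j) = \sum_i A i j *: e i) ->
  (forall j, f' *: u (e' j) = \sum_i A' i j *: e' i) ->
  f * \tr A' = f' * \tr A.
Proof.
move=> ul ie ie' f0 f'0 fe fe' AE A'E.
have u0 : u 0 = 0 by have /eqP := ul 1 0 0; rewrite !scale1r addr0 -subr_eq0 opprD addNKr oppr_eq0 => /eqP.
have uS I (r : seq I) (c : I -> S) (y : I -> M) :
    u (\sum_(i <- r) c i *: y i) = \sum_(i <- r) c i *: u (y i).
  by elim/big_rec2: _ => [//|i v w _ <-]; rewrite ul.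
have uZ a y : u (a *: y) = a *: u y by rewrite -[a *: y]addr0 ul u0 addr0.
have [B BE] := frame_mx e' fe; have [C CE] := frame_mx e fe'.
have mxS (y : 'I_k -> M) (P Q : 'M[S]_k) j :
    \sum_i P i j *: (\sum_l Q l i *: y l) = \sum_l (Q *m P) l j *: y l.
  under eq_bigr do rewrite scaler_sumr.
  rewrite exchange_big; apply: eq_bigr => l _ /=; rewrite mxE scaler_suml.
  by apply: eq_bigr => i _; rewrite scalerA mulrC.
have scS (y : 'I_k -> M) a (P : 'M[S]_k) j :
    a *: (\sum_i P i j *: y i) = \sum_i (a *: P) i j *: y i.
  by rewrite scaler_sumr; apply: eq_bigr => i _; rewrite mxE scalerA.
have BC : B *m C = (f * f')%:M.
  apply/matrixP => i j; apply: (independent_inj ie (c := fun i => (B *m C) i j)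
    (c' := fun i => ((f * f')%:M : 'M_k) i j)).
  rewrite -mxS; under eq_bigr do rewrite -BE scalerA mulrC -scalerA.
  rewrite -scaler_sumr -CE scalerA (bigD1 j) //= mxE eqxx mulr1n big1 ?addr0 // => l lj.
  by rewrite mxE (negPf lj) scale0r.
have B0 : \det B != 0.
  apply: contraTneq (mulf_neq0 f0 f'0) => B0; rewrite negbK.
  have := congr1 (determinant) BC; rewrite det_mulmx B0 mul0r det_scalar => /esym/eqP.
  by rewrite expf_eq0 => /andP[].
have H : f *: (B *m A') = f' *: (A *m B).
  apply/matrixP => i j; apply: (independent_inj ie (c := fun i => (f *: (B *m A')) i j)
    (c' := fun i => (f' *: (A *m B)) i j)).
  rewrite -!scS -!mxS.
  under eq_bigr do rewrite -BE scalerA mulrC -scalerA.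
  rewrite -scaler_sumr -A'E.
  under [in RHS]eq_bigr do rewrite -AE scalerA mulrC -scalerA.
  rewrite -scaler_sumr -uS.
  rewrite -BE.
  by rewrite uZ !scalerA; congr (_ *: _); rewrite mulrC mulrA.
(* Multiplying by the adjugate instead of inverting [B] keeps the computation in [S]; the factor
   [\det B] cancels at the end. *)
have := congr1 (fun X => \tr (\adj B *m X)) H.
rewrite -!scalemxAr !mxtraceZ mulmxA mul_adj_mx mul_scalar_mx mxtraceZ.
rewrite mulmxA mxtrace_mulC mulmxA mul_mx_adj mul_scalar_mx mxtraceZ.
by rewrite mulrCA [RHS]mulrCA => /(mulfI B0).
Qed.

End Frames.

(** * The rank computed by a frame *)

Section BaseChangeRank.
Variables (S : idomainType) (M : lmodType S).
Local Notation K := {fraction S}.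
Local Notation BC := (base_change (@tofrac S) M).

Lemma fextU (A : nzRingType) (X : choiceType) (N : lmodType A) (f : X -> N) x :
  fext f << x >> = f x.
Proof.
rewrite (@fextE _ _ _ f [:: x]) // ?big_seq1 ?mcoeffU ?eqxx ?scale1r // => y.
by rewrite msuppU oner_eq0 !inE.
Qed.

(** The coordinates [c m / f] respect the tensor relations, so they descend to the base change and
    show that the classes of the [e i] are independent. These classes generate because [f] is
    invertible in [K]. *)
Lemma frame_has_dim k (e : 'I_k -> M) f : independent e -> f != 0 -> frame e f ->
  has_dim [set: BC] k.
Proof.
move=> ie f0 fe; pose c m := sval (cid (fe m)).
have cE m : f *: m = \sum_i c m i *: e i by rewrite /c; case: cid.
have tf0 : tofrac f != 0 by rewrite tofrac_eq0.
pose co (m : M) : 'rV[K]_k := \row_i (tofrac (c m i) / tofrac f).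
have cD m m' i : c (m + m') i = c m i + c m' i.
  apply: (independent_inj ie (c := c (m + m')) (c' := fun i => c m i + c m' i)).
  rewrite -cE scalerDr !cE -big_split; by apply: eq_bigr => j _ /=; rewrite scalerDl.
have cZ a m i : c (a *: m) i = a * c m i.
  apply: (independent_inj ie (c := c (a *: m)) (c' := fun i => a * c m i)).
  rewrite -cE scalerA mulrC -scalerA cE scaler_sumr.
  by apply: eq_bigr => j _; rewrite scalerA.
have ce j i : c (e j) i = (i == j)%:R * f.
  apply: (independent_inj ie (c := c (e j)) (c' := fun i => (i == j)%:R * f)).
  rewrite -cE (bigD1 j) //= eqxx mul1r big1 ?addr0 // => l lj.
  by rewrite (negPf lj) mul0r scale0r.
have coe j : co (e j) = delta_mx 0 j.
  apply/rowP => i; rewrite !mxE ce rmorphM rmorph_nat eqxx /=.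
  by rewrite mulfK.
have kill x y : mqpi (span_sub (tensor_rel (@tofrac S) (M := M))) x = mqpi _ y ->
    fext co x = fext co y.
  move=> /mqpiP [n [a [t [tR xy]]]]; apply/eqP; rewrite -subr_eq0 -linearB /= xy.
  rewrite linear_sum big1 // => i _; rewrite linearZ /=.
  suff -> : fext co (t i) = 0 by rewrite scaler0.
  case: (tR i) => [m m'|b m].
    rewrite !linearB /= !fextU -addrA -opprD.
    apply/eqP; rewrite subr_eq0; apply/eqP/rowP => j.
    by rewrite !mxE cD rmorphD mulrDl.
  rewrite linearB linearZ /= !fextU; apply/eqP; rewrite subr_eq0; apply/eqP/rowP => j.
  by rewrite !mxE cZ rmorphM mulrA.
pose E i : BC := mqpi _ << e i >>.
have tD m m' : mqpi _ << m + m' >> = mqpi _ << m >> + mqpi _ << m' >> :> BC.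
  rewrite -[RHS]raddfD; apply/mqpiP; exists 1%N, (fun=> 1), (fun=> << m + m' >> - << m >> - << m' >>).
  by split=> [_|]; [exact: TensorD|rewrite big_ord1 scale1r opprD addrA].
have tZ a m : mqpi _ << a *: m >> = tofrac a *: mqpi _ << m >> :> BC.
  rewrite -[RHS]linearZ; apply/mqpiP.
  exists 1%N, (fun=> 1), (fun=> << a *: m >> - tofrac a *: << m >>).
  by split=> [_|]; [exact: TensorZ|rewrite big_ord1 scale1r].
have t0 : mqpi _ << 0 >> = 0 :> BC.
  by rewrite -[X in << X >>](scale0r 0) tZ rmorph0 scale0r.
have tS I (r : seq I) (d : I -> S) (y : I -> M) :
    mqpi _ << \sum_(i <- r) d i *: y i >> = \sum_(i <- r) tofrac (d i) *: mqpi _ << y i >> :> BC.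
  by elim/big_rec2: _ => [//|i v w _ <-]; rewrite tD tZ.
have gen m : mqpi _ << m >> = \sum_i co m 0 i *: E i :> BC.
  apply: (scalerI tf0); rewrite -tZ cE tS scaler_sumr.
  by apply: eq_bigr => i _; rewrite mxE scalerA mulrC mulfVK.
have genp p : mqpi _ p = \sum_i (fext co p) 0 i *: E i :> BC.
  have mE m : << p@_m *g m >> = p@_m *: << m >> :> {malg K[M]}.
    by apply/malgP => m'; rewrite mcoeffZ !mcoeffU mulr_natr.
  rewrite {1}[p]monalgE raddf_sum /fext /=.
  under [RHS]eq_bigr => i _ do rewrite summxE scaler_suml.
  rewrite exchange_big; apply: eq_bigr => m _ /=; rewrite mE linearZ /= gen scaler_sumr.
  have coZ (a : K) i : (a *: co m) 0 i = a * co m 0 i by rewrite [LHS]mxE.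
  by apply: eq_bigr => i _; rewrite coZ -scalerA.
exists E; split=> // v _; rewrite -(mqreprK v); exists (fext co (mqrepr v)).
split=> [|d Ed]; first exact: genp.
transitivity (fext co (\sum_i d 0 i *: << e i >>)).
  by apply: kill; rewrite Ed raddf_sum /=; apply: eq_bigr => i _; rewrite linearZ.
rewrite linear_sum; apply/rowP => j; rewrite summxE (bigD1 j) //= big1 ?addr0.
  by rewrite linearZ /= fextU coe !mxE !eqxx mulr1.
by move=> i ij; rewrite linearZ /= fextU coe !mxE eq_sym (negPf ij) andbF mulr0.
Qed.
End BaseChangeRank.

(** * The support of the derived weighting functor *)

Section WeightingElements.
Variables (F : fieldType) (g : finLieAlgType F) (h : cartan g).
Variable M : lmodType (uea g).
Local Notation S := (uh h).
Implicit Types (l m : dual h).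

Lemma max_subP l (x : M) : max_sub M l x <->
  exists n (c : 'I_n -> S) (y : 'I_n -> M),
    (forall i, character l (c i) = 0) /\ x = \sum_i uincl (c i) *: y i.
Proof.
split=> [[n [a [e [Ee ->]]]]|[n [c [y [c0 ->]]]]]; last first.
  exists n, (fun=> 1), (fun i => uincl (c i) *: y i); split=> [i|].
    by exists (c i), (y i).
  by apply: eq_bigr => i _; rewrite scale1r.
pose P i := cid (Ee i); pose b i : S := sval (P i); pose y i := sval (cid (svalP (P i))).
have H i : character l (b i) = 0 /\ e i = b i *: y i by rewrite /y /b; case: cid.
exists n, (fun i => a i * b i), y; split=> [i|].
  by rewrite /character rmorphM; have [E _] := H i; rewrite [X in _ * X]E mulr0.
apply: eq_bigr => i _; have [_ ->] := H i; rewrite scalerA.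
by [].
Qed.

Lemma fpi_eq0 l (x : M) : fpi l x = 0 <-> max_sub M l x.
Proof. by rewrite -(fpi0 M l) fpiP subr0. Qed.

Fact wsingle_fin l (x : M) : exists s : seq (dual h),
  forall m, m \notin s -> (if m == l then fpi m x else 0) = 0.
Proof. by exists [:: l] => m; rewrite inE => /negPf ->. Qed.
Definition wsingle l (x : M) : weighting h M := Wsum (wsingle_fin l x).

Lemma wsingleE l x : wfun (wsingle l x) l = fpi l x.
Proof. by rewrite /= eqxx. Qed.

Lemma wsingle_neq l x m : m != l -> wfun (wsingle l x) m = 0.
Proof. by move=> /= /negPf ->. Qed.

Lemma weighting_add (f f' : weighting h M) m : wfun (f + f') m = wfun f m + wfun f' m.
Proof. by []. Qed.

Lemma weighting_sub (f f' : weighting h M) m : wfun (f - f') m = wfun f m - wfun f' m.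
Proof. by []. Qed.

Lemma weighting_scal (c : F) (f : weighting h M) m :
  wfun ((c%:A : uea g) *: f) m = (c%:A : S) *: wfun f m.
Proof. by rewrite [_ *: f](@rep_scalE _ _ _ (wrep h M)). Qed.

Lemma dual_neq l m : m != l -> exists y : lie_of h, dual_app m y - dual_app l y != 0.
Proof.
move=> ml; apply: contrapT => /forallNP H; move/negP: ml; apply; apply/eqP/lfunP => y.
by have /negP := H y; rewrite negbK subr_eq0 => /eqP.
Qed.

Lemma fib_scaleVK l (c : F) (q : fib M l) : c != 0 ->
  (c^-1%:A : S) *: ((c%:A : S) *: q) = q.
Proof. by move=> c0; rewrite scalerA mulr_algl scalerA mulVf // !scale1r. Qed.

(** Distinct weights differ at some [y], so a component at [m != l] is killed by a nonzero
    scalar. *)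
Lemma weighting_weight_space l (f : weighting h M) :
  weight_space h (weighting h M) l f <-> forall m, m != l -> wfun f m = 0.
Proof.
split=> [H m ml|H y]; last first.
  apply: wsumP => m; rewrite weighting_cartan weighting_scal.
  by have [->//|/H ->] := eqVneq m l; rewrite !scaler0.
have [y yml] := dual_neq ml.
have := congr1 (fun w : weighting h M => wfun w m) (H y).
rewrite weighting_cartan weighting_scal => /eqP.
rewrite -subr_eq0 -scalerBl -scalerBl => /eqP E.
by rewrite -(fib_scaleVK (wfun f m) yml) E scaler0.
Qed.

End WeightingElements.
Arguments wsingle {F g h M} l x.

(** * The derived functor and purity of the augmentation kernel *)

Section LeftDerivedSupport.
Variables (F : fieldType) (g : finLieAlgType F) (h : cartan g).
Variable M : lmodType (uea g).
Local Notation S := (uh h).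
Local Notation aug := (aug M).
Local Notation diff1 := (diff1 M).
Local Notation diff2 := (diff2 M).

(** Injectivity of [K / m_l K -> P / m_l P], for [K] the kernel of the augmentation of the free
    module [P]: an elementary form of the vanishing of Tor_1 at [l]. *)
Definition pure_at (l : dual h) := forall k : kerm aug,
  max_sub (res0 M) l (val k) -> max_sub (kerm aug) l k.

Lemma kerm_eq0 (P Q : lmodType (uea g)) (f : {linear P -> Q}) (k : kerm f) : f (val k) = 0.
Proof. by apply/eqP; apply: (valP k). Qed.

Lemma kerm_valB (P Q : lmodType (uea g)) (f : {linear P -> Q}) (k k' : kerm f) :
  val (k - k') = val k - val k'.
Proof. by []. Qed.

Lemma kerm_valZ (P Q : lmodType (uea g)) (f : {linear P -> Q}) a (k : kerm f) :
  val (a *: k) = a *: val k.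
Proof. by []. Qed.

Lemma kerm_val_sum (P Q : lmodType (uea g)) (f : {linear P -> Q}) I (r : seq I)
    (c : I -> uea g) (k : I -> kerm f) :
  val (\sum_(i <- r) c i *: k i) = \sum_(i <- r) c i *: val (k i).
Proof. by elim/big_rec2: _ => [//|i x y _ <-]. Qed.

Definition to_kernel : {linear res1 M -> kerm aug} := fext id.

Lemma val_to_kernel p : val (to_kernel p) = diff1 p.
Proof.
exact: kerm_val_sum.
Qed.

Lemma aug_diff1 p : aug (diff1 p) = 0.
Proof. by rewrite -val_to_kernel kerm_eq0. Qed.

Lemma diff1_diff2 p : diff1 (diff2 p) = 0.
Proof.
have -> : diff2 p = \sum_(k <- msupp p) p@_k *: val k by [].
rewrite raddf_sum big1 // => k _.
transitivity (p@_k *: diff1 (val k)); first exact: linearZ_LR.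
by rewrite kerm_eq0 scaler0.
Qed.

Lemma diff2_onto p : diff1 p = 0 -> exists q, diff2 q = p.
Proof.
move=> /eqP p0; pose k : kerm diff1 := exist _ p p0.
by exists << k >>; rewrite /Defs.diff2 /= fextU.
Qed.

Lemma diff1_onto (k : kerm aug) : diff1 << k >> = val k.
Proof. by rewrite /Defs.diff1 /= fextU. Qed.

(** Purity writes [diff1 p] with coefficients in [m_l] and entries in the kernel. Lifting the
    entries gives [p'] in [m_l] times [res1 M], and [p - p'] is a cycle, hence in the image of
    [diff2]. *)
Lemma pure_fiber_exact l (p : res1 M) : pure_at l ->
  fpi l (diff1 p) = 0 -> exists q, fpi l (diff2 q) = fpi l p.
Proof.
move=> pl /fpi_eq0; have /eqP p0 := aug_diff1 p; pose k : kerm aug := exist (fun x => aug x == 0) (diff1 p) p0.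
move=> /(pl k)/max_subP [n [c [y [c0 kE]]]].
pose p' : res1 M := \sum_i uincl (c i) *: << y i >>.
have p'E : diff1 p' = diff1 p.
  rewrite -[RHS]/(val k) kE kerm_val_sum raddf_sum; apply: eq_bigr => i _.
  transitivity (uincl (c i) *: diff1 << y i >>); first exact: linearZ_LR.
  by rewrite diff1_onto.
have [q qE] : exists q, diff2 q = p - p'.
  by apply: diff2_onto; rewrite linearB /= p'E subrr.
exists q; rewrite qE fpiD fpiN (fpi_eq0 _ p').2 ?subr0 //.
by apply/max_subP; exists n, c, (fun i => << y i >>).
Qed.

(** Under purity, each component of a cycle of weight [l] bounds, and the bounding chains are
    assembled with finite support. Conversely, a [k] violating purity, placed at [l] as the
    generator [<< k >>], is a cycle; applying [to_kernel], which kills boundaries, shows that it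
    does not bound. *)
Lemma supp_weighting1 l : supp h (weighting1 h M) l <-> ~ pure_at l.
Proof.
split=> [[v vl v0] pl|npl].
  apply: v0; pose z := mqrepr v; have vE : v = mqpi _ z by rewrite mqreprK.
  pose w : weighting h (res1 M) := val z.
  have w0 : wmap h diff1 w = 0 by apply: kerm_eq0.
  have fibw m : exists q, fpi m (diff2 q) = wfun w m.
    have [->|ml] := eqVneq m l.
      have [|q qE] := @pure_fiber_exact l (frepr (wfun w l)) pl.
        by rewrite -(@wmapE _ _ _ _ _ diff1 w l) ?freprK // w0.
      by exists q; rewrite qE freprK.
    (* Away from [l], the difference between the action of [y] and its value at [l] kills the class
       but is an invertible scalar on this component. *)
    have [y yml] := dual_neq ml.
    have := vl y; rewrite vE -![_ *: mqpi _ _]linearZ => /mqpiP [u uE].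
    move/(congr1 (fun f : weighting h (res1 M) => wfun f m)): uE.
    rewrite kerm_valB !kerm_valZ -/w weighting_sub weighting_cartan weighting_scal -scalerBl -scalerBl => E.
    exists ((dual_app m y - dual_app l y)^-1%:A *: frepr (wfun u m)).
    rewrite linearZ_LR fpiZ -[fpi m _]/(wfun (wmap h diff2 u) m) E.
    exact: fib_scaleVK.
  have [qf qfP] : exists qf : dual h -> res2 M, forall m, fpi m (diff2 (qf m)) = wfun w m.
    by exists (fun m => sval (cid (fibw m))) => m; case: cid.
  have ufin : exists s : seq (dual h), forall m, m \notin s ->
      (if wfun w m == 0 then 0 else fpi m (qf m)) = 0.
    by have [s sw] := wfun_fin w; exists s => m /sw ->; rewrite eqxx.
  rewrite vE -[RHS](raddf0 (mqpi _)); apply/mqpiP; rewrite subr0.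
  exists (Wsum ufin); apply: wsumP => m; rewrite -[RHS]/(wfun w m).
  case: (eqVneq (wfun w m) 0) => [w0m|wm].
    rewrite w0m (@wmapE _ _ _ _ _ diff2 _ m 0) ?raddf0 ?fpi0 //=.
    by rewrite w0m eqxx.
  rewrite (@wmapE _ _ _ _ _ diff2 _ m (qf m)) ?qfP //.
  by rewrite /= (negPf wm).
have [k [k1 k2]] : exists k : kerm aug, max_sub (res0 M) l (val k) /\
    ~ max_sub (kerm aug) l k.
  apply: contrapT => /forallNP H; apply: npl => k k1; apply: contrapT => k2.
  by apply: (H k).
pose z0 := wsingle (h := h) l (<< k >> : res1 M).
have z00 : wmap h diff1 z0 == 0.
  apply/eqP/wsumP => m; have [->|ml] := eqVneq m l.
    rewrite (wmapE diff1 (wsingleE l _)) diff1_onto.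
    by apply/fpi_eq0.
  rewrite (@wmapE _ _ _ _ _ diff1 _ m 0) ?raddf0 ?fpi0 //.
  by rewrite wsingle_neq.
pose z : kerm (wmap h diff1) := exist (fun x => wmap h diff1 x == 0) z0 z00.
exists (mqpi _ z).
  move=> y; rewrite -![_ *: mqpi _ _]linearZ; congr mqpi; apply: val_inj.
  apply: (weighting_weight_space l z0).2 => m ml.
  exact: wsingle_neq.
rewrite -[X in _ <> X](raddf0 (mqpi _)) => /mqpiP; rewrite subr0 => -[u uE].
have {uE} : wmap h diff2 u = z0 := uE.
move=> /(congr1 (fun f : weighting h (res1 M) => wfun f l)); rewrite wsingleE => E.
have d0 q : to_kernel (diff2 q) = 0.
  by apply: val_inj; rewrite val_to_kernel diff1_diff2.
have kE : to_kernel << k >> = k by rewrite /to_kernel /= fextU.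
apply: k2; have /(subN (S := max_sub _ l)) := lin_max_sub to_kernel ((fpiP _ _ _).1 E).
suff -> : - to_kernel (diff2 (frepr (wfun u l)) - << k >>) = k by [].
by rewrite (raddfB to_kernel) [X in X - _](d0 _) [X in _ - X]kE sub0r opprK.
Qed.

End LeftDerivedSupport.

(** * Fibers and frames at a point *)

Section LocalBasis.
Variables (F : fieldType) (g : finLieAlgType F) (h : cartan g) (M : lmodType (uea g)).
Local Notation S := (uh h).
Local Notation MU := (res_uh h M).
Implicit Type l : dual h.

Lemma max_sub_gen (N : lmodType (uea g)) l (c : S) (y : N) :
  character l c = 0 -> max_sub N l (uincl c *: y).
Proof.
move=> c0; apply/max_subP; exists 1%N, (fun=> c), (fun=> y).
by split=> //; rewrite big_ord1.
Qed.

Lemma max_sub_sum (N : lmodType (uea g)) l I (r : seq I) (y : I -> N) :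
  (forall i, max_sub N l (y i)) -> max_sub N l (\sum_(i <- r) y i).
Proof.
move=> H; elim/big_rec: _ => [|i x _ Hx]; first exact: sub0P.
exact: subD.
Qed.

Lemma fpi_uincl l (a : S) (x : M) : fpi l (uincl a *: x) = a *: fpi l x.
Proof.
transitivity (fpi l (a *: (x : MU) + 0)); first by rewrite addr0.
by rewrite fpi_linear_uh fpi0 addr0.
Qed.

Lemma fib_scale_character l (a : S) (q : fib M l) : a *: q = (character l a)%:A *: q.
Proof.
rewrite -[q]freprK; apply/eqP; rewrite -subr_eq0 -scalerBl; apply/eqP.
transitivity (fpi l (uincl (a - (character l a)%:A) *: frepr q)).
  by rewrite fpi_uincl.
apply/fpi_eq0/max_sub_gen.
by rewrite characterB character_scal subrr.
Qed.

Definition fiber_basis l k (e : 'I_k -> M) :=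
  (forall c : 'I_k -> F, \sum_i (c i)%:A *: fpi l (e i) = 0 :> fib M l -> forall i, c i = 0) /\
  (forall q : fib M l, exists c : 'I_k -> F, q = \sum_i (c i)%:A *: fpi l (e i)).

(** Over the field [F], a frame is a basis, since its nonzero coefficient is invertible. *)
Lemma fiber_basis_exists l : fin_generated MU ->
  exists k (e : 'I_k -> M), fiber_basis l e.
Proof.
move=> [n [x xM]]; pose V := restr (in_alg S) (fib M l).
have fgV : fin_generated (V : lmodType F).
  exists n, (fun j => fpi l (x j) : V) => q.
  have [a qE] := xM (frepr q); exists (fun j => character l (a j)).
  rewrite -[q]freprK qE fpi_sum; apply: eq_bigr => j _.
  rewrite -[LHS]/(fpi l (uincl (a j) *: (x j : M))) fpi_uincl.
  exact: fib_scale_character.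
have [k [e [f [ie f0 fe]]]] := frame_exists fgV.
exists k, (fun i => frepr (e i : fib M l)); split=> [c E|q].
  by apply: ie; rewrite -[RHS]E; apply: eq_bigr => i _; rewrite freprK.
have [c cE] := fe (f^-1 *: (q : V)); exists c.
move: cE; rewrite scalerA mulfV // scale1r => ->.
by apply: eq_bigr => i _; rewrite freprK.
Qed.

(* Nakayama's lemma. *)
Lemma fiber_basis_frame l k (e : 'I_k -> M) : fin_generated MU -> fiber_basis l e ->
  exists2 f : S, character l f = 1 & frame (e : 'I_k -> MU) f.
Proof.
move=> [n [x xM]] [_ eb].
have mx z : max_sub M l z -> exists C : 'I_n -> S,
    (forall j, character l (C j) = 0) /\ z = \sum_j C j *: x j :> MU.
  move=> /max_subP[p [c [y [c0 ->]]]].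
  pose a i := sval (cid (xM (y i))).
  have yE i : y i = \sum_j a i j *: x j :> MU by rewrite /a; case: cid.
  exists (fun j => \sum_i c i * a i j); split=> [j|].
    rewrite character_sum big1 // => i _.
    by rewrite characterM c0 mul0r.
  under [RHS]eq_bigr do rewrite scaler_suml.
  rewrite exchange_big; apply: eq_bigr => i _; rewrite yE.
  rewrite -[LHS]/(c i *: (\sum_j a i j *: x j : MU)) scaler_sumr.
  by apply: eq_bigr => j _; rewrite scalerA.
have ex j : exists b : 'I_k -> S, exists C : 'I_n -> S, (forall j, character l (C j) = 0) /\
    x j - \sum_i b i *: (e i : MU) = \sum_j C j *: x j :> MU.
  have [c cE] := eb (fpi l (x j)); exists (fun i => (c i)%:A); apply: mx.
  apply/fpiP; rewrite cE fpi_sum; apply: eq_bigr => i _.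
  exact/esym/fpi_uincl.
pose b j := sval (cid (ex j)); pose bP j := svalP (cid (ex j)).
pose C j := sval (cid (bP j)).
have CP j : (forall j', character l (C j j') = 0) /\
    x j - \sum_i b j i *: (e i : MU) = \sum_j' C j j' *: x j' :> MU.
  exact: svalP (cid (bP j)).
(* The matrix [D] maps the generators into the span of [e] and is the identity at [l]. So [\det D]
   has value 1 there, and the adjugate of [D] shows that it is a frame coefficient. *)
pose D : 'M[S]_n := 1%:M - \matrix_(i, j) C i j.
have DE j : \sum_j' D j j' *: x j' = \sum_i b j i *: (e i : MU).
  under eq_bigr do rewrite !mxE scalerBl.
  rewrite sumrB -(CP j).2 (bigD1 j) //= eqxx scale1r big1 ?addr0; last first.
    by move=> j' jj'; rewrite eq_sym (negPf jj') scale0r.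
  by rewrite opprB addrC subrK.
exists (\det D).
  rewrite /character -det_map_mx (_ : map_mx _ D = 1%:M) ?det1 //.
  apply/matrixP => i j; rewrite !mxE raddfB /= rmorph_nat.
  by rewrite [X in _ - X](CP i).1 subr0.
apply: frame_of_generators xM _ => j.
exists (fun i => \sum_j' (\adj D) j j' * b j' i).
under [RHS]eq_bigr do rewrite scaler_suml.
rewrite exchange_big /=.
under [RHS]eq_bigr => j' _ do under eq_bigr => i _ do rewrite -scalerA.
under [RHS]eq_bigr => j' _ do rewrite -scaler_sumr -DE scaler_sumr.
rewrite exchange_big /=.
have H j' : \sum_(i < n) (\adj D) j i *: (D i j' *: x j') = ((\det D)%:M : 'M_n) j j' *: x j'.
  by rewrite -mul_adj_mx mxE scaler_suml; apply: eq_bigr => i _; rewrite scalerA.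
under [RHS]eq_bigr do rewrite H.
rewrite (bigD1 j) //= mxE eqxx mulr1n big1 ?addr0 // => j' jj'.
by rewrite mxE eq_sym (negPf jj') scale0r.
Qed.

(** Let [kk] be the sum of the [c j] times [y j], with [c j] in [m_l]. The frame corrects [f] times
    [y j] to an element [z j] of the kernel; by independence of [e] the corrections cancel, so [f]
    times [kk] is the sum of the [c j] times [z j]. Finally [f] is invertible modulo [m_l]. *)
Lemma frame_pure l k (e : 'I_k -> MU) (f : S) : independent e -> frame e f ->
  character l f != 0 -> pure_at M l.
Proof.
move=> ie fe fl kk /max_subP[n [c [y [c0 kE]]]].
pose s j := sval (cid (fe (aug M (y j)))).
have sE j : f *: (aug M (y j) : MU) = \sum_i s j i *: e i by rewrite /s; case: cid.
have cs0 i : \sum_j c j * s j i = 0.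
  apply: (ie (fun i => \sum_j c j * s j i)).
  under eq_bigr do rewrite scaler_suml.
  rewrite exchange_big /=.
  under eq_bigr => j _ do under eq_bigr => i' _ do rewrite -scalerA.
  under eq_bigr => j _ do rewrite -scaler_sumr -sE scalerA mulrC -scalerA.
  rewrite -scaler_sumr; suff -> : \sum_j c j *: (aug M (y j) : MU) = 0 by rewrite scaler0.
  transitivity (aug M (val kk)); last exact: (kerm_eq0 kk).
  by rewrite kE raddf_sum; apply: eq_bigr => j _; apply/esym/linearZ_LR.
pose z j : res0 M := uincl f *: y j - \sum_i uincl (s j i) *: << (e i : M) >>.
have z0 j : aug M (z j) == 0.
  rewrite /z raddfB /= subr_eq0; apply/eqP.
  transitivity (uincl f *: aug M (y j)); first exact: linearZ_LR.
  transitivity (\sum_i aug M (uincl (s j i) *: << (e i : M) >>)); last first.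
    exact/esym/raddf_sum.
  rewrite [LHS]sE; apply: eq_bigr => i _; apply/esym.
  transitivity (uincl (s j i) *: aug M << (e i : M) >>); first exact: linearZ_LR.
  by congr (_ *: _); rewrite /Defs.aug /= fextU.
pose zz j : kerm (aug M) := exist (fun x => aug M x == 0) (z j) (z0 j).
have fk : uincl f *: kk = \sum_j uincl (c j) *: zz j.
  apply: val_inj; rewrite kerm_valZ kerm_val_sum kE scaler_sumr.
  rewrite [RHS](eq_bigr (fun j => uincl f *: (uincl (c j) *: y j) - uincl (c j) *: \sum_i uincl (s j i) *: << (e i : M) >>)); last first.
    move=> j _; rewrite -[LHS]/(uincl (c j) *: z j) /z scalerBr !scalerA -!rmorphM.
    by rewrite [f * _]mulrC.
  rewrite sumrB [X in _ = _ - X](_ : _ = 0) ?subr0 //.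
  under eq_bigr do rewrite scaler_sumr.
  rewrite exchange_big big1 // => i _ /=.
  under eq_bigr do rewrite scalerA -rmorphM.
  by rewrite -scaler_suml -rmorph_sum cs0 rmorph0 scale0r.
pose fi : S := (character l f)^-1%:A.
have -> : kk = uincl (1 - fi * f) *: kk + uincl fi *: (uincl f *: kk).
  by rewrite scalerA -rmorphM -scalerDl -rmorphD subrK rmorph1 scale1r.
have fif : character l (1 - fi * f) = 0.
  by rewrite characterB characterM character1 character_scal mulVf ?subrr.
apply: subD; first exact: max_sub_gen.
rewrite fk; apply: (subZ (S := max_sub _ l)); apply: max_sub_sum => j.
exact: max_sub_gen.
Qed.

End LocalBasis.

(** * Independence of lifted fiber bases *)

Section PureFree.
Variables (F : closedFieldType) (g : finLieAlgType F) (h : cartan g).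
Hypothesis uncountableF : ~ countable [set: F]%classic.
Hypothesis center0 : forall x : g, (forall y, lie x y = 0) -> x = 0.
Hypothesis char0 : [pchar F] =i pred0.
Variable M : lmodType (uea g).
Local Notation S := (uh h).
Local Notation MU := (res_uh h M).
Variables (l : dual h) (k : nat) (e : 'I_k -> M) (f : S).
Hypothesis fl : character l f = 1.
Hypothesis fe : frame (e : 'I_k -> MU) f.
Hypothesis eb : fiber_basis l e.

Let comb (c : 'rV[S]_k) : MU := \sum_i c 0 i *: (e i : MU).

Fact comb_linear : linear comb.
Proof.
move=> a c d; rewrite /comb scaler_sumr -big_split; apply: eq_bigr => i _ /=.
by rewrite !mxE scalerDl scalerA.
Qed.
HB.instance Definition _ := GRing.isLinear.Build S 'rV[S]_k MU _ comb comb_linear.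

Fact fiber_basis_inj : injective e.
Proof.
move=> i j eij; apply/eqP; apply: contrapT => /negP ij.
have [H _] := eb; have := H (fun t => (t == i)%:R - (t == j)%:R) _ i.
rewrite eqxx (negPf ij) subr0 => E; apply/negP: (oner_neq0 F); apply/negPn/eqP/E.
under eq_bigr do rewrite scalerBl scalerBl.
rewrite sumrB (bigD1 i) //= [X in _ - X](bigD1 j) //= !eqxx !scale1r.
rewrite !big1 ?addr0 ?eij ?subrr // => t ti; rewrite (negPf ti) !scale0r //.
Qed.

(** An [S]-linear lift of [f] times the augmentation through [comb], built on each free generator
    with [uea_lift]. The prescribed values at the [e i] will allow a relation to be recovered from
    its image. *)
Lemma kernel_lift : exists r : res0 M -> 'rV[S]_k,
  [/\ forall a y y', r (uincl a *: y + y') = a *: r y + r y',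
      forall y, comb (r y) = f *: (aug M y : MU) &
      forall i, r << e i >> = f *: delta_mx 0 i].
Proof.
pose phi (m : M) (u : uea g) : MU := f *: (u *: m : MU).
have phiP m a u v : phi m (uincl a * u + v) = a *: phi m u + phi m v.
  rewrite /phi scalerDl -[(_ * _) *: m]scalerA scalerDr; congr (_ + _).
  by rewrite -[uincl a *: _]/(a *: (u *: m : MU)) !scalerA mulrC.
have onto m u : exists p, comb p = phi m u.
  have [c cE] := fe (u *: m); exists (\row_i c i).
  by rewrite /phi cE; apply: eq_bigr => i _; rewrite mxE.
(* As [e] is injective, at most one index is eligible, so the value at [e i] is the intended one. *)
pose p0 (m : M) : 'rV[S]_k := if [pick i | e i == m] is Some i then f *: delta_mx 0 i
  else sval (cid (onto m 1)).
have p0E m : comb (p0 m) = phi m 1.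
  rewrite /p0; case: pickP => [i /eqP <-|_]; last by case: cid.
  rewrite linearZ /= /phi scale1r; congr (_ *: _).
  rewrite /comb (bigD1 i) //= mxE !eqxx scale1r big1 ?addr0 // => j ji.
  by rewrite mxE (negPf ji) andbF scale0r.
pose psi m := sval (cid (uea_lift center0 char0 (phiP m) (onto m) (p0E m))).
have psiP m : [/\ forall a u v, psi m (uincl a * u + v) = a *: psi m u + psi m v,
    forall u, comb (psi m u) = phi m u & psi m 1 = p0 m].
  exact: svalP (cid (uea_lift center0 char0 (phiP m) (onto m) (p0E m))).
have psi0 m : psi m 0 = 0.
  have [H _ _] := psiP m; have := H 0 0 0; rewrite raddf0 mul0r addr0 scale0r add0r.
  by have := H 1 0 0; rewrite mulr0 addr0 scale1r => /eqP; rewrite -subr_eq0 opprD addNKr oppr_eq0 => /eqP.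
pose r (y : res0 M) : 'rV[S]_k := \sum_(m <- msupp y) psi m (y@_m).
have rE (s : seq M) y : uniq s -> {subset msupp y <= s} -> r y = \sum_(m <- s) psi m (y@_m).
  move=> us ys; rewrite /r [RHS](bigID (fun x => x \in msupp y)) /=.
  rewrite [X in _ = _ + X]big1 ?addr0; last by move=> x /mcoeff_outdom ->.
  rewrite -[RHS]big_filter; apply: perm_big; apply: uniq_perm.
  - exact: fset_uniq.
  - exact: filter_uniq.
  - move=> x; rewrite mem_filter; case xp: (x \in msupp y) => //=.
    by apply/esym/ys.
exists r; split=> [a y y'|y|i].
- pose s := undup (msupp y ++ msupp y' ++ msupp (uincl a *: y + y')).
  have us : uniq s by exact: undup_uniq.
  rewrite (@rE s) // => [|x xs]; last by rewrite mem_undup !mem_cat xs !orbT.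
  rewrite (@rE s y) // => [|x xs]; last by rewrite mem_undup !mem_cat xs.
  rewrite (@rE s y') // => [|x xs]; last by rewrite mem_undup !mem_cat xs !orbT.
  rewrite scaler_sumr -big_split; apply: eq_bigr => x _ /=.
  by have [H _ _] := psiP x; rewrite mcoeffD mcoeffZ H.
- rewrite /r raddf_sum; transitivity (\sum_(m <- msupp y) f *: (y@_m *: m : MU)).
    by apply: eq_bigr => m _; have [_ H _] := psiP m; exact: H.
  by rewrite -scaler_sumr.
- rewrite (@rE [:: e i]) // ?big_seq1.
    rewrite mcoeffU eqxx; have [_ _ ->] := psiP (e i); rewrite /p0.
    by case: pickP => [j /eqP/fiber_basis_inj ->//|/(_ i)]; rewrite eqxx.
  by move=> x; rewrite msuppU oner_eq0 !inE.
Qed.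

(* A relation among the [e i] has coefficients in [m_l], so purity puts the
   corresponding element of the kernel in [m_l] times the kernel. Iterating, the
   coefficients vanish at [l] to infinite order. *)
Lemma pure_independent : pure_at M l -> independent (e : 'I_k -> MU).
Proof.
move=> pl; have [r [rP rc re]] := kernel_lift.
have r0 : r 0 = 0.
  by have := rP 1 0 0; rewrite rmorph1 !scale1r addr0 => /eqP; rewrite -subr_eq0 opprD addNKr oppr_eq0 => /eqP.
have rS I (s : seq I) (c : I -> S) (y : I -> res0 M) :
    r (\sum_(i <- s) uincl (c i) *: y i) = \sum_(i <- s) c i *: r (y i).
  by elim/big_rec2: _ => [//|i u v _ <-]; rewrite rP.
(* Purity and the lift [r] express [f] times a relation through new relations, with coefficients in
   [m_l]. *)
have step (c : 'rV[S]_k) : comb c = 0 -> exists n (b : 'I_n -> S) (d : 'I_n -> 'rV[S]_k),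
    [/\ forall j, character l (b j) = 0, forall j, comb (d j) = 0 &
        f *: c = \sum_j b j *: d j].
  move=> c0; pose y : res0 M := \sum_i uincl (c 0 i) *: << e i >>.
  have y0 : aug M y == 0.
    rewrite /y raddf_sum; apply/eqP; rewrite -[RHS]c0; apply: eq_bigr => i _.
    transitivity (uincl (c 0 i) *: aug M << e i >>); first exact: linearZ_LR.
    by rewrite /Defs.aug /= fextU.
  pose kk : kerm (aug M) := exist (fun x => aug M x == 0) y y0.
  have cl i : character l (c 0 i) = 0.
    have [H _] := eb; apply: (H (fun i => character l (c 0 i))).
    rewrite -[RHS](fpi0 M l) -c0 /comb fpi_sum.
    apply: eq_bigr => j _; rewrite -fib_scale_character; apply/esym; exact: fpi_uincl.
  have yl : max_sub (res0 M) l (val kk).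
    by apply: max_sub_sum => i; apply: max_sub_gen.
  have /max_subP[n [b [z [b0 kE]]]] := pl _ yl.
  exists n, b, (fun j => r (val (z j))); split=> // [j|].
    by rewrite rc kerm_eq0 scaler0.
  rewrite -rS -kerm_val_sum -kE -[val kk]/y /y rS.
  apply/rowP => i; rewrite summxE (bigD1 i) //= big1 ?addr0 => [|j ji].
    by rewrite re !mxE !eqxx mulr1 mulrC.
  by rewrite re !mxE eq_sym (negPf ji) andbF !mulr0.
(* Each use of [step] gains a factor ['X] on a line through [l]; the factor [f] cancels because its
   restriction takes the value 1 at parameter 0. *)
have dvd mu N (c : 'rV[S]_k) i : comb c = 0 -> ('X^N %| on_line l mu (c 0 i))%R.
  elim: N c i => [|N IH] c i c0; first by rewrite expr0 dvd1p.
  have [n [b [d [b0 d0 /rowP/(_ i) E]]]] := step _ c0.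
  have : ('X^(N.+1) %| on_line l mu (f * c 0 i))%R.
    have -> : f * c 0 i = \sum_j b j * d j 0 i.
      transitivity ((f *: c) 0 i); first by rewrite mxE.
      by rewrite E summxE; apply: eq_bigr => j _; rewrite mxE.
    rewrite on_line_sum; apply: (big_ind (fun p => ('X^(N.+1) %| p)%R)) => [|p q|j _].
    - exact: dvdp0.
    - exact: dvdp_add.
    rewrite on_lineM exprS; apply: dvdp_mul; last exact: IH.
    rewrite -['X]subr0 -polyC0 -[_ - _]/('X - 0%:P) dvdp_XsubCl /root.
    by rewrite on_lineE scale0r addr0 b0.
  rewrite on_lineM Gauss_dvdpr // coprimep_expl // coprimep_sym.
  rewrite coprimepX /root on_lineE scale0r addr0 fl.
  exact: oner_neq0.
move=> c cE i; apply/eqP; apply: contrapT => /negP/(character_nonzero uncountableF)[m].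
have cc : comb (\row_j c j) = 0.
  by rewrite /comb -[RHS]cE; apply: eq_bigr => j _; rewrite mxE.
(* The line joins [l] to a point [m] where the coefficient is nonzero, reached at parameter 1. *)
have := dvd (m - l) _ _ i cc; rewrite mxE => H.
suff z : on_line l (m - l) (c i) = 0.
  have := on_lineE l (m - l) (c i) 1; rewrite z horner0 scale1r addrC subrK => <-.
  by rewrite eqxx.
apply/eqP; apply: contrapT => /negP nz.
have := dvdp_leq nz (H (size (on_line l (m - l) (c i)))).
by rewrite size_polyXn ltnn.
Qed.

End PureFree.

Lemma pure_frame (F : closedFieldType) (g : finLieAlgType F) (h : cartan g)
    (M : lmodType (uea g)) (l : dual h) : ~ countable [set: F]%classic ->
  (forall x : g, (forall y, lie x y = 0) -> x = 0) -> [pchar F] =i pred0 ->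
  fin_generated (res_uh h M) -> pure_at M l ->
  exists k (e : 'I_k -> res_uh h M) (f : uh h),
    [/\ independent e, character l f != 0, frame e f & fiber_basis l (e : 'I_k -> M)].
Proof.
move=> uF c0 char0 fg pl; have [k [e eb]] := fiber_basis_exists l fg.
have [f f1 fe] := fiber_basis_frame fg eb.
exists k, e, f; split=> //; last by rewrite f1 oner_neq0.
exact: (@pure_independent _ _ _ uF c0 char0 _ _ _ _ _ f1 fe eb pl).
Qed.

(** * Weights and roots *)

Section RootStrings.
Variables (F : fieldType) (g : finLieAlgType F) (h : cartan g).
Hypothesis char0 : [pchar F] =i pred0.
Variable W : lmodType (uea g).
Implicit Types (l a : dual h) (v : W).

Lemma weight_space_root l a z v : root_space a z -> weight_space h W l v ->
  weight_space h W (l + a) (uvar z *: v).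
Proof.
move=> az lv y; rewrite scalerA.
have -> : uvar (lsval y) * uvar z = uvar z * uvar (lsval y) + uvar (lie (lsval y) z).
  by rewrite uvar_lieE addrC subrK.
rewrite az scalerDl -scalerA lv linearZ /= -[_ *: uvar z]mulr_algl.
rewrite !scalerA -scalerDl; congr (_ *: _).
by rewrite mulr_algl mulr_algr -scalerDl mulr_algl dual_appD.
Qed.

Lemma weight_space_iter l a z v k : root_space a z -> weight_space h W l v ->
  weight_space h W (l + k%:R *: a) (iter k ( *:%R (uvar z)) v).
Proof.
move=> az lv; elim: k => [|k IH]; first by rewrite scale0r addr0.
rewrite -[k.+1]addn1 natrD scalerDl scale1r addrA addn1 iterS.
exact: weight_space_root.
Qed.

Lemma iter_first_zero (f : W -> W) v : f 0 = 0 -> v <> 0 -> (exists k, iter k f v = 0) ->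
  exists k, iter k f v <> 0 /\ iter k.+1 f v = 0.
Proof.
move=> f0 v0 [k]; elim: k => [//|k IH] Ek.
by have [/IH//|nz] := pselect (iter k f v = 0); exists k.
Qed.

Section Sl2.
Variables (a : dual h) (x y : g) (t : lie_of h).
Hypotheses (ax : root_space a x) (ay : root_space (- a) y) (txy : lsval t = lie x y).

(** Moving [x] past each [y] adds the value at [t] of the current weight. As [dual_app a t] is not
    normalized, it may be zero, which is the Heisenberg case. *)
Lemma sl2_string m w k : weight_space h W m w -> uvar x *: w = 0 ->
  (uvar x *: iter k.+1 ( *:%R (uvar y)) w) =
  ((\sum_(i < k.+1) (dual_app m t - i%:R * dual_app a t))%:A : uea g) *:
    iter k ( *:%R (uvar y)) w.
Proof.
move=> mw xw; have xy v : uvar x *: (uvar y *: v) =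
    uvar y *: (uvar x *: v) + uvar (lsval t) *: v.
  by rewrite txy uvar_lieE !scalerA -scalerDl addrC subrK.
elim: k => [|k IH].
  rewrite big_ord1 mul0r subr0 /= xy xw scaler0 add0r; exact: mw.
rewrite [in RHS]big_ord_recr [RHS]/= scalerDl scalerDl iterS xy IH.
congr (_ + _); first by rewrite !scalerA mulr_algl mulr_algr.
have := weight_space_iter k.+1 ay mw t; rewrite iterS => ->.
by rewrite dual_appD dual_appZ /dual_app opp_lfunE mulrN.
Qed.

Hypothesis supp_line : forall l b, (forall k : nat, supp h W (l + k%:R *: b)) ->
  forall c, supp h W (l + c *: b).

(** If the line is not contained in the support, [supp_line] forces both strings to stop: [x] leads
    up to a vector [w] of weight [m = l + j a], and [y] to a last nonzero vector after [k] steps. By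
    [sl2_string], the sum for [k.+1] terms vanishes, so [2 m(t) = k a(t)], and the integer is
    [k - 2 j]. *)
Lemma supp_line_or_integral l : supp h W l ->
  (forall c, supp h W (l + c *: a)) \/
  exists k : int, dual_app l t *+ 2 = k%:~R * dual_app a t.
Proof.
move=> [v lv v0]; have [Z|nZ] := pselect (forall c, supp h W (l + c *: a)); [by left|right].
have [j [wj0 xw]] : exists j, iter j ( *:%R (uvar x)) v <> 0 /\
    iter j.+1 ( *:%R (uvar x)) v = 0.
  apply: iter_first_zero => //; first exact: scaler0.
  apply: contrapT => /forallNP H; apply: nZ; apply: supp_line => k.
  by exists (iter k ( *:%R (uvar x)) v) => //; apply: weight_space_iter.
pose w := iter j ( *:%R (uvar x)) v; pose m := l + j%:R *: a.
have mw : weight_space h W m w by apply: weight_space_iter.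
have [k [wk0 yw]] : exists k, iter k ( *:%R (uvar y)) w <> 0 /\
    iter k.+1 ( *:%R (uvar y)) w = 0.
  apply: iter_first_zero => //; first exact: scaler0.
  apply: contrapT => /forallNP H; apply: nZ => c.
  have -> : l + c *: a = m + (j%:R - c) *: - a.
    by rewrite /m scalerN -scaleNr opprB -addrA -scalerDl [j%:R + _]addrC subrK.
  apply: supp_line => i.
  by exists (iter i ( *:%R (uvar y)) w) => //; apply: weight_space_iter.
have := sl2_string k mw xw; rewrite yw scaler0 => /esym E.
pose s := \sum_(i < k.+1) (dual_app m t - i%:R * dual_app a t).
have s0 : s = 0.
  apply: contrapT => /eqP sn0; apply: wk0.
  have := congr1 ( *:%R (s^-1%:A : uea g)) E.
  by rewrite scaler0 scalerA mulr_algl scalerA mulVf // !scale1r.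
have sE : s *+ 2 = (dual_app m t *+ 2 - k%:R * dual_app a t) *+ k.+1.
  rewrite /s; elim: (k) => [|i IH]; first by rewrite big_ord1 mul0r !subr0.
  by rewrite big_ord_recr /= mulrnDl IH; ring.
have : dual_app m t *+ 2 - k%:R * dual_app a t = 0.
  move: sE; rewrite s0 mul0rn => /esym/eqP; rewrite -[_ *+ k.+1]mulr_natr mulf_eq0.
  by rewrite ((pcharf0P F).1 char0) orbF => /eqP.
move=> E2; exists (k%:Z - (j.*2)%:Z).
move/eqP: E2; rewrite subr_eq0 => /eqP; rewrite /m dual_appD dual_appZ mulrnDl => E2.
rewrite -[LHS](addrK ((j%:R * dual_app a t) *+ 2)) E2.
rewrite intrB mulrBl; congr (_ * _ - _).
by rewrite -pmulrn -mulrnAl -muln2 natrM mulr_natr.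
Qed.
End Sl2.
End RootStrings.

(** * Coroots in a simple Lie algebra *)

Section SimpleRoots.
Import VectorInternalTheory.
Variables (F : fieldType) (g : finLieAlgType F) (h : cartan g).
Hypothesis simple_g : simple_lie g.
Local Notation N := (dim g).
Local Notation b := (root_basis h).
Local Notation wt := (@root_weight F g h).

Lemma simple_center0 (x : g) : (forall y, lie x y = 0) -> x = 0.
Proof.
move=> cx; have [[y [z yz]] ideals] := simple_g.
have [|x0|full] := ideals <[x]>%VS.
- by move=> u v /vlineP[c ->]; rewrite lieZr lieC cx oppr0 scaler0 mem0v.
- by apply/eqP; rewrite -memv0 -x0 memv_line.
- case: yz; have : y \in <[x]>%VS by rewrite full memvf.
  by case/vlineP => c ->; rewrite lieZl cx scaler0.
Qed.

Lemma span_ind (V : vectType F) (X : seq V) (P : V -> Prop) : P 0 ->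
  (forall a x y, P x -> P y -> P (a *: x + y)) ->
  (forall x, x \in X -> P x) -> forall x, x \in <<X>>%VS -> P x.
Proof.
move=> P0 Pl PX x; rewrite -[X]in_tupleE => /coord_span ->.
elim/big_rec: _ => [//|i y _ Py]; apply: Pl => //.
by apply: PX; apply: mem_nth.
Qed.

(** Evaluation on a basis of [T] maps to a space of dimension smaller than that of [h], so it has a
    nonzero kernel. *)
Lemma separating_vector (T : {vspace dual h}) : T != fullv ->
  exists2 y : lie_of h, y != 0 & forall t, t \in T -> dual_app t y = 0.
Proof.
move=> Tn; pose tb := vbasis T.
pose phi (y : lie_of h) : 'rV[F]_(\dim T) := \row_i dual_app tb`_i y.
have phil : linear phi by move=> a u v; apply/rowP => i; rewrite !mxE /dual_app linearP.
pose phiL : {linear lie_of h -> 'rV[F]_(\dim T)} :=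
  HB.pack phi (GRing.isLinear.Build _ _ _ _ phi phil).
have : lker (linfun phiL) != 0%VS.
  apply: contraNneq Tn => k0; rewrite -(dimv_leqif_eq (subvf T)).
  have := limg_ker_dim (linfun phiL) fullv; rewrite k0 capv0 dimv0 add0n => E.
  rewrite eqn_leq (dimvS (subvf _)) /= [X in (X <= _)%N](_ : _ = \dim {: lie_of h}).
    by rewrite -E (leq_trans (dimvS (subvf _))) // dimvf dim_matrix mul1r.
  by rewrite !dimvf; exact: muln1.
move=> kn0; pose y := vpick (lker (linfun phiL)); exists y; first by rewrite vpick0.
have : y \in lker (linfun phiL) by apply: memv_pick.
rewrite memv_ker lfunE /= => /eqP/rowP y0 t /coord_vbasis ->.
rewrite /dual_app sum_lfunE big1 // => i _; rewrite scale_lfunE.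
have := y0 i; rewrite !mxE => E; by rewrite [X in _ *: X]E scaler0.
Qed.

Lemma root_basis_neq0 (i : 'I_N) : b`_i != 0.
Proof.
apply: contraTneq (oner_neq0 F) => b0.
have := coord_free i i (basis_free (root_basis_basis h)).
by rewrite eqxx b0 linear0 => /esym/eqP; rewrite negbK.
Qed.

Lemma root_space0_mem (z : g) : root_space (0 : dual h) z -> z \in (lsub h).
Proof.
move=> rz; apply: (cartan_centralizer (c := h)) => y yh.
have := rz (vsproj (lsub h) y); rewrite dual_app0 scale0r => <-.
by rewrite /lsval vsprojK.
Qed.

Lemma lsval_sum J (r : seq J) (P : pred J) (c : J -> F) (y : J -> lie_of h) :
  lsval (\sum_(j <- r | P j) c j *: y j) = \sum_(j <- r | P j) c j *: lsval (y j).
Proof.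
elim/big_rec2: _ => [|j u v _ <-]; first exact: (linear0 (@lsval F g h)).
exact: lsval_linear.
Qed.

Lemma cartan_root_space0 (y : lie_of h) : root_space (0 : dual h) (lsval y).
Proof. by move=> t; rewrite -lie_ofE lie_of0 linear0 dual_app0 scale0r. Qed.

(* The span of the root vectors with weight outside [T] and of their brackets is an
   ideal. *)
Lemma coroots_outside_span (T : {vspace dual h}) (t : dual h) : T != fullv ->
  (forall (i j : 'I_N) (s : lie_of h), wt i \notin T -> wt j = - wt i ->
     lsval s = lie b`_i b`_j -> dual_app t s = 0) -> t = 0.
Proof.
move=> Tn tH.
pose I := [seq i <- enum 'I_N | wt i \notin T].
have mI i : (i \in I) = (wt i \notin T) by rewrite mem_filter mem_enum andbT.
pose P : {vspace g} := <<[seq b`_i | i : 'I_N <- I]>>%VS.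
pose Q : {vspace g} := <<[seq lie b`_i b`_j | i : 'I_N <- I, j : 'I_N <- I]>>%VS.
have bP (i : 'I_N) : wt i \notin T -> b`_i \in P.
  by move=> iT; apply: memv_span; apply: map_f; rewrite mI.
have rP ga z : root_space ga z -> ga \notin T -> z \in P.
  move=> rz gT; rewrite (root_basisE h z); apply: memv_suml => i _.
  have [E|ne] := eqVneq (wt i) ga; first by apply/memvZ/bP; rewrite E.
  by rewrite (root_coord rz ne) scale0r mem0v.
have PQ x y : x \in P -> y \in P -> lie x y \in Q.
  move=> xP yP; move: x xP; apply: span_ind.
  - by rewrite lie0l mem0v.
  - by move=> a u v Hu Hv; rewrite lieDl lieZl memvD // memvZ.
  move=> u /mapP[i iI ->]; move: y yP; apply: span_ind.
  - by rewrite lie0r mem0v.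
  - by move=> a v w Hv Hw; rewrite lieDr lieZr memvD // memvZ.
  by move=> v /mapP[j jI ->]; apply: memv_span; apply: allpairs_f.
have PI x : x \in P -> x \in (P + Q)%VS by apply: subvP; apply: addvSl.
have QI x : x \in Q -> x \in (P + Q)%VS by apply: subvP; apply: addvSr.
have ideal : lie_ideal (P + Q)%VS.
  move=> x y yPQ; rewrite (root_basisE h x) lie_suml; apply: memv_suml => k _.
  rewrite lieZl; apply: memvZ.
  have bkP i : wt k + wt i \notin T -> lie b`_k b`_i \in P.
    by apply: rP; apply: root_spaceB; apply: root_basisP.
  case/memv_addP: yPQ => u uP [v vQ ->]; rewrite lieDr; apply: memvD.
    move: u uP; apply: span_ind.
    - by rewrite lie0r mem0v.
    - by move=> a z w Hz Hw; rewrite lieDr lieZr memvD // memvZ.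
    move=> z /mapP[i iI ->]; have iT : wt i \notin T by rewrite -mI.
    have [kT|kT] := boolP (wt k \in T); last by apply/QI/PQ; apply: bP.
    by apply/PI/bkP; apply: contra iT => H; rewrite -[wt i](addKr (wt k)) memvD // memvN.
  move: v vQ; apply: span_ind.
  - by rewrite lie0r mem0v.
  - by move=> a z w Hz Hw; rewrite lieDr lieZr memvD // memvZ.
  move=> z /allpairsP[[i j] /= []]; rewrite !mI => iT jT ->.
  have [ijkT|ijkT] := boolP (wt k + (wt i + wt j) \in T); last first.
    apply: PI; apply: rP ijkT; apply: root_spaceB; first exact: root_basisP.
    by apply: root_spaceB; apply: root_basisP.
  have jac : lie b`_k (lie b`_i b`_j) = lie (lie b`_k b`_i) b`_j + lie b`_i (lie b`_k b`_j).
    have := lie_jacobi b`_k b`_i b`_j.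
    rewrite (lieC b`_j (lie _ _)) (lieC b`_j b`_k).
    have -> : lie b`_i (- lie b`_k b`_j) = - lie b`_i (lie b`_k b`_j).
      by rewrite -scaleN1r lieZr scaleN1r.
    by move=> /eqP; rewrite -addrA -opprD subr_eq0 addrC => /eqP.
  rewrite jac; apply/QI/memvD; apply: PQ; try exact: bP.
    apply: bkP; apply: contra jT => H.
    by rewrite -[wt j](addKr (wt k + wt i)) memvD ?memvN // -addrA.
  apply: bkP; apply: contra iT => H.
  by rewrite -[wt i](addKr (wt k + wt j)) memvD ?memvN // -addrA [wt j + _]addrC.
have [_ /(_ _ ideal)[I0|full]] := simple_g.
  (* If the ideal is zero, all weights lie in [T], and a vector of [h] annihilated by [T] is
     central. *)
  have allT i : wt i \in T.
    apply: contraT => iT; have : b`_i \in (P + Q)%VS by apply/PI/bP.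
    by rewrite I0 memv0 (negPf (root_basis_neq0 i)).
  have [y y0 yT] := separating_vector Tn.
  case/eqP: y0; apply: lsval_inj; rewrite linear0; apply: simple_center0 => z.
  rewrite (root_basisE h z) lie_sumr big1 // => i _.
  by rewrite lieZr root_basisP yT // scale0r scaler0.
(* The extension of [t] to [g] by zero on the nonzero weight spaces. By hypothesis it vanishes on
   the ideal, which is now all of [g]. *)
pose tau (z : g) := \sum_(i < N | wt i == 0) coord b i z * dual_app t (vsproj (lsub h) b`_i).
have tauD a u v : tau (a *: u + v) = a * tau u + tau v.
  rewrite /tau mulr_sumr -big_split; apply: eq_bigr => i _ /=.
  by rewrite linearP mulrDl mulrA.
have tau0 : tau 0 = 0 by rewrite /tau big1 // => i _; rewrite linear0 mul0r.
have tau_root (ga : dual h) z : root_space ga z -> ga != 0 -> tau z = 0.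
  move=> rz g0; rewrite /tau big1 // => i /eqP wi.
  by rewrite (root_coord (i := i) rz) ?mul0r // wi eq_sym.
have tau_h (y : lie_of h) : tau (lsval y) = dual_app t y.
  have {2}-> : y = \sum_(i < N | wt i == 0) coord b i (lsval y) *: (vsproj (lsub h) b`_i : lie_of h).
    apply: lsval_inj; rewrite lsval_sum {1}(root_basisE h (lsval y)).
    rewrite (bigID (fun i => wt i == 0)) /= [X in _ + X]big1 ?addr0; last first.
      by move=> i wi; rewrite (root_coord (cartan_root_space0 y) wi) scale0r.
    apply: eq_bigr => i /eqP wi.
    have vi : lsval (vsproj (lsub h) b`_i : lie_of h) = b`_i.
      by rewrite /lsval vsprojK // root_space0_mem // -wi; apply: root_basisP.
    by rewrite vi.
  rewrite /dual_app linear_sum /tau; apply: eq_bigr => i _.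
  by rewrite linearZ.
have tauPQ z : z \in (P + Q)%VS -> tau z = 0.
  case/memv_addP => u uP [v vQ ->].
  have -> : tau (u + v) = tau u + tau v by rewrite -[u]scale1r tauD mul1r scale1r.
  have -> : tau u = 0.
    move: u uP; apply: span_ind => // [a x y Hx Hy|x /mapP[i iI ->]].
      by rewrite tauD Hx Hy mulr0 addr0.
    apply: (tau_root _ _ (@root_basisP F g h i)); apply: contraTneq iI => wi0.
    by rewrite mI wi0 negbK mem0v.
  rewrite add0r; move: v vQ; apply: span_ind => // [a x y Hx Hy|].
    by rewrite tauD Hx Hy mulr0 addr0.
  move=> x /allpairsP[[i j] /= []]; rewrite !mI => iT jT ->.
  have rij : root_space (wt i + wt j) (lie b`_i b`_j).
    by apply: root_spaceB; apply: root_basisP.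
  have [w0|wn0] := eqVneq (wt i + wt j) 0; last exact: tau_root rij wn0.
  rewrite w0 in rij.
  have sE : lsval (vsproj (lsub h) (lie b`_i b`_j) : lie_of h) = lie b`_i b`_j.
    by rewrite /lsval vsprojK // root_space0_mem.
  rewrite -sE tau_h; apply: (tH i j) => //.
  by apply/eqP; rewrite -addr_eq0 addrC w0.
apply/lfunP => y; rewrite zero_lfunE -[LHS]/(dual_app t y) -tau_h.
by apply: tauPQ; rewrite full memvf.
Qed.
End SimpleRoots.

(** * Countability of the support *)

Section FiniteSupport.
Import VectorInternalTheory.
Variables (F : closedFieldType) (g : finLieAlgType F) (h : cartan g).
Hypothesis uncountableF : ~ countable [set: F]%classic.
Hypothesis char0 : [pchar F] =i pred0.
Hypothesis simple_g : simple_lie g.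
Local Notation S := (uh h).
Local Notation b := (root_basis h).
Local Notation wt := (@root_weight F g h).
Variables (W : lmodType (uea g)) (I : S -> Prop) (f0 : S).
Hypothesis suppI : supp h W = zeros I.
Hypotheses (If0 : I f0) (f00 : f0 != 0).

(** The restriction to the line of an element of [I] vanishes at all natural numbers, infinitely
    many points in characteristic zero. *)
Lemma zeros_line (l a : dual h) : (forall k : nat, supp h W (l + k%:R *: a)) ->
  forall c, supp h W (l + c *: a).
Proof.
rewrite suppI => H c u Iu; rewrite -on_lineE.
suff -> : on_line l a u = 0 by rewrite horner0.
apply/eqP; apply: contrapT => /negP nz.
pose rs : seq F := [seq k%:R | k <- iota 0 (size (on_line l a u))].
have urs : uniq rs.
  rewrite map_inj_in_uniq ?iota_uniq // => i j _ _ /eqP.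
  wlog ij : i j / (i <= j)%N.
    by case: (leqP i j) => [ij H'|/ltnW ji H' E]; [exact: H'|apply/esym/H'; rewrite // eq_sym].
  rewrite eq_sym -subr_eq0 -natrB // ((pcharf0P F).1 char0) subn_eq0 => ji.
  by apply/eqP; rewrite eqn_leq ij.
have := max_poly_roots nz _ urs; rewrite size_map size_iota ltnn => /(_ _)/negP; case=> //.
by apply/allP => z /mapP[k _ ->]; rewrite /root on_lineE (H k _ Iu).
Qed.

Let affine (T : {vspace dual h}) := exists l, forall t, t \in T -> supp h W (l + t).

Lemma affine_proper T : affine T -> T != fullv.
Proof.
move=> [l lT]; apply: contraTneq f00 => Tfull; rewrite negbK.
apply: contrapT => /negP/(character_nonzero uncountableF)[m]; case/negP.
have := lT (m - l); rewrite Tfull memvf addrC subrK suppI => /(_ isT f0 If0) ->.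
exact: eqxx.
Qed.

Lemma affine_maximal : (exists l, supp h W l) -> exists T, affine T /\
  forall T', affine T' -> (\dim T' <= \dim T)%N.
Proof.
move=> [l Zl]; pose P d := `[< exists T, affine T /\ \dim T = d >].
have ex : exists d, P d.
  exists 0%N; apply/asboolP; exists 0%VS; split; last exact: dimv0.
  by exists l => t; rewrite memv0 => /eqP ->; rewrite addr0.
have bd d : P d -> (d <= \dim {: dual h})%N.
  by move=> /asboolP[T [_ <-]]; apply/dimvS/subvf.
case: (ex_maxnP ex bd) => d /asboolP[T [aT dT]] dmax; exists T; split=> // T' aT'.
by rewrite dT; apply: dmax; apply/asboolP; exists T'.
Qed.

(** By maximality, the translate by [l] of [T + <[wt i]>] leaves the support, say at [l + t'], with
    [t'] equal to [t0] plus a multiple of [wt i]. If [dual_app t s] were nonzero, integrality would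
    restrict the parameter [a] of [l + t0 + a t] to a countable set, apart from finitely many
    exceptions. *)
Lemma affine_coroot T (i j : 'I_(dim g)) (s : lie_of h) (t : dual h) :
  affine T -> (forall T', affine T' -> (\dim T' <= \dim T)%N) ->
  wt i \notin T -> wt j = - wt i -> lsval s = lie b`_i b`_j -> t \in T ->
  dual_app t s = 0.
Proof.
move=> [l lT] Tmax iT wj sE tT; apply/eqP; apply: contrapT => /negP ts.
have ai : root_space (wt i) b`_i by apply: root_basisP.
have aj : root_space (- wt i) b`_j by rewrite -wj; apply: root_basisP.
have [t' [t'T nZ]] : exists t', t' \in (T + <[wt i]>)%VS /\ ~ supp h W (l + t').
  apply: contrapT => /forallNP H.
  have aT' : affine (T + <[wt i]>)%VS.
    by exists l => t' t'T; apply: contrapT => nZ; apply: (H t').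
  have := Tmax _ aT'; rewrite leqNgt => /negP; apply.
  rewrite ltn_neqAle dimvS ?addvSl // andbT.
  apply: contra iT => /eqP dE.
  have : (T == T + <[wt i]>)%VS by rewrite -(dimv_leqif_eq (addvSl _ _)) dE.
  by move=> /eqP ->; apply: subvP (addvSr _ _) _ (memv_line _).
case/memv_addP: t'T => t0 t0T [_ /vlineP[c0 ->] t'E].
have [u Iu un0] : exists2 u, I u & character (l + t') u != 0.
  apply: contrapT => H; apply: nZ; rewrite suppI => u Iu.
  by apply/eqP; apply: contrapT => /negP un0; apply: H; exists u.
(* Where [q] is nonzero, the line in direction [wt i] through [l + t0 + a t] leaves the support, so
   the integral alternative holds. *)
pose q := on_line (l + t') t u.
have q0 : q != 0.
  by apply: contraNneq un0 => q0; have := on_lineE (l + t') t u 0; rewrite scale0r addr0 -/q q0 horner0 => <-.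
have two : (2%:R : F) != 0 by rewrite ((pcharf0P F).1 char0).
have str a : q.[a] != 0 -> exists k : int,
    a = ((k%:~R * dual_app (wt i) s) / 2%:R - dual_app (l + t0) s) / dual_app t s.
  move=> qa.
  have Za : supp h W (l + (t0 + a *: t)) by apply: lT; rewrite memvD // memvZ.
  have [H|[k kE]] := supp_line_or_integral char0 ai aj sE zeros_line Za.
    case/negP: qa; rewrite on_lineE; apply/eqP.
    have := H c0; rewrite suppI => /(_ _ Iu) <-; congr character.
    by rewrite t'E -!addrA; congr (_ + (_ + _)); rewrite addrC.
  exists k; rewrite -kE addrA dual_appD dual_appZ -[_ *+ 2]mulr_natr mulfK //.
  by rewrite addrAC subrr add0r mulfK.
apply: uncountableF; have [rs qE] := closed_field_poly_normal q.
suff -> : [set: F]%classic = ([set` rs] `|` range (fun k : int =>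
    ((k%:~R * dual_app (wt i) s) / 2%:R - dual_app (l + t0) s) / dual_app t s))%classic.
  rewrite -bigcup2E; apply: bigcup_countable => // [[|[|k]]] _ //=.
    exact/finite_set_countable/finite_seq.
  by apply: sub_countable (card_image_le _ _) _.
rewrite predeqE => a; split=> // _; have [qa|/str[k ->]] := eqVneq q.[a] 0; last first.
  by right; exists k.
left; move: qa; rewrite qE hornerZ => /eqP.
by rewrite mulf_eq0 lead_coef_eq0 (negPf q0) /= -[_ == 0]/(root _ _) root_prod_XsubC.
Qed.

(** The maximal [T] is zero by [affine_coroot] and [coroots_outside_span]. Then every point of the
    support is integral against all brackets of opposite root vectors, and these brackets separate
    points. *)
Lemma supp_countable : countable (supp h W).
Proof.
have [ex|nex] := pselect (exists l, supp h W l); last first.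
  suff -> : supp h W = set0 by [].
  by rewrite predeqE => l; split=> // Zl; apply: nex; exists l.
have [T [aT Tmax]] := affine_maximal ex.
have Tn := affine_proper aT.
have T0 t : t \in T -> t = 0.
  move=> tT; apply: (coroots_outside_span simple_g Tn) => i j s iT wj sE.
  exact: affine_coroot aT Tmax iT wj sE tT.
(* Such a line would be an affine subspace of dimension 1, larger than the maximal one. *)
have line l i : wt i \notin T -> ~ (forall c, supp h W (l + c *: wt i)).
  move=> iT H; have aL : affine <[wt i]>%VS.
    by exists l => _ /vlineP[c ->].
  have := Tmax _ aL; rewrite dim_vline.
  have -> : wt i != 0 by apply: contraNneq iT => ->; rewrite mem0v.
  have -> : \dim T = 0%N.
    by apply/eqP; rewrite dimv_eq0 -subv0; apply/subvP => t /T0 ->; rewrite mem0v.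
  by [].
pose cor (p : 'I_(dim g) * 'I_(dim g)) : lie_of h := vsproj (lsub h) (lie b`_p.1 b`_p.2).
have ex_k (l : dual h) p : exists k : int, supp h W l -> wt p.1 \notin T -> wt p.2 = - wt p.1 ->
    dual_app l (cor p) *+ 2 = k%:~R * dual_app (wt p.1) (cor p).
  have [[Zl [iT wj]]|H] := pselect (supp h W l /\ (wt p.1 \notin T /\ wt p.2 = - wt p.1)); last first.
    by exists 0 => Zl iT wj; case: H.
  have ai : root_space (wt p.1) b`_p.1 by apply: root_basisP.
  have aj : root_space (- wt p.1) b`_p.2 by rewrite -wj; apply: root_basisP.
  have sE : lsval (cor p) = lie b`_p.1 b`_p.2.
    rewrite /lsval vsprojK //; apply: (root_space0_mem (h := h)).
    by rewrite -(subrr (wt p.1)); apply: root_spaceB.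
  have [/(line _ _ iT)//|[k kE]] := supp_line_or_integral char0 ai aj sE zeros_line Zl.
  by exists k.
(* The integers attached to all pairs of basis vectors form a finite table, so there are countably
   many tables; irrelevant pairs have an unconstrained entry. *)
pose ks (l : dual h) : {ffun 'I_(dim g) * 'I_(dim g) -> int} := [ffun p => sval (cid (ex_k l p))].
apply/countable_injP; exists (fun l => choice.pickle (ks l)) => l l' /set_mem Zl /set_mem Zl'.
move=> /(pcan_inj choice.pickleK) E.
apply/eqP; rewrite -subr_eq0; apply/eqP; apply: (coroots_outside_span simple_g Tn).
move=> i j s iT wj sE.
have Es : s = cor (i, j).
  by apply: lsval_inj; rewrite /cor /= /lsval vsprojK // -sE lsvalP.
have two : (2%:R : F) != 0 by rewrite ((pcharf0P F).1 char0).
have H (m : dual h) : supp h W m ->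
    dual_app m (cor (i, j)) *+ 2 = (ks m (i, j))%:~R * dual_app (wt i) (cor (i, j)).
  by move=> Zm; rewrite ffunE; case: cid => k /= ->.
apply: (mulIf two); rewrite mul0r mulr_natr Es /dual_app add_lfunE opp_lfunE.
by rewrite -!/(dual_app _ _) mulrnBl !H // E subrr.
Qed.

End FiniteSupport.

(** * The weighting module *)

Section WeightingStructure.
Variables (F : fieldType) (g : finLieAlgType F) (h : cartan g) (M : lmodType (uea g)).
Local Notation S := (uh h).
Local Notation MU := (res_uh h M).
Local Notation WM := (weighting h M).
Implicit Types (l m a : dual h).

Lemma weighting_sum I (r : seq I) (f : I -> WM) m :
  wfun (\sum_(i <- r) f i : WM) m = \sum_(i <- r) wfun (f i) m.
Proof. by elim/big_rec2: _ => [//|i x y _ <-]. Qed.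

Lemma wsingle0 l : wsingle l (0 : M) = 0.
Proof. by apply: wsumP => m /=; case: eqP => // _; rewrite fpi0. Qed.

Lemma wsingleD l (x y : M) : wsingle l (x + y) = (wsingle l x : WM) + wsingle l y.
Proof.
apply: wsumP => m; rewrite weighting_add /=.
by case: eqP => [_|_]; rewrite ?addr0 ?fpiD.
Qed.

Lemma wsingle_sum l I (r : seq I) (x : I -> M) :
  wsingle l (\sum_(i <- r) x i) = \sum_(i <- r) (wsingle l (x i) : WM).
Proof. by elim/big_rec2: _ => [|i u v _ <-]; rewrite ?wsingle0 ?wsingleD. Qed.

Lemma wsingle_scal l (c : F) (x : M) :
  wsingle l ((c%:A : uea g) *: x) = (c%:A : uea g) *: (wsingle l x : WM).
Proof.
apply: wsumP => m; rewrite weighting_scal /=.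
by case: eqP => [_|_]; rewrite ?scaler0 ?fpiZ.
Qed.

Lemma fiber_basis_weight_space l k (e : 'I_k -> M) : fiber_basis l e ->
  is_basis (weight_space h WM l) (fun i => wsingle l (e i) : res_F WM).
Proof.
move=> [ind gen].
have E (c : 'I_k -> F) m : wfun (\sum_i c i *: (wsingle l (e i) : res_F WM) : WM) m =
    \sum_i ((c i)%:A : S) *: (if m == l then fpi m (e i) else 0).
  by rewrite weighting_sum; apply: eq_bigr => i _; exact: weighting_scal.
split=> [i|v lv].
  by apply/weighting_weight_space => m ml; apply: wsingle_neq.
have v0 := (weighting_weight_space l (v : WM)).1 lv.
have [c cE] := gen (wfun (v : WM) l); exists (\row_i c i); split.
  apply: wsumP => m; rewrite E.
  have [->|ml] := eqVneq m l.
    by rewrite [LHS]cE; apply: eq_bigr => i _; rewrite mxE.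
  by rewrite [LHS]v0 // big1 // => i _; rewrite scaler0.
move=> d dE; apply/rowP => i; rewrite mxE; apply/eqP; rewrite -subr_eq0; apply/eqP.
apply: (ind (fun i => c i - d 0 i)).
under eq_bigr do rewrite scalerBl scalerBl.
rewrite sumrB -cE dE E eqxx subrr //.
Qed.

Lemma weighting_weight_module : fin_generated MU -> weight_module h WM.
Proof.
move=> fg; split=> [v|s w us wl w0 l ls|l].
- have [s sv] := wfun_fin (v : WM); exists (undup s).
  exists (fun l => wsingle l (frepr (wfun (v : WM) l))); split=> [l|].
    by apply/weighting_weight_space => m ml; apply: wsingle_neq.
  apply: wsumP => m; rewrite [RHS](weighting_sum (undup s)).
  have [ms|ms] := boolP (m \in undup s).
    rewrite (bigD1_seq m) ?undup_uniq //= eqxx freprK big1 ?addr0 // => l lm.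
    by rewrite eq_sym (negPf lm).
  rewrite [LHS]sv; last by rewrite -mem_undup.
  rewrite big1_seq // => l /andP[_ ls] /=; case: eqP => // ml.
  by rewrite ml ls in ms.
- apply: wsumP => m.
  have [->|ml] := eqVneq m l; last exact: ((weighting_weight_space l (w l : WM)).1 (wl l) m ml).
  have := congr1 (fun f : WM => wfun f l) w0.
  rewrite [X in X = _ -> _](weighting_sum s) (bigD1_seq l) //= big1 ?addr0 // => l' l'l.
  by apply: ((weighting_weight_space l' (w l' : WM)).1 (wl l')); rewrite eq_sym.
- have [k [e eb]] := fiber_basis_exists l fg.
  by exists k, (fun i => wsingle l (e i) : res_F WM); apply: fiber_basis_weight_space.
Qed.

(** The first clause describes the action on the weighting module; the second says that [u] has
    weight [a] under the adjoint action of [h]. *)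
Definition homogeneous a (u : uea g) :=
  (forall l x, u *: (wsingle l x : WM) = wsingle (l + a) (u *: x)) /\
  (forall y : lie_of h, uvar (lsval y) * u = u * uvar (lsval y) + dual_app a y *: u).

Lemma homogeneous_root a z : root_space a z -> homogeneous a (uvar z).
Proof.
move=> az; split=> [l x|y]; last first.
  rewrite -linearZ /= -az uvar_lieE addrC subrK.
  by [].
apply: wsumP => m; rewrite -[m](subrK a) /=.
have [E|ne] := eqVneq (m - a) l.
  rewrite (@weighting_root _ _ _ _ a z _ (m - a) x) //; last by rewrite E wsingleE.
  by rewrite E eqxx.
rewrite (@weighting_root _ _ _ _ a z _ (m - a) 0) //; last by rewrite wsingle_neq ?fpi0.
by rewrite scaler0 fpi0 (inj_eq (addIr a)) (negPf ne).
Qed.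

Lemma homogeneous_scal a (c : F) u : homogeneous a u -> homogeneous a (c *: u).
Proof.
move=> [H1 H2]; split=> [l x|y].
  by rewrite -mulr_algl -[LHS]scalerA -[X in _ = wsingle _ X]scalerA H1 wsingle_scal.
by rewrite -scalerAr H2 scalerDr scalerAl !scalerA mulrC.
Qed.

Lemma homogeneous1 : homogeneous 0 1.
Proof.
by split=> [l x|y]; rewrite ?scale1r ?addr0 // mulr1 mul1r dual_app0 scale0r addr0.
Qed.

Lemma homogeneousM a a' u v : homogeneous a u -> homogeneous a' v ->
  homogeneous (a + a') (u * v).
Proof.
move=> [H1 H2] [H1' H2']; split=> [l x|y].
  by rewrite -!scalerA H1' H1 -addrA [a' + a]addrC.
rewrite mulrA H2 mulrDl -mulrA H2' mulrDr mulrA -addrA; congr (_ + _).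
by rewrite -scalerAl -scalerAr -scalerDl dual_appD addrC.
Qed.

Lemma homogeneous_decomposition u : exists L : seq (dual h * uea g),
  (forall p, p \in L -> homogeneous p.1 p.2) /\ u = \sum_(p <- L) p.2.
Proof.
elim/uea_ind: u => [x|c|u v [L [HL ->]] [L' [HL' ->]]|u v [L [HL ->]] [L' [HL' ->]]].
- exists [seq (root_weight h i, coord (root_basis h) i x *: uvar (root_basis h)`_i) |
    i <- index_enum _].
  split=> [p /mapP[i _ ->]|].
    exact/homogeneous_scal/homogeneous_root/root_basisP.
  rewrite big_map {1}(root_basisE h x) linear_sum; apply: eq_bigr => i _.
  exact: linearZ_LR.
- exists [:: (0, c%:A)]; split=> [p|]; last by rewrite big_seq1.
  by rewrite inE => /eqP ->; apply: homogeneous_scal homogeneous1.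
- exists (L ++ L'); rewrite big_cat; split=> // p.
  by rewrite mem_cat => /orP[/HL|/HL'].
- exists [seq (p.1 + q.1, p.2 * q.2) | p <- L, q <- L']; split.
    by move=> p /allpairsP[[q r] /= [qL rL ->]]; apply: homogeneousM; [apply: HL|apply: HL'].
  by rewrite big_allpairs_dep mulr_suml; apply: eq_bigr => p _; rewrite mulr_sumr.
Qed.

(** Choose [y] on which the weight of the first term is nonzero. The operator [ad y] minus that
    value removes the first term, while it multiplies the whole sum, which commutes with [y], by a
    nonzero scalar; induction on the number of terms concludes. *)
Lemma homogeneous_nonzero_sum (L : seq (dual h * uea g)) :
  (forall p, p \in L -> homogeneous p.1 p.2 /\ p.1 != 0) ->
  (forall y : lie_of h, uvar (lsval y) * (\sum_(p <- L) p.2) =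
                        (\sum_(p <- L) p.2) * uvar (lsval y)) ->
  \sum_(p <- L) p.2 = 0.
Proof.
move: {2}(size L) (erefl (size L)) => n.
elim: n L => [|n IH] [|p L] //= ; rewrite ?big_nil // => -[sL] HL comm.
have [Hp p0] := HL p (mem_head _ _).
have [y] := dual_neq p0; rewrite dual_app0 subr0 => py.
set v := \sum_(q <- p :: L) q.2 in comm *.
pose L' := [seq (q.1, (dual_app q.1 y - dual_app p.1 y) *: q.2) | q <- L].
have ad0 : \sum_(q <- p :: L) dual_app q.1 y *: q.2 = 0.
  have := comm y; rewrite /v mulr_sumr mulr_suml => /eqP; rewrite -subr_eq0 -sumrB => /eqP E.
  rewrite -[RHS]E big_seq [RHS]big_seq; apply: eq_bigr => q qL.
  by have [[_ H] _] := HL q qL; rewrite H [RHS]addrC addKr.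
have vE : \sum_(q <- L') q.2 = - dual_app p.1 y *: v.
  rewrite big_map /=; under eq_bigr do rewrite scalerBl.
  rewrite sumrB -scaler_sumr /v big_cons scaleNr scalerDr opprD; congr (_ - _).
  by move: ad0; rewrite big_cons addrC => /eqP; rewrite addr_eq0 => /eqP.
have : \sum_(q <- L') q.2 = 0.
  apply: IH => [|q /mapP[q' q'L ->]|z]; first by rewrite size_map.
    have [|Hq q0] := HL q'; first by rewrite inE q'L orbT.
    by split=> //; apply: homogeneous_scal.
  by rewrite vE -scalerAl -scalerAr comm.
rewrite vE => /(congr1 ( *:%R (- dual_app p.1 y)^-1)).
by rewrite scaler0 scalerA mulVf ?oppr_eq0 // scale1r.
Qed.

(** The terms of nonzero weight in a decomposition of [u] sum to zero, since this sum also commutes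
    with [h]. The weight zero terms act in place on each fiber. *)
Lemma commutant_wsingle u l x : commutant h u ->
  u *: (wsingle l x : WM) = wsingle l (u *: x).
Proof.
move=> cu; have [L [HL uE]] := homogeneous_decomposition u.
pose L0 := [seq p <- L | p.1 == 0]; pose L1 := [seq p <- L | p.1 != 0].
have uE' : u = \sum_(p <- L0) p.2 + \sum_(p <- L1) p.2.
  by rewrite !big_filter uE (bigID (fun p => p.1 == 0)).
have H0 p : p \in L0 -> homogeneous 0 p.2.
  by rewrite mem_filter => /andP[/eqP p0 /HL]; rewrite p0.
have c0 (y : lie_of h) : uvar (lsval y) * (\sum_(p <- L0) p.2) = (\sum_(p <- L0) p.2) * uvar (lsval y).
  rewrite mulr_sumr mulr_suml big_seq [RHS]big_seq; apply: eq_bigr => p /H0[_ ->].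
  by rewrite dual_app0 scale0r addr0.
have L10 : \sum_(p <- L1) p.2 = 0.
  apply: homogeneous_nonzero_sum => [p|y].
    by rewrite mem_filter => /andP[p0 /HL].
  have -> : \sum_(p <- L1) p.2 = u - \sum_(p <- L0) p.2 by rewrite uE' addrC addKr.
  have := cu (uvar y); rewrite /uincl ulift_var /= => cy.
  by rewrite mulrBr mulrBl c0 cy.
rewrite uE' L10 addr0 !scaler_suml wsingle_sum big_seq [RHS]big_seq.
by apply: eq_bigr => p /H0[H _]; rewrite H addr0.
Qed.

End WeightingStructure.

(** * Traces and coherence *)

Section CoherentFamily.
Variables (F : closedFieldType) (g : finLieAlgType F) (h : cartan g) (M : lmodType (uea g)).
Hypothesis uncountableF : ~ countable [set: F]%classic.
Hypothesis char0 : [pchar F] =i pred0.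
Hypothesis simple_g : simple_lie g.
Local Notation S := (uh h).
Local Notation n := (\dim {: lie_of h}).
Local Notation MU := (res_uh h M).
Local Notation WM := (weighting h M).
Local Notation Z := (supp h (weighting1 h M)).

Lemma character_meval (l : dual h) (a : S) : character l a =
  mpoly.meval (fun i => dual_app l (vbasis {: lie_of h})`_i) (ulift (uh_poly h) a).
Proof.
elim/uea_ind: a => [y|c|a b IHa IHb|a b IHa IHb].
- rewrite character_var ulift_var /= /uh_poly_fun.
  rewrite (big_morph (mpoly.meval _) (mpoly.mevalD _) (mpoly.meval0 _)).
  rewrite {1}(coord_vbasis (memvf y)) /dual_app linear_sum; apply: eq_bigr => i _.
  by rewrite mpoly.mevalZ mpoly.mevalXU linearZ.
- by rewrite character_scal ulift_scal mpoly.mevalZ mpoly.meval1 mulr1.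
- by rewrite characterD raddfD mpoly.mevalD /= IHa IHb.
- by rewrite characterM rmorphM mpoly.mevalM /= IHa IHb.
Qed.

Definition frame_coefs d : set (S^o) :=
  [set f : S | exists e : 'I_d -> MU, independent e /\ frame e f]%classic.

Definition frame_ideal d (a : S) : Prop := @in_span S (S^o) (frame_coefs d) a.

Lemma frame_ideal_ideal d : ideal_pred (frame_ideal d).
Proof. by split=> [|a u v Iu Iv]; [exact: in_span0|exact: in_spanP]. Qed.

Lemma frame_ideal_coef d f : frame_coefs d f -> frame_ideal d f.
Proof.
by move=> Cf; exists 1%N, (fun=> 1), (fun=> f); split=> //; rewrite big_ord1 scale1r.
Qed.

Lemma frame_ideal_sub d (D : S -> Prop) : ideal_pred D ->
  (forall f, frame_coefs d f -> D f) -> forall a, frame_ideal d a -> D a.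
Proof.
move=> iD HD a [k [c [f [Cf ->]]]]; apply: ideal_sum => // i.
exact: (idealM (c i) iD (HD _ (Cf i))).
Qed.

Lemma frame_is_rank d (e : 'I_d -> MU) (f : S) :
  independent e -> f != 0 -> frame e f -> is_rank h M d.
Proof. exact: frame_has_dim. Qed.

(** Off the support, a lifted fiber basis is a frame, so its size is the rank by uniqueness of
    dimension. This gives the degree of the family. *)
Lemma outside_supp_frame d l : fin_generated MU -> is_rank h M d -> ~ Z l ->
  exists (e : 'I_d -> MU) (f : S),
    [/\ independent e, character l f != 0, frame e f & fiber_basis l (e : 'I_d -> M)].
Proof.
move=> fg rk nZ; have pl : pure_at M l.
  by apply: contrapT => npl; apply: nZ; apply/supp_weighting1.
have [k [e [f [ie fl fe eb]]]] :=
  pure_frame uncountableF (simple_center0 simple_g) char0 fg pl.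
have f0 : f != 0 by apply: contraNneq fl => ->; rewrite character0.
have kd : k = d by apply: has_dim_unique (frame_is_rank ie f0 fe) rk.
by subst k; exists e, f.
Qed.

(** Inclusion in the zero set is [frame_pure]; the converse holds because a point outside the
    support has a frame whose coefficient is nonzero there. *)
Lemma supp_zeros d : fin_generated MU -> is_rank h M d -> Z = zeros (frame_ideal d).
Proof.
move=> fg rk; rewrite predeqE => l; split=> [Zl|zl].
  apply: frame_ideal_sub => [|f [e [ie fe]]].
    split=> [|a u v u0 v0]; first exact: character0.
    by rewrite characterD characterM u0 v0 mulr0 addr0.
  apply/eqP; apply: contrapT => /negP fl.
  by apply: ((supp_weighting1 M l).1 Zl); apply: frame_pure ie fe fl.
apply: contrapT => nZ; have [e [f [ie fl fe _]]] := outside_supp_frame fg rk nZ.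
by case/eqP: fl; apply: zl; apply: frame_ideal_coef; exists e.
Qed.

Lemma coherent_weighting : (2 <= \dim h)%N -> fin_generated MU ->
  exists d, is_rank h M d /\ coherent_family WM (~` Z)%classic d.
Proof.
move=> n2 fg; have [d [e0 [f0 [ie0 f00 fe0]]]] := frame_exists fg.
have rk := frame_is_rank ie0 f00 fe0.
have ZE := supp_zeros fg rk.
have If0 : frame_ideal d f0 by apply: frame_ideal_coef; exists e0.
have cZ : countable (zeros (frame_ideal d)).
  rewrite -ZE; exact: (supp_countable uncountableF char0 simple_g ZE If0 f00).
exists d; split=> //; split.
- by rewrite setCK ZE; apply: countable_zeros_finite => //; apply: frame_ideal_ideal.
- exact: weighting_weight_module.
- move=> l nZ; have [e [f [ie fl fe eb]]] := outside_supp_frame fg rk nZ.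
  by exists (fun i => wsingle l (e i : M) : res_F WM); apply: fiber_basis_weight_space.
move=> u cu; pose uM (m : MU) : MU := u *: (m : M).
have uMl : linear uM.
  move=> a x y; rewrite /uM -[a *: x]/(uincl a *: (x : M)) scalerDr; congr (_ + _).
  by rewrite -[RHS]/(uincl a *: (u *: (x : M))) !scalerA cu.
have [A0 A0E] := frame_mx (fun j => uM (e0 j)) fe0.
(* The ideal of denominators of the fraction [\tr A0 / f0], the trace of [u]. It contains every
   frame coefficient, since [frame_trace] compares any two frames. *)
pose D a := exists p, a * \tr A0 = f0 * p.
have iD : ideal_pred D.
  split=> [|a v w [p Ep] [p' Ep']]; first by exists 0; rewrite mul0r mulr0.
  by exists (a * p + p'); rewrite mulrDl -mulrA Ep Ep' mulrDr mulrCA.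
have ID : forall a, frame_ideal d a -> D a.
  apply: frame_ideal_sub => // f [e [ie fe]].
  have [->|fn0] := eqVneq f 0; first by case: iD.
  have [A AE] := frame_mx (fun j => uM (e j)) fe; exists (\tr A).
  by rewrite (frame_trace uMl ie0 ie f00 fn0 fe0 fe A0E AE).
have n2' : (2 <= n)%N by rewrite dimvf.
pose i : 'I_n := Ordinal (ltnW n2'); pose j : 'I_n := Ordinal n2'.
have ij : i != j by [].
(* Two denominators in different variables are available because [dim h] is at least 2; by [hartogs]
   the trace is an element [T] of [S]. *)
have U := countable_zeros_univariate uncountableF (frame_ideal_ideal d) cZ.
have [q q0 /ID[p Ep]] := U i; have [q' q'0 /ID[p' Ep']] := U j.
have [T TE] := hartogs uncountableF ij q0 q'0 f00 Ep Ep'.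
exists (fun l => character l T).
  by exists (ulift (uh_poly h) T) => l; apply: character_meval.
move=> l nZ; have [e [f [ie fl fe eb]]] := outside_supp_frame fg rk nZ.
have fn0 : f != 0 by apply: contraNneq fl => ->; rewrite character0.
have [A AE] := frame_mx (fun j => uM (e j)) fe.
have trA : \tr A = f * T.
  apply: (mulfI f00); rewrite (frame_trace uMl ie0 ie f00 fn0 fe0 fe A0E AE) TE.
  exact: mulrCA.
exists d, (fun i => wsingle l (e i : M) : res_F WM).
(* At [l] the coefficient [f] is invertible, so [A / f] specializes to the matrix of [u] on the
   weight space. *)
exists (\matrix_(i, j) ((character l f)^-1 * character l (A i j))).
split; first exact: fiber_basis_weight_space.
split=> [k|]; last first.
  rewrite /mxtrace; under eq_bigr do rewrite mxE.
  by rewrite -mulr_sumr -character_sum -/(mxtrace A) trA characterM mulKf.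
rewrite [LHS](commutant_wsingle _ _ cu).
have fE : (character l f)%:A *: fpi l (u *: (e k : M)) =
    \sum_i (character l (A i k))%:A *: fpi l (e i : M) :> fib M l.
  rewrite -fib_scale_character -fpi_uincl.
  rewrite -[uincl f *: _]/(f *: (uM (e k))) AE fpi_sum; apply: eq_bigr => i' _.
  by rewrite -fib_scale_character; exact: fpi_uincl.
apply: wsumP => m; rewrite [RHS](weighting_sum (index_enum _)).
have [->|ml] := eqVneq m l; last first.
  rewrite [LHS]wsingle_neq // big1 // => i' _.
  transitivity (((\matrix_(i, j) ((character l f)^-1 * character l (A i j))) i' k)%:A *:
    wfun (wsingle l (e i' : M)) m); first exact: weighting_scal.
  by rewrite wsingle_neq // scaler0.
rewrite [LHS]wsingleE -[LHS](fib_scaleVK _ fl) fE scaler_sumr; apply: eq_bigr => i' _.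
transitivity (((\matrix_(i, j) ((character l f)^-1 * character l (A i j))) i' k)%:A *:
    wfun (wsingle l (e i' : M)) l); last exact/esym/weighting_scal.
by rewrite wsingleE mxE !scalerA mulr_algl scalerA.
Qed.

End CoherentFamily.

(** * Uncountability of the real and complex numbers *)

Section Uncountable.
Local Open Scope classical_set_scope.
Import Order.TTheory Num.Theory.

Lemma real_uncountable (R : realType) : ~ countable [set: R].
Proof.
move=> /countable_injP[f finj].
pose s k : R := match pselect (exists x, f x = k) with
  | left e => sval (cid e) | right _ => 0 end.
have sf x : s (f x) = x.
  rewrite /s; case: pselect => [e|[]]; last by exists x.
  by case: cid => y /= fy; apply: finj fy; apply: mem_set.
(* [x] is in the intersection of nested intervals, the [k]-th one avoiding [s k]. *)
pose step k (ab : R * R) := let m := (ab.1 + ab.2) / 2 in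
  (* The second interval stops strictly before [m], because [s k] may be equal to [m]. *)
  if s k < m then (m, ab.2) else (ab.1, (ab.1 + m) / 2).
pose J := fix J k := if k is k'.+1 then step k' (J k') else (0, 1).
have Jlt k : (J k).1 < (J k).2.
  elim: k => [|k IH] /=; first exact: ltr01.
  by rewrite /step; case: ifP => _ /=; move: IH; case: (J k) => a b /=; lra.
have Jle k : (J k).1 <= (J k.+1).1 /\ (J k.+1).2 <= (J k).2.
  by have := Jlt k; rewrite /= /step; case: ifP => _ /=; case: (J k) => a b /=; split; lra.
have mono k i : (J k).1 <= (J (k + i)%N).1 /\ (J (k + i)%N).2 <= (J k).2.
  elim: i => [|i [IH1 IH2]]; first by rewrite addn0.
  have [H1 H2] := Jle (k + i)%N; rewrite addnS.
  by split; [apply: le_trans IH1 H1|apply: le_trans H2 IH2].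
have cross k i : (J k).1 <= (J i).2.
  have [ki|/ltnW ik] := leqP k i.
    have [H _] := mono k (i - k)%N; rewrite subnKC // in H.
    by apply: le_trans H (ltW (Jlt i)).
  have [_ H] := mono i (k - i)%N; rewrite subnKC // in H.
  by apply: le_trans (ltW (Jlt k)) H.
pose E := range (fun k => (J k).1).
have supE : has_sup E.
  by split; [exists (J 0%N).1, 0%N|exists (J 0%N).2 => _ [k _ <-]; apply: cross].
pose x := sup E.
have lo k : (J k).1 <= x by apply: sup_upper_bound => //; exists k.
have hi k : x <= (J k).2.
  by apply: ge_sup; [exists (J 0%N).1, 0%N|move=> _ [i _ <-]; apply: cross].
have := lo (f x).+1; have := hi (f x).+1; rewrite /= /step sf.
have := lo (f x); have := Jlt (f x).
by case: (J (f x)) => a b /=; case: (ltP x) => /=; lra.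
Qed.

Lemma complex_uncountable (R : realType) : ~ countable [set: R[i]].
Proof.
move=> /countable_injP[f finj]; apply: (@real_uncountable R).
apply/countable_injP; exists (fun x => f (x%:C)%C) => x y _ _ E.
by have [] := finj _ _ (mem_set I) (mem_set I) E.
Qed.
End Uncountable.

Theorem corollary4p7 (R : realType) (g : finLieAlgType R[i]) (h : cartan g)
    (M : lmodType (uea g)) :
  simple_lie g -> (2 <= \dim h)%N ->
  in_frakA h M -> torsion_free (res_uh h M) ->
  exists d, is_rank h M d /\
    coherent_family (weighting h M) (~` supp h (weighting1 h M))%classic d.
Proof.
move=> simple_g n2 [_ fg] _.
apply: coherent_weighting => //; first exact: complex_uncountable.
exact: Num.Theory.pchar_num.
Qed.
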